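(* For every connected Lie subgroup $G\subseteq SL_2(\mathbb{R})$ there exists a 2-dimensional manifold with density $(M^2,g,\phi)$ whose $\nabla^\phi$-holonomy group $Hol^\phi$ is $G$.
   Context: A manifold with density $(M,g,\phi)$ is a smooth connected manifold $M$ with a Riemannian metric $g$ and a smooth function $\phi:M\to\mathbb{R}$. Let $\nabla$ be the Levi-Civita connection of $g$. The weighted connection is the torsion-free affine connection $\nabla^\phi_X Y=\nabla_X Y-d\phi(X)Y-d\phi(Y)X$. For $p\in M$, $Hol^\phi_p$ is the group of all linear maps $T_pM\to T_pM$ obtained by $\nabla^\phi$-parallel translation along piecewise $C^1$ loops based at $p$. Choosing a basis of $T_pM$ identifies $Hol^\phi_p$ with a subgroup of $GL_n(\mathbb{R})$ ($n=\dim M$), well defined up to conjugation and independent of $p$ up to conjugation; ''$Hol^\phi$ is $G$'' means that it equals $G$ for a suitable choice of basis. *)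

(* Defs.v *)
From HB Require Import structures.
From mathcomp Require Import all_boot all_order all_algebra.
From mathcomp Require Import all_classical all_reals all_analysis.
Set Implicit Arguments.
Unset Strict Implicit.
Unset Printing Implicit Defensive.
Import Order.TTheory GRing.Theory Num.Theory.
Import numFieldNormedType.Exports.
Local Open Scope classical_set_scope.
Local Open Scope ring_scope.

(* [Ck_on k U f] and [smooth_on U f] are meant for open [U] and
   finite-dimensional [V]; C^(k+1) is "differentiable, and every directional
   derivative x |-> df_x(v) is C^k". *)
Fixpoint Ck_on (R : realType) (V W : normedModType R) (k : nat) (U : set V)
    (f : V -> W) : Prop :=
  match k with
  | 0 => forall x, U x -> {for x, continuous f}
  | k'.+1 => (forall x, U x -> differentiable f x) /\
             (forall v : V, Ck_on k' U (fun x => 'd f x v))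
  end.

Definition smooth_on (R : realType) (V W : normedModType R) (U : set V)
    (f : V -> W) : Prop :=
  forall k, Ck_on k U f.

(* A smooth n-manifold is given by a smooth atlas, i.e. an indexed family of
   charts. [chart i] and [chart_inv i] are total functions, meaningful only on
   [chart_dom i] and on its image respectively. *)
Record manifold (R : realType) (n : nat) := Manifold {
  mspace :> topologicalType ;
  chart_index : Type ;
  chart_dom : chart_index -> set mspace ;
  chart : chart_index -> mspace -> 'rV[R]_n ;
  chart_inv : chart_index -> 'rV[R]_n -> mspace ;
  manifold_hausdorff : hausdorff_space mspace ;
  manifold_second_countable : @second_countable mspace ;
  chart_dom_cover : forall p, exists i, chart_dom i p ;
  chart_dom_open : forall i, open (chart_dom i) ;
  chart_image_open : forall i, open (chart i @` chart_dom i) ;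
  chartK : forall i p, chart_dom i p -> chart_inv i (chart i p) = p ;
  chart_continuous : forall i, {within chart_dom i, continuous (chart i)} ;
  chart_inv_continuous :
    forall i, {within chart i @` chart_dom i, continuous (chart_inv i)} ;
  transition_smooth : forall i j,
    smooth_on (chart i @` (chart_dom i `&` chart_dom j))
              (chart j \o chart_inv i) }.

Arguments chart_index {R n} m.
Arguments chart_dom {R n m} i.
Arguments chart {R n m} i.
Arguments chart_inv {R n m} i.

Definition chart_image (R : realType) (n : nat) (M : manifold R n)
    (i : chart_index M) : set 'rV[R]_n := chart i @` chart_dom i.

Definition transition (R : realType) (n : nat) (M : manifold R n)
    (i j : chart_index M) : 'rV[R]_n -> 'rV[R]_n :=
  chart j \o chart_inv i.

(* A tangent vector at p is the family of its components in the charts around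
   p, related by the differentials of the transition maps. Components in the
   charts that do not contain p are set to 0, so that equality of families is
   equality of tangent vectors. *)
Definition tangent_pred (R : realType) (n : nat) (M : manifold R n) (p : M) :
    {pred (chart_index M -> 'rV[R]_n)} :=
  mem [set v : chart_index M -> 'rV[R]_n |
    (forall i j, chart_dom i p -> chart_dom j p ->
       v j = 'd (transition i j) (chart i p) (v i)) /\
    (forall i, ~ chart_dom i p -> v i = 0)].

Lemma tangent_submod_closed (R : realType) (n : nat) (M : manifold R n)
  (p : M) : submod_closed (tangent_pred p).
Proof.
split; first by apply/mem_set; split=> // i j _ _; rewrite linear0.
move=> a u v /set_mem[uE u0] /set_mem[vE v0]; apply/mem_set.
split=> [i j ip jp|i ip].
  rewrite [RHS]linearP.
  by rewrite -(uE i j ip jp) -(vE i j ip jp).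
have -> : (a *: u + v) i = a *: u i + v i by [].
by rewrite (u0 i ip) (v0 i ip) scaler0 addr0.
Qed.

HB.instance Definition _ (R : realType) (n : nat) (M : manifold R n) (p : M) :=
  GRing.isSubmodClosed.Build R (chart_index M -> 'rV[R]_n) (tangent_pred p)
    (tangent_submod_closed p).

Record tangent (R : realType) (n : nat) (M : manifold R n) (p : M) := Tangent {
  components : chart_index M -> 'rV[R]_n ;
  _ : components \in tangent_pred p }.

Section TangentLmodule.
Context (R : realType) (n : nat) (M : manifold R n) (p : M).

HB.instance Definition _ := [isSub for @components R n M p].
HB.instance Definition _ := [Choice of tangent p by <:].
HB.instance Definition _ := [SubChoice_isSubLmodule of tangent p by <:].

End TangentLmodule.

Definition smooth_function (R : realType) (n : nat) (M : manifold R n)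
    (f : M -> R) : Prop :=
  forall i : chart_index M, smooth_on (chart_image i) (f \o chart_inv i).

(* [metric_coef g i x u v] is g(u, v) at the point of coordinates x in the
   chart i, where u and v are given by their components in that chart. *)
Record riemannian_metric (R : realType) (n : nat) (M : manifold R n) :=
  RiemannianMetric {
  metric_coef :> chart_index M -> 'rV[R]_n -> 'rV[R]_n -> 'rV[R]_n -> R ;
  metric_linear : forall i x v, chart_image i x ->
    scalar (metric_coef i x ^~ v) ;
  metric_sym : forall i x u v, chart_image i x ->
    metric_coef i x u v = metric_coef i x v u ;
  metric_posdef : forall i x u, chart_image i x -> u != 0 ->
    0 < metric_coef i x u u ;
  metric_smooth : forall i u v,
    smooth_on (chart_image i) (fun x => metric_coef i x u v) ;
  metric_transition : forall i j p u v, chart_dom i p -> chart_dom j p ->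
    metric_coef i (chart i p) u v =
    metric_coef j (chart j p) ('d (transition i j) (chart i p) u)
                              ('d (transition i j) (chart i p) v) }.

Record manifold_with_density (R : realType) (n : nat) := ManifoldWithDensity {
  dmanifold :> manifold R n ;
  density_nonempty : [set: dmanifold] !=set0 ;
  density_connected : connected [set: dmanifold] ;
  metric : riemannian_metric dmanifold ;
  density : dmanifold -> R ;
  density_smooth : smooth_function density }.

(* The coefficients of an affine connection: in the chart i, for vector fields
   X and Y written in coordinates,
     (nabla_X Y)(x) = dY_x(X x) + Gamma i x (X x) (Y x). *)
Definition connection_coef (R : realType) (n : nat) (M : manifold R n) :=
  chart_index M -> 'rV[R]_n -> 'rV[R]_n -> 'rV[R]_n -> 'rV[R]_n.

Record affine_connection (R : realType) (n : nat) (M : manifold R n)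
    (Gamma : connection_coef M) : Prop := AffineConnection {
  connection_linearl : forall i x v, chart_image i x ->
    linear (Gamma i x ^~ v) ;
  connection_linearr : forall i x u, chart_image i x -> linear (Gamma i x u) ;
  connection_smooth : forall i u v,
    smooth_on (chart_image i) (fun x => Gamma i x u v) ;
  connection_transition : forall i j p u v, chart_dom i p -> chart_dom j p ->
    'd (transition i j) (chart i p) (Gamma i (chart i p) u v) =
    'd (fun x => 'd (transition i j) x v) (chart i p) u +
    Gamma j (chart j p) ('d (transition i j) (chart i p) u)
                        ('d (transition i j) (chart i p) v) }.

Definition torsion_free (R : realType) (n : nat) (M : manifold R n)
    (Gamma : connection_coef M) : Prop :=
  forall i x u v, chart_image i x -> Gamma i x u v = Gamma i x v u.

Definition metric_compatible (R : realType) (n : nat) (M : manifold R n)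
    (g : riemannian_metric M) (Gamma : connection_coef M) : Prop :=
  forall i x u v w, chart_image i x ->
    'd (fun y => g i y v w) x u =
    g i x (Gamma i x u v) w + g i x v (Gamma i x u w).

Definition levi_civita (R : realType) (n : nat) (M : manifold R n)
    (g : riemannian_metric M) (Gamma : connection_coef M) : Prop :=
  [/\ affine_connection Gamma, torsion_free Gamma & metric_compatible g Gamma].

(* nabla^phi_X Y = nabla_X Y - dphi(X) Y - dphi(Y) X *)
Definition weighted (R : realType) (n : nat) (M : manifold R n) (phi : M -> R)
    (Gamma : connection_coef M) : connection_coef M :=
  fun i x u v => Gamma i x u v - 'd (phi \o chart_inv i) x u *: v
                               - 'd (phi \o chart_inv i) x v *: u.

(* Derivative along J: one-sided at the end points when J is an interval. *)
Definition deriv_within (R : realType) (V : normedModType R) (J : set R)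
    (f : R -> V) (t : R) (l : V) : Prop :=
  (s - t)^-1 *: (f s - f t) @[s --> within J t^'] --> l.

Definition C1_on (R : realType) (n : nat) (M : manifold R n) (J : set R)
    (gamma : R -> M) : Prop :=
  {within J, continuous gamma} /\
  forall i : chart_index M, exists v : R -> 'rV[R]_n,
    {within J `&` gamma @^-1` chart_dom i, continuous v} /\
    forall t, J t -> chart_dom i (gamma t) ->
      deriv_within J (chart i \o gamma) t (v t).

Definition piece (R : realType) (s : seq R) (k : nat) : set R :=
  `[nth 0 (0 :: s) k, nth 0 (0 :: s) k.+1].

(* A piecewise C^1 loop at p, parametrized by [0, 1] and C^1 on each closed
   piece of the subdivision 0 :: s of [0, 1]. *)
Definition piecewise_C1_loop (R : realType) (n : nat) (M : manifold R n)
    (p : M) (s : seq R) (gamma : R -> M) : Prop :=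
  [/\ itv_partition 0 1 s,
      {within `[0, 1], continuous gamma},
      forall k, (k < size s)%N -> C1_on (piece s k) gamma,
      gamma 0 = p & gamma 1 = p].

(* V is a parallel vector field along gamma: in every chart,
   V' + Gamma(gamma', V) = 0 on each piece of the subdivision. The one-sided
   derivatives make V continuous across the subdivision points. *)
Definition parallel_along (R : realType) (n : nat) (M : manifold R n)
    (Gamma : connection_coef M) (s : seq R) (gamma : R -> M)
    (V : R -> chart_index M -> 'rV[R]_n) : Prop :=
  (forall t, `[0, 1]%classic t -> V t \in tangent_pred (gamma t)) /\
  forall k i t, (k < size s)%N -> piece s k t -> chart_dom i (gamma t) ->
    exists v : 'rV[R]_n,
      deriv_within (piece s k) (chart i \o gamma) t v /\
      deriv_within (piece s k) (V ^~ i) t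
        (- Gamma i (chart i (gamma t)) v (V t i)).

Definition holonomy (R : realType) (n : nat) (M : manifold R n)
    (Gamma : connection_coef M) (p : M) : set {linear tangent p -> tangent p} :=
  [set L | exists (s : seq R) (gamma : R -> M),
     piecewise_C1_loop p s gamma /\
     forall v : tangent p, exists V : R -> chart_index M -> 'rV[R]_n,
       [/\ parallel_along Gamma s gamma V,
           V 0 = components v & V 1 = components (L v)]].

Arguments holonomy {R n M} Gamma p.

Definition is_basis (R : realType) (n : nat) (M : manifold R n) (p : M)
    (e : 'I_n -> tangent p) : Prop :=
  bijective (fun a : 'I_n -> R => \sum_(i < n) a i *: e i).

Definition matrices_in_basis (R : realType) (n : nat) (M : manifold R n)
    (p : M) (e : 'I_n -> tangent p)
    (H : set {linear tangent p -> tangent p}) : set 'M[R]_n :=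
  [set A | exists L : {linear tangent p -> tangent p},
     H L /\ forall j, L (e j) = \sum_(i < n) A i j *: e i].

(* "Hol^phi is G"; the Levi-Civita connection exists and is unique. *)
Definition weighted_holonomy_is (R : realType) (n : nat)
    (D : manifold_with_density R n) (G : set 'M[R]_n) : Prop :=
  exists Gamma : connection_coef D,
    levi_civita (metric D) Gamma /\
    forall p : D, exists e : 'I_n -> tangent p,
      is_basis e /\
      matrices_in_basis e (holonomy (weighted (@density R n D) Gamma) p) = G.

Definition smooth_map (R : realType) (m n : nat) (M : manifold R m)
    (N : manifold R n) (f : M -> N) : Prop :=
  continuous f /\
  forall (i : chart_index M) (j : chart_index N),
    smooth_on [set x | chart_image i x /\ chart_dom j (f (chart_inv i x))]
      (fun x => chart j (f (chart_inv i x))).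

(* Smoothness of a map M x N -> P, in the product charts of M x N. *)
Definition smooth_map2 (R : realType) (m n k : nat) (M : manifold R m)
    (N : manifold R n) (P : manifold R k) (f : M -> N -> P) : Prop :=
  continuous (fun z : M * N => f z.1 z.2) /\
  forall (i : chart_index M) (j : chart_index N) (l : chart_index P),
    smooth_on [set z : 'rV[R]_m * 'rV[R]_n |
        [/\ chart_image i z.1, chart_image j z.2 &
            chart_dom l (f (chart_inv i z.1) (chart_inv j z.2))]]
      (fun z => chart l (f (chart_inv i z.1) (chart_inv j z.2))).

Record lie_group (R : realType) (d : nat) (H : manifold R d) := LieGroup {
  lone : H ;
  lmul : H -> H -> H ;
  linv : H -> H ;
  lmulA : associative lmul ;
  lmul1 : left_id lone lmul ;
  lmulV : left_inverse lone linv lmul ;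
  lmul_smooth : smooth_map2 lmul ;
  linv_smooth : smooth_map linv }.

Definition immersion (R : realType) (d : nat) (H : manifold R d)
    (W : normedModType R) (f : H -> W) : Prop :=
  forall i : chart_index H,
    smooth_on (chart_image i) (f \o chart_inv i) /\
    forall x, chart_image i x -> injective ('d (f \o chart_inv i) x).

(* G is a connected Lie subgroup of SL_n(R): the image of a connected Lie group
   under an injective homomorphism which is an immersion. As SL_n(R) is an
   embedded submanifold of the space of matrices, being an immersion into
   either of them is the same. *)
Definition connected_lie_subgroup_SL (R : realType) (n : nat)
    (G : set 'M[R]_n) : Prop :=
  (forall A, G A -> \det A = 1) /\
  exists (d : nat) (H : manifold R d) (S : lie_group H) (iota : H -> 'M[R]_n),
    [/\ connected [set: H],
        forall x y, iota (lmul S x y) = iota x *m iota y,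
        injective iota,
        immersion iota &
        range iota = G].

(* Main.v *)
Require Import Defs.
From HB Require Import structures.
From mathcomp Require Import all_boot all_order all_algebra.
From mathcomp Require Import all_classical all_reals all_analysis.
From mathcomp Require Import ring lra.
Set Implicit Arguments.
Unset Strict Implicit.
Unset Printing Implicit Defensive.
Import Order.TTheory GRing.Theory Num.Theory.
Import numFieldNormedType.Exports.
Local Open Scope classical_set_scope.
Local Open Scope ring_scope.

(** Up to conjugation in GL_2, the connected Lie subgroups of SL_2 are the trivial
    group, the identity components of the centralizers of the companion matrices
    (0, -d; 1, 0) for d = 0, 1, -1 (parabolic, elliptic, hyperbolic), the group of
    upper triangular matrices with positive diagonal, and SL_2 itself. As the
    holonomy group is defined up to the choice of a basis, it is enough to realize
    these six groups; the proof has a geometric half that does this and an algebraic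
    half that establishes the list.

    Geometry. All examples live on the plane, with a metric e^(2a) dx^2 + e^(2b) dy^2
    and a density phi. In a frame of area 1 for the parallel area form of the weighted
    connection, parallel transport becomes a linear equation W' = omega(g') W with a
    traceless matrix omega that is explicit in a, b, phi ([wcoef_gauge]). The upper
    bound on the holonomy comes from quantities conserved by this equation along
    arbitrary loops ([holonomy_det], [one_param_upper], [borel_upper]), the lower bound
    from broken lines along which the equation is solved in closed form
    ([transp_holonomy]). If a = b = ha(y) and phi = hp(y), omega vanishes on vertical
    vectors and is off-diagonal on horizontal ones; ha and hp can be chosen so that
    omega is proportional to a given companion matrix ([one_param_realizable]), or so
    that it is an upper unipotent direction on one horizontal line and a lower one on
    another ([sl2_realizable]). The triangular group needs a genuinely two-dimensional
    example ([borel_realizable]).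

    Algebra. Let H be a connected Lie group of dimension d immersed in SL_2 by an
    injective homomorphism. Its Lie algebra is a d-dimensional space of traceless
    matrices, so d <= 3 ([lie_dim_le3]). Neither the exponential map nor the
    correspondence between subgroups and subalgebras is used. Instead, a property that
    is stable under products and inverses and holds near the identity holds on all of H
    ([open_subgroup]), a continuous function on H has the intermediate value property
    ([connected_ivt]), and relations on H pass to the Lie algebra by differentiation
    ([lie_alg_relation]). In dimension 1 the group commutes with a generator of the Lie
    algebra, which [traceless_normal_form] brings to companion form, and connectedness
    gives all of the one-parameter group. In dimension 2 the derived algebra is a line
    normalized by the group; its generator is singular because an invertible one would
    commute with the group ([dim2_det0]), so the group is triangular, and commutators
    and conjugation fill up the triangular group ([borel_range]). In dimension 3 three
    matrix entries are local coordinates of SL_2, and an elementary minimization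
    argument ([local_surjection]) shows that H contains a neighbourhood of the identity,
    hence the elementary matrices, which generate SL_2. *)

(** * Smooth functions on normed modules *)

Section Smooth.
Context (R : realType) (V : normedModType R).
Implicit Types (f g : V -> R).

Lemma smooth_differentiable (W : normedModType R) (f : V -> W) x :
  smooth_on setT f -> differentiable f x.
Proof. by move=> /(_ 1%N) [+ _]; exact. Qed.

Lemma smooth_diff (W : normedModType R) (f : V -> W) v :
  smooth_on setT f -> smooth_on setT (fun x => 'd f x v).
Proof. by move=> sf k; have [_] := sf k.+1; exact. Qed.

Lemma Ck_onW (W : normedModType R) k (U : set V) (f : V -> W) :
  Ck_on k.+1 U f -> Ck_on k U f.
Proof.
elim: k f => [|k IH] f [df Cdf].
  by move=> x Ux; exact/differentiable_continuous/df.
by split=> // v; exact: IH.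
Qed.

Lemma smooth_cst (W : normedModType R) (c : W) : smooth_on setT (fun _ : V => c).
Proof.
move=> k; elim: k c => [|k IH] c; first by move=> x _; exact: cvg_cst.
split=> [x _|v]; first exact: differentiable_cst.
have -> : (fun x : V => 'd (fun=> c) x v) = fun=> 0; last exact: IH.
by apply/funext => x; rewrite (_ : (fun=> c) = cst c)// diff_cst.
Qed.

Lemma smooth_linear (W : normedModType R) (f : {linear V -> W}) :
  continuous f -> smooth_on setT f.
Proof.
move=> cf [|k]; first by move=> x _; exact: cf.
split=> [x _|v]; first exact: linear_differentiable.
have -> : (fun x : V => 'd f x v) = fun=> f v; last exact: smooth_cst.
by apply/funext => x; rewrite diff_lin.
Qed.

Lemma Ck_onD k f g : Ck_on k setT f -> Ck_on k setT g ->
  Ck_on k setT (fun x => f x + g x).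
Proof.
elim: k f g => [|k IH] f g.
  by move=> cf cg x _; apply: cvgD; [exact: cf|exact: cg].
move=> [df Cdf] [dg Cdg]; split=> [x Ux|v].
  by apply: (differentiableD (f:=f) (g:=g)); [exact: df|exact: dg].
have -> : (fun x => 'd (fun x => f x + g x) x v) =
          (fun x => 'd f x v + 'd g x v).
  by apply/funext=> x; rewrite (diffD (df x I) (dg x I)).
by apply: (IH _ _ (Cdf v) (Cdg v)).
Qed.

Lemma Ck_onM k f g : Ck_on k setT f -> Ck_on k setT g ->
  Ck_on k setT (fun x => f x * g x).
Proof.
elim: k f g => [|k IH] f g.
  by move=> cf cg x _; apply: cvgM; [exact: cf|exact: cg].
move=> Cf Cg; have [df Cdf] := Cf; have [dg Cdg] := Cg.
split=> [x Ux|v].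
  by apply: (differentiableM (f:=f) (g:=g)); [exact: df|exact: dg].
have -> : (fun x => 'd (fun x => f x * g x) x v) =
          (fun x => f x * 'd g x v + g x * 'd f x v).
  by apply/funext=> x; rewrite (diffM (df x I) (dg x I)).
by apply: Ck_onD; apply: IH; solve [exact: Cdf|exact: Cdg|exact: Ck_onW].
Qed.

Lemma smoothD f g : smooth_on setT f -> smooth_on setT g ->
  smooth_on setT (fun x => f x + g x).
Proof. by move=> sf sg k; exact: Ck_onD. Qed.

Lemma smoothM f g : smooth_on setT f -> smooth_on setT g ->
  smooth_on setT (fun x => f x * g x).
Proof. by move=> sf sg k; exact: Ck_onM. Qed.

Lemma smoothN f : smooth_on setT f -> smooth_on setT (fun x => - f x).
Proof.
move=> sf; have -> : (fun x => - f x) = (fun x => -1 * f x).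
  by apply/funext=> x; rewrite mulN1r.
by apply: smoothM => //; exact: smooth_cst.
Qed.

Lemma smoothB f g : smooth_on setT f -> smooth_on setT g ->
  smooth_on setT (fun x => f x - g x).
Proof. by move=> sf sg; apply: smoothD => //; exact: smoothN. Qed.

(** The chain rule for a scalar function of one variable. *)
Lemma diff_comp1 (h : R -> R) (dh : R) f x : is_derive (f x) 1 h dh ->
  differentiable f x ->
  differentiable (h \o f) x /\ forall v, 'd (h \o f) x v = dh * 'd f x v.
Proof.
move=> ih df; have dhf : differentiable h (f x).
  by apply/derivable1_diffP; case: ih.
split=> [|v]; first exact: differentiable_comp.
rewrite diff_comp//= deriv1E; last exact/derivable1_diffP.
by rewrite derive1E derive_val /GRing.scale/= mulrC.
Qed.

(** If h' is a smooth expression in h \o f and in smooth functions, then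
    h \o f inherits the smoothness of f, one derivative at a time. *)
Lemma smooth_comp1 (h h' : R -> R) f :
  (forall x, is_derive (f x) 1 h (h' (f x))) ->
  (forall k, Ck_on k setT f -> Ck_on k setT (h \o f) -> Ck_on k setT (h' \o f)) ->
  smooth_on setT f -> smooth_on setT (h \o f).
Proof.
move=> dh Ch sf; have df x := smooth_differentiable x sf.
elim=> [|k IH].
  by move=> x _; exact/differentiable_continuous/(diff_comp1 (dh x) (df x)).1.
split=> [x _|v]; first exact: (diff_comp1 (dh x) (df x)).1.
have -> : (fun x => 'd (h \o f) x v) = (fun x => (h' \o f) x * 'd f x v).
  by apply/funext=> x; rewrite (diff_comp1 (dh x) (df x)).2.
by apply: Ck_onM; [apply: Ch => //; exact: sf|exact: smooth_diff].
Qed.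

Lemma smooth_expR f : smooth_on setT f -> smooth_on setT (fun x => expR (f x)).
Proof. by apply: (smooth_comp1 (h' := expR)). Qed.

Lemma smoothV f : (forall x, f x != 0) -> smooth_on setT f ->
  smooth_on setT (fun x => (f x)^-1).
Proof.
move=> f0; apply: (smooth_comp1 (h := GRing.inv) (h' := fun y => - y^-2)).
  move=> x; have d0 : derivable (GRing.inv : R -> R) (f x) 1.
    exact/derivable1_diffP/differentiable_Rinv.
  apply: DeriveDef => //.
  rewrite deriveE; last exact/derivable1_diffP.
  by rewrite diff_Rinv// /GRing.scale/= mulr1.
move=> k _ C.
have -> : (fun y => - y ^- 2) \o f =
          (fun x => -1 * ((GRing.inv \o f) x * (GRing.inv \o f) x)).
  by apply/funext=> x /=; rewrite mulN1r -invfM -expr2.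
by apply: Ck_onM; [exact: smooth_cst|exact: Ck_onM].
Qed.

Lemma smooth_ln f : (forall x, 0 < f x) -> smooth_on setT f ->
  smooth_on setT (fun x => ln (f x)).
Proof.
move=> f0 sf; apply: (smooth_comp1 (h := @ln R) (h' := GRing.inv)) => //.
  by move=> x; exact: is_derive1_ln.
by move=> k _ _; apply: (smoothV (f := f)) => // x; rewrite gt_eqF.
Qed.

End Smooth.

Lemma diff_linear_comp (R : realType) (V W X : normedModType R)
    (L : {linear W -> X}) (f : V -> W) x : continuous L -> differentiable f x ->
  differentiable (L \o f) x /\ forall v, 'd (L \o f) x v = L ('d f x v).
Proof.
move=> cL df; have dL := linear_differentiable (f x) cL.
split=> [|v]; first exact: (differentiable_comp df dL).
have /(congr1 (fun h => h v)) E1 := diff_comp df dL.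
have /(congr1 (fun h => h ('d f x v))) E2 := diff_lin (f x) cL.
exact: etrans E1 E2.
Qed.

(** The topology on matrices is generated by the boxes given by entrywise
    neighbourhoods. *)
Lemma continuous_mx (T : topologicalType) (K : topologicalType) m n
    (F : set_system T) (FF : Filter F) (f : T -> 'M[K]_(m, n)) (l : 'M[K]_(m, n)) :
  (forall i j, f t i j @[t --> F] --> l i j) -> f t @[t --> F] --> l.
Proof.
move=> fl A [P lP sPA]; have h i j : \forall t \near F, P i j (f t i j).
  exact: (fl i j (P i j) (lP i j)).
have : \forall t \near F, forall i, forall j, P i j (f t i j).
  by apply: filter_forall => i; apply: filter_forall => j; exact: h.
by apply: filterS => t Pt; exact: sPA.
Qed.

Section Plane.
Context (R : realType).
Local Notation pt := 'rV[R]_2.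

(** Every point is joined to the origin by a segment. *)
Lemma connected_normed (V : normedModType R) : connected [set: V].
Proof.
have -> : [set: V] = \bigcup_(v : V) ((fun t : R => t *: v) @` `[0, 1]).
  by rewrite eqEsubset; split=> // v _; exists v => //; exists 1 => //=;
     rewrite ?in_itv/= ?ler01 ?lexx ?scale1r.
apply: bigcup_connected.
  by exists 0 => v _; exists 0 => //=; rewrite ?in_itv/= ?ler01 ?lexx ?scale0r.
move=> v _; apply: connected_continuous_connected.
  by apply/connected_intervalP; exact: interval_is_interval.
by apply: continuous_subspaceT => t; exact: scalel_continuous.
Qed.

Lemma rat_row_approx n (x : 'rV[R]_n) (e : R) : 0 < e ->
  exists q : 'rV[rat]_n, ball x e (map_mx ratr q).
Proof.
move=> e0; have H i : exists q : rat, ratr q \in `]x ord0 i - e, x ord0 i + e[.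
  by apply: rat_in_itvoo; lra.
have {H}[q Hq] := choice H.
exists (\row_i q i); split=> // i j.
rewrite ord1 !mxE /ball/= ltr_norml.
by move: (Hq j); rewrite in_itv/= => /andP[? ?]; apply/andP; split; lra.
Qed.

(** Balls with rational centre and radius 1 / (k + 1). *)
Lemma second_countable_rV n : @second_countable 'rV[R]_n.
Proof.
pose B (qk : 'rV[rat]_n * nat) : set 'rV[R]_n :=
  ball (map_mx ratr qk.1 : 'rV[R]_n) (qk.2.+1%:R^-1 : R).
exists (range B).
  by apply: (sub_countable (card_image_le _ _)); exact: countableP.
split; first by move=> _ [qk _ <-]; exact: ball_open.
move=> x A /nbhs_ballP[e /= e0 eA].
have e2 : 0 < e / 2 by rewrite divr_gt0.
have [k ke] : exists k : nat, k.+1%:R^-1 < e / 2.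
  have /ltr_add_invr[k] := e2; rewrite add0r => ?; by exists k.
have k0 : 0 < k.+1%:R^-1 :> R by rewrite invr_gt0.
have [q xq] := rat_row_approx x k0.
exists (B (q, k)) => /=; first by split; [exists (q, k)|exact: ball_sym].
move=> y qy; apply: eA; rewrite [e]splitr.
exact: ball_triangle (le_ball (ltW ke) xq) (le_ball (ltW ke) qy).
Qed.

End Plane.

(** * Diagonal metrics on the plane *)

Notation cx u := (u ord0 (ord0 : 'I_2)).
Notation cy u := (u ord0 (lift ord0 (ord0 : 'I_1) : 'I_2)).

Section Row2.
Context (R : realType).
Local Notation pt := 'rV[R]_2.

Definition row2 (p q : R) : pt := \row_(j < 2) if j == ord0 then p else q.

Lemma row2E p q : (cx (row2 p q) = p) * (cy (row2 p q) = q).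
Proof. by rewrite !mxE. Qed.

Lemma row2P (u v : pt) : cx u = cx v -> cy u = cy v -> u = v.
Proof.
move=> h0 h1; apply/rowP => j.
by case: (unliftP ord0 j) => [j'|] -> //; rewrite (ord1 j').
Qed.

Lemma row2_coord (u : pt) : row2 (cx u) (cy u) = u.
Proof. by apply: row2P; rewrite row2E. Qed.

Lemma diff_coord (V : normedModType R) (f : pt -> V) x u :
  'd f x u = cx u *: 'd f x (row2 1 0) + cy u *: 'd f x (row2 0 1).
Proof.
rewrite -!linearZ -linearD; congr ('d f x _).
by apply: row2P; rewrite !mxE/= ?mxE /=; ring.
Qed.

Lemma row2DZ p q : row2 p q = p *: row2 1 0 + q *: row2 0 1.
Proof. by apply: row2P; rewrite !mxE/= ?mxE /=; ring. Qed.

Lemma smooth_row2 (V : normedModType R) (f g : V -> R) :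
  smooth_on setT f -> smooth_on setT g ->
  smooth_on setT (fun x => row2 (f x) (g x)).
Proof.
move=> sf sg k; move: (sf k) (sg k) => {sf sg}.
elim: k f g => [|k IH] f g.
  move=> cf cg x _; apply: continuous_mx => i j; rewrite (ord1 i) mxE.
  under eq_fun do rewrite mxE.
  by case: ifP => _; [exact: cf|exact: cg].
move=> [df Cdf] [dg Cdg].
have E : (fun x => row2 (f x) (g x)) =
         (fun x => f x *: row2 1 0) + (fun x => g x *: row2 0 1).
  by apply/funext=> x; rewrite row2DZ.
have d1 x : differentiable (fun z => f z *: row2 1 0) x.
  by apply: differentiableZl; exact: df.
have d2 x : differentiable (fun z => g z *: row2 0 1) x.
  by apply: differentiableZl; exact: dg.
split=> [x _|v]; first by rewrite E; exact: differentiableD.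
have -> : (fun x => 'd (fun x => row2 (f x) (g x)) x v) =
          (fun x => row2 ('d f x v) ('d g x v)); last exact: (IH _ _ (Cdf v) (Cdg v)).
apply/funext=> x; rewrite E.
have /(congr1 (fun h => h v)) -> := diffD (d1 x) (d2 x).
have /(congr1 (fun h => h v)) E1 := diffZl (row2 1 0) (df x I).
have /(congr1 (fun h => h v)) E2 := diffZl (row2 0 1) (dg x I).
exact: etrans (congr2 +%R E1 E2) (esym (row2DZ _ _)).
Qed.

Lemma smooth_cx : smooth_on setT (fun u : pt => cx u).
Proof.
have l : linear (fun u : pt => cx u : R) by move=> k u v; rewrite !mxE.
pose L : {linear pt -> R} := HB.pack (fun u : pt => cx u : R)
  (GRing.isLinear.Build _ _ _ _ _ l).
by apply: (smooth_linear (f := L)); exact: coord_continuous.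
Qed.

Lemma smooth_cy : smooth_on setT (fun u : pt => cy u).
Proof.
have l : linear (fun u : pt => cy u : R) by move=> k u v; rewrite !mxE.
pose L : {linear pt -> R} := HB.pack (fun u : pt => cy u : R)
  (GRing.isLinear.Build _ _ _ _ _ l).
by apply: (smooth_linear (f := L)); exact: coord_continuous.
Qed.

End Row2.

Section SymBilinear.
Context (R : realType).
Local Notation pt := 'rV[R]_2.

Definition dx (f : pt -> R) (x : pt) : R := 'd f x (row2 1 0).
Definition dy (f : pt -> R) (x : pt) : R := 'd f x (row2 0 1).

Lemma diff_dxy (f : pt -> R) x u : 'd f x u = cx u * dx f x + cy u * dy f x.
Proof. exact: diff_coord. Qed.

Lemma smooth_dx f : smooth_on setT f -> smooth_on setT (dx f).
Proof. exact: smooth_diff. Qed.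

Lemma smooth_dy f : smooth_on setT f -> smooth_on setT (dy f).
Proof. exact: smooth_diff. Qed.

(** The general symmetric bilinear map of the plane, by its coefficients; the
    Christoffel symbols have this shape, which makes them torsion-free. *)
Definition sym_bilin (k l m k' l' m' : R) (u v : pt) : pt :=
  row2 (k * (cx u * cx v) + l * (cx u * cy v + cy u * cx v) + m * (cy u * cy v))
       (k' * (cx u * cx v) + l' * (cx u * cy v + cy u * cx v)
        + m' * (cy u * cy v)).

Lemma sym_bilinC k l m k' l' m' u v :
  sym_bilin k l m k' l' m' u v = sym_bilin k l m k' l' m' v u.
Proof. by apply: row2P; rewrite !row2E; ring. Qed.

Lemma sym_bilin_linear k l m k' l' m' u :
  linear (sym_bilin k l m k' l' m' u).
Proof. by move=> c v w; apply: row2P; rewrite !mxE/=; ring. Qed.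

Lemma sym_bilin_linearl k l m k' l' m' v :
  linear (sym_bilin k l m k' l' m' ^~ v).
Proof. by move=> c u w; rewrite /= -!(sym_bilinC _ _ _ _ _ _ v) sym_bilin_linear. Qed.

Lemma smooth_sym_bilin (k l m k' l' m' : pt -> R) u v :
  smooth_on setT k -> smooth_on setT l -> smooth_on setT m ->
  smooth_on setT k' -> smooth_on setT l' -> smooth_on setT m' ->
  smooth_on setT (fun x => sym_bilin (k x) (l x) (m x) (k' x) (l' x) (m' x) u v).
Proof.
have sC (c : R) := @smooth_cst R pt _ c.
move=> sk sl sm sk' sl' sm'; apply: smooth_row2; apply: smoothD.
- exact: smoothD (smoothM sk (sC _)) (smoothM sl (sC _)).
- exact: smoothM sm (sC _).
- exact: smoothD (smoothM sk' (sC _)) (smoothM sl' (sC _)).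
- exact: smoothM sm' (sC _).
Qed.

End SymBilinear.

Section PlaneManifold.
Context (R : realType).
Local Notation pt := 'rV[R]_2.

Lemma smooth_id_on (U : set pt) : U = setT -> smooth_on U (id : pt -> pt).
Proof.
move=> ->; apply: (smooth_linear (f := idfun)) => x; exact: cvg_id.
Qed.

Program Definition plane : manifold R 2 := @Manifold R 2 pt unit
  (fun _ => setT) (fun _ => id) (fun _ => id)
  _ (@second_countable_rV R 2) _ _ _ _ _ _ _.
Next Obligation. exact: norm_hausdorff. Qed.
Next Obligation. by move=> p; exists tt. Qed.
Next Obligation. by move=> i; exact: openT. Qed.
Next Obligation. by move=> i; rewrite image_id; exact: openT. Qed.
Next Obligation. by []. Qed.
Next Obligation.
by move=> i; apply: continuous_subspaceT => x; exact: cvg_id.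
Qed.
Next Obligation.
by move=> i; apply: continuous_subspaceT => x; exact: cvg_id.
Qed.
Next Obligation. by move=> i j; apply: smooth_id_on; rewrite setTI image_id. Qed.

Lemma plane_image (i : chart_index plane) : chart_image i = setT.
Proof. by rewrite /chart_image/= image_id. Qed.

Lemma plane_transition (i j : chart_index plane) p v :
  'd (transition i j) p v = v.
Proof. by rewrite /transition/= (_ : id \o id = id)// diff_val. Qed.

Variables (a b phi : pt -> R).
Hypotheses (sa : smooth_on setT a) (sb : smooth_on setT b)
  (sphi : smooth_on setT phi).

(** The metric e^(2a) dx^2 + e^(2b) dy^2. *)
Definition diag_coef (x u v : pt) : R :=
  expR (a x + a x) * (cx u * cx v) + expR (b x + b x) * (cy u * cy v).

Lemma smooth_diag_coef u v : smooth_on setT (fun x => diag_coef x u v).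
Proof.
by apply: smoothD; apply: smoothM; (exact: smooth_cst || apply: smooth_expR);
   exact: smoothD.
Qed.

Program Definition diag_metric : riemannian_metric plane :=
  @RiemannianMetric R 2 plane (fun _ => diag_coef) _ _ _ _ _.
Next Obligation.
move=> i x v _ k u w; rewrite /diag_coef !mxE /GRing.scale/=.
by move: (expR _) (expR _) => A B; ring.
Qed.
Next Obligation.
by move=> i x u v _; rewrite /diag_coef [cx u * _]mulrC [cy u * _]mulrC.
Qed.
Next Obligation.
move=> i x u _ u0; rewrite /diag_coef -!expr2.
have [u1|u1] := eqVneq (cx u) 0; last first.
  apply: ltr_pwDl; last by rewrite mulr_ge0 ?expR_ge0 ?sqr_ge0.
  by rewrite mulr_gt0 ?expR_gt0 ?exprn_even_gt0.
have u2 : cy u != 0.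
  by apply: contra_neq u0 => u2; apply: row2P; rewrite ?u1 ?u2 mxE.
apply: ltr_wpDl; first by rewrite mulr_ge0 ?expR_ge0 ?sqr_ge0.
by rewrite mulr_gt0 ?expR_gt0 ?exprn_even_gt0.
Qed.
Next Obligation.
by move=> i u v; rewrite plane_image; exact: smooth_diag_coef.
Qed.
Next Obligation.
by move=> i j p u v _ _; rewrite !(plane_transition i j).
Qed.

Program Definition diag_plane : manifold_with_density R 2 :=
  @ManifoldWithDensity R 2 plane _ _ diag_metric phi _.
Next Obligation. by exists (0 : pt). Qed.
Next Obligation. exact: connected_normed. Qed.
Next Obligation. by move=> i; rewrite plane_image; exact: sphi. Qed.

(** The Christoffel symbols of e^(2a) dx^2 + e^(2b) dy^2. *)
Definition christoffel (x : pt) : pt -> pt -> pt :=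
  sym_bilin (dx a x) (dy a x) (- dx b x * expR (b x + b x - (a x + a x)))
            (- dy a x * expR (a x + a x - (b x + b x))) (dx b x) (dy b x).

Lemma smooth_christoffel u v : smooth_on setT (fun x => christoffel x u v).
Proof.
apply: smooth_sym_bilin.
- exact: smooth_dx.
- exact: smooth_dy.
- apply: smoothM; first by apply: smoothN; exact: smooth_dx.
  by apply/smooth_expR/smoothB; exact: smoothD.
- apply: smoothM; first by apply: smoothN; exact: smooth_dy.
  by apply/smooth_expR/smoothB; exact: smoothD.
- exact: smooth_dx.
- exact: smooth_dy.
Qed.

(** The compatibility with the metric once A, B are put for e^a, e^b. *)
Lemma compat_identity (A B p q r s : R) (u v w : pt) : A != 0 -> B != 0 ->
  (A * A) * ((cx u * p + cy u * q) + (cx u * p + cy u * q)) * (cx v * cx w) +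
  (B * B) * ((cx u * r + cy u * s) + (cx u * r + cy u * s)) * (cy v * cy w) =
  let G := sym_bilin p q (- r * (B * B * (A * A)^-1))
                     (- q * (A * A * (B * B)^-1)) r s in
  (A * A * (cx (G u v) * cx w) + B * B * (cy (G u v) * cy w)) +
  (A * A * (cx v * cx (G u w)) + B * B * (cy v * cy (G u w))).
Proof.
rewrite /sym_bilin !row2E; move: (cx u) (cy u) (cx v) (cy v) (cx w) (cy w).
by move=> *; field; apply/andP.
Qed.

Lemma diff_expRD (f : pt -> R) x u : smooth_on setT f ->
  'd (fun x => expR (f x + f x)) x u = expR (f x + f x) * ('d f x u + 'd f x u).
Proof.
move=> sf; have df := smooth_differentiable x sf.
have [_ ->] := @diff_comp1 _ _ _ _ (f + f) x (is_derive_expR (f x + f x))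
  (differentiableD df df).
have /(congr1 (fun h => h u)) E := diffD df df.
exact: congr1 E.
Qed.

Lemma diff_diag_coef x u v w :
  'd (fun x => diag_coef x v w) x u =
    expR (a x + a x) * ('d a x u + 'd a x u) * (cx v * cx w) +
    expR (b x + b x) * ('d b x u + 'd b x u) * (cy v * cy w).
Proof.
have dE f c : smooth_on setT f ->
    differentiable (fun x : pt => expR (f x + f x) * c : R) x /\
    'd (fun x : pt => expR (f x + f x) * c : R) x u =
      expR (f x + f x) * ('d f x u + 'd f x u) * c.
  move=> sf; have sE : smooth_on setT (fun x => expR (f x + f x)).
    by apply/smooth_expR/smoothD.
  have dE := smooth_differentiable x sE.
  split; first exact: differentiableZl.
  have /(congr1 (fun h => h u)) E := diffZl (c : R) dE.
  exact: etrans E (congr1 (fun z : R => z * c) (diff_expRD x u sf)).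
have [d1 E1] := dE a (cx v * cx w) sa; have [d2 E2] := dE b (cy v * cy w) sb.
have /(congr1 (fun h => h u)) E := diffD d1 d2.
exact: etrans E (congr2 +%R E1 E2).
Qed.

Lemma diag_levi_civita :
  levi_civita diag_metric (fun _ => christoffel : pt -> pt -> pt -> pt).
Proof.
split.
- split.
  + by move=> i x v _; exact: sym_bilin_linearl.
  + by move=> i x u _; exact: sym_bilin_linear.
  + by move=> i u v; rewrite plane_image; exact: smooth_christoffel.
  + move=> i j p u v _ _; have tE := @plane_transition i j p.
    have E : 'd (fun x => 'd (transition i j) x v) p u = 0.
      rewrite (_ : (fun x => _) = cst v); first by rewrite diff_cst.
      by apply/funext=> x; rewrite plane_transition.
    apply: etrans (tE _) (esym _); apply: etrans _ (add0r _).
    apply: congr2; first exact: E.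
    exact: (congr2 (christoffel p) (tE u) (tE v)).
- by move=> i x u v _; exact: sym_bilinC.
- move=> i x u v w _; rewrite [LHS]diff_diag_coef !diff_dxy.
  rewrite /= /diag_coef /christoffel !expRD !expRN !expRD.
  by apply: compat_identity; rewrite gt_eqF// expR_gt0.
Qed.

End PlaneManifold.

(** * Derivatives of curves *)

Section CurveCalculus.
Context (R : realType).
Local Notation pt := 'rV[R]_2.

(** The two usual forms of the difference quotient: the one of one-sided
    derivatives along an interval, and the one of directional derivatives. *)
Lemma cvg_quotient_shift (V : normedModType R) (f : R -> V) (t : R) (l : V) :
  ((s - t)^-1 *: (f s - f t) @[s --> t^'] --> l) <->
  (h^-1 *: ((f \o shift t) (h *: 1) - f t) @[h --> 0^'] --> l).
Proof.
have S1 : shift t @ 0^' --> t^'.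
  move=> A /nbhs_ballP[e /= e0 eA]; apply/nbhs_ballP; exists e => //.
  move=> h; rewrite /ball/= sub0r normrN => he h0; apply: eA.
    by rewrite /ball/= opprD addrCA subrr addr0 normrN.
  by apply: contra_neq h0 => /(congr1 (fun z => z - t)); rewrite addrK subrr.
have S2 : (fun s => s - t) @ t^' --> 0^'.
  move=> A /nbhs_ballP[e /= e0 eA]; apply/nbhs_ballP; exists e => //.
  move=> s; rewrite /ball/= => he h0; apply: eA; last by rewrite /= subr_eq0.
  by rewrite /ball/= sub0r opprB.
split=> H.
- have -> : (fun h => h^-1 *: ((f \o shift t) (h *: 1) - f t)) =
            (fun s => (s - t)^-1 *: (f s - f t)) \o shift t.
    by apply/funext => h /=; rewrite addrK [h *: 1]mulr1.
  exact: cvg_comp S1 H.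
- have -> : (fun s => (s - t)^-1 *: (f s - f t)) =
     (fun h => h^-1 *: ((f \o shift t) (h *: 1) - f t)) \o (fun s => s - t).
    by apply/funext => s /=; rewrite [_ *: 1]mulr1 subrK.
  exact: cvg_comp S2 H.
Qed.

Lemma is_derive_within (V : normedModType R) (J : set R) (f : R -> V) (t : R) (l : V) :
  is_derive t 1 f l -> deriv_within J f t l.
Proof.
move=> [df El].
have H : h^-1 *: ((f \o shift t) (h *: 1) - f t) @[h --> 0^'] --> l.
  by rewrite -El; exact: df.
by apply: cvg_trans (proj2 (cvg_quotient_shift f t l) H);
   apply: cvg_app; exact: cvg_within.
Qed.

Lemma deriv_within_is_derive (V : normedModType R) (J : set R) (f : R -> V) (t : R) (l : V) :
  nbhs t J -> deriv_within J f t l -> is_derive t 1 f l.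
Proof.
move=> Jt df; have H : h^-1 *: ((f \o shift t) (h *: 1) - f t) @[h --> 0^'] --> l.
  apply/cvg_quotient_shift; apply: cvg_trans df; apply: cvg_app => A wA.
  rewrite /within/= in wA.
  have Jt' : \forall s \near t^', J s by exact: nbhs_dnbhs.
  by apply: filterS2 Jt' wA => s Js; apply.
by apply: DeriveDef; [apply/cvg_ex; exists l|exact/cvg_lim].
Qed.

Lemma deriv_within_continuous (V : normedModType R) (J : set R) (f : R -> V) :
  (forall t, J t -> exists l, deriv_within J f t l) -> {within J, continuous f}.
Proof.
move=> df; apply/subspace_continuousP => t Jt; have [l fl] := df t Jt.
have H : f s @[s --> within J t^'] --> f t.
  pose g s := f t + (s - t) *: ((s - t)^-1 *: (f s - f t)).
  have gl : g s @[s --> within J t^'] --> f t.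
    rewrite -[X in _ --> X]addr0 -[X in _ --> _ + X](scale0r l).
    apply: cvgD; first exact: cvg_cst.
    apply: cvgZ fl; rewrite -[X in _ --> X](subrr t).
    apply: cvgB; last exact: cvg_cst.
    by move=> A tA; apply: cvg_within; exact: nbhs_dnbhs.
  apply: cvg_trans gl; apply: near_eq_cvg; rewrite near_withinE.
  apply: (filterS _ (nbhs_dnbhs_neq t)) => s st _.
  by rewrite /g scalerA divff ?subr_eq0// scale1r addrC subrK.
move=> A fA; have HA : nbhs t [set y | y != t -> J y -> A (f y)] := H A fA.
change (nbhs t [set y | J y -> A (f y)]).
apply: filterS HA => s HA Js.
by have [->|st] := eqVneq s t; [exact: nbhs_singleton|exact: HA].
Qed.

Lemma is_derive_comp_curve (V W : normedModType R) (f : V -> W) (g : R -> V)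
    (t : R) (v : V) :
  is_derive t 1 g v -> differentiable f (g t) ->
  is_derive t 1 (f \o g) ('d f (g t) v).
Proof.
move=> [dg Eg] df; have {}dg : differentiable g t by exact/derivable1_diffP.
have dfg : differentiable (f \o g) t by exact: differentiable_comp.
apply: DeriveDef; first exact/derivable1_diffP.
have E1 : 'd g t 1 = v := etrans (esym (deriveE (1 : R) dg)) Eg.
apply: etrans (deriveE (1 : R) dfg) _.
have /(congr1 (fun h => h (1 : R))) E2 := diff_comp dg df.
exact: etrans E2 (congr1 ('d f (g t)) E1).
Qed.

Lemma is_derive_ray (V : normedModType R) (x v : V) (t : R) :
  is_derive t 1 (fun s => x + s *: v) v.
Proof.
have dz : differentiable (fun s : R => s *: v) t.
  by have := is_diff_scalel t v; case.
have E : 'd (fun s : R => s *: v) t 1 = v.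
  have := is_diff_scalel t v; case=> _ /(congr1 (fun h => h (1 : R))) E.
  by apply: etrans E _; exact: scale1r.
have dZ : is_derive t 1 (fun s : R => s *: v) v.
  by apply: DeriveDef; [exact: diff_derivable|exact: etrans (deriveE _ dz) E].
by have := is_deriveD (is_derive_cst x t 1) dZ; rewrite add0r.
Qed.

Lemma is_derive_mx m n (M : R -> 'M[R]_(m, n)) (t : R) (L : 'M[R]_(m, n)) :
  is_derive t 1 M L <-> (forall i j, is_derive t 1 (fun s => M s i j) (L i j)).
Proof.
split=> [[dM EL] i j|H].
  apply: DeriveDef; first by move/derivable_mxP : dM; exact.
  by rewrite -EL derive_mx// mxE.
have dM : derivable M t 1 by apply/derivable_mxP => i j; have [] := H i j.
apply: DeriveDef => //; rewrite derive_mx//; apply/matrixP => i j; rewrite mxE.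
by have [] := H i j.
Qed.

Lemma is_derive_row2 (f g : R -> R) (t p q : R) : is_derive t 1 f p ->
  is_derive t 1 g q -> is_derive t 1 (fun s => row2 (f s) (g s)) (row2 p q).
Proof.
move=> df dg; apply/is_derive_mx => i j; rewrite mxE.
under eq_fun do rewrite mxE.
by case: ifP.
Qed.

Lemma is_derive_coord (f : R -> pt) (t : R) (l : pt) : is_derive t 1 f l ->
  is_derive t 1 (fun s => cx (f s)) (cx l) /\
  is_derive t 1 (fun s => cy (f s)) (cy l).
Proof. by move/is_derive_mx => H; split; exact: H. Qed.

Lemma is_derive_mul (f g : R -> R) (t p q : R) : is_derive t 1 f p ->
  is_derive t 1 g q ->
  is_derive t 1 (fun s => f s * g s) (p * g t + f t * q).
Proof.
by move=> df dg; apply: is_derive_eq; rewrite /GRing.scale/=; ring.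
Qed.

End CurveCalculus.

(** * Subdivided intervals and linear equations *)

Section Partition.
Context (R : realType).

Lemma itv_partition_lt (s : seq R) k : itv_partition 0 1 s -> (k < size s)%N ->
  nth 0 (0 :: s) k < nth 0 (0 :: s) k.+1.
Proof. by move=> [/(pathP 0) + _] ks; exact. Qed.

(** Propagation of a property along a subdivided interval; P holds at the start
    of a piece when it is propagated along it, so that conserved quantities and
    signs of continuous functions can be carried across the corners of a curve. *)
Lemma partition_ind (s : seq R) (P : R -> Prop) : itv_partition 0 1 s -> P 0 ->
  (forall k, (k < size s)%N -> P (nth 0 (0 :: s) k) ->
     forall t, piece s k t -> P t) ->
  forall k, (k <= size s)%N -> P (nth 0 (0 :: s) k).
Proof.
move=> sP P0 PS; elim=> [//|k IH] ks; apply: (PS k) => //.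
  by apply: IH; exact: ltnW.
by rewrite /piece/= in_itv/= lexx andbT ltW//; exact: itv_partition_lt.
Qed.

Lemma partition_ind1 (s : seq R) (P : R -> Prop) : itv_partition 0 1 s -> P 0 ->
  (forall k, (k < size s)%N -> P (nth 0 (0 :: s) k) ->
     forall t, piece s k t -> P t) -> P 1.
Proof.
move=> sP P0 PS; have := partition_ind sP P0 PS (leqnn _).
by have [_ /eqP <-] := sP; rewrite (last_nth 0).
Qed.

Lemma constant_itv (f : R -> R) (a b t : R) : {within `[a, b], continuous f} ->
  (forall x, x \in `]a, b[ -> is_derive x 1 f 0) -> t \in `[a, b] -> f t = f a.
Proof.
move=> cf df; rewrite in_itv/= => /andP[ta tb].
have [->//|ne] := eqVneq t a.
have at_ : a < t by rewrite lt_neqAle eq_sym ne.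
have [||c _ /eqP] := @MVT_segment R f (fun=> 0) a t ta.
- by move=> x; rewrite in_itv/= => /andP[? ?]; apply: df;
     rewrite in_itv/=; apply/andP; split=> //; exact: lt_le_trans tb.
- apply: continuous_subspaceW cf => x /=; rewrite !in_itv/= => /andP[-> xt] /=.
  exact: le_trans tb.
by rewrite mul0r subr_eq0 => /eqP.
Qed.

Lemma gt0_itv (f : R -> R) (a b t : R) : {within `[a, b], continuous f} ->
  (forall x, x \in `[a, b] -> f x != 0) -> 0 < f a -> t \in `[a, b] -> 0 < f t.
Proof.
move=> cf f0 fa tab; have := tab; rewrite in_itv/= => /andP[ta tb].
rewrite ltNge; apply/negP => ft.
have cft : {within `[a, t], continuous f}.
  apply: continuous_subspaceW cf => x /=; rewrite !in_itv/= => /andP[-> xt] /=.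
  exact: le_trans tb.
have [|c] := IVT (v := 0) ta cft.
  by rewrite ge_min le_max ft (ltW fa) orbT.
rewrite in_itv/= => /andP[ac ct] /eqP; apply/negP; apply: f0.
by rewrite in_itv/= ac (le_trans ct tb).
Qed.

Lemma bounded_itv (f : R -> R) (a b : R) : a <= b ->
  {within `[a, b], continuous f} ->
  exists K, forall t, t \in `[a, b] -> `|f t| <= K.
Proof.
move=> ab cf.
have [M _ HM] := EVT_max ab cf; have [m _ Hm] := EVT_min ab cf.
exists (`|f M| + `|f m|) => t /[dup] /HM H1 /Hm H2; rewrite ler_norml.
have := ler_norm (f M); have := ler_norm (- f m); rewrite normrN.
have := normr_ge0 (f M); have := normr_ge0 (f m).
by move=> *; apply/andP; split; lra.
Qed.

(** Uniqueness for u' = c(t) u with bounded c, by monotonicity of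
    u^2 exp(-2Kt). *)
Lemma linear_ode_zero (u c : R -> R) (K a b t : R) :
  {within `[a, b], continuous u} ->
  (forall x, x \in `]a, b[ -> is_derive x 1 u (c x * u x)) ->
  (forall x, x \in `]a, b[ -> c x <= K) -> u a = 0 -> t \in `[a, b] -> u t = 0.
Proof.
move=> cu du cK ua; rewrite in_itv/= => /andP[ta tb].
(* f is nonincreasing, nonnegative and starts at 0 *)
pose f x := u x * u x * expR (- (K + K) * x).
have df x : x \in `]a, b[ ->
    is_derive x 1 f ((c x - K) * 2 * (u x * u x) * expR (- (K + K) * x)).
  move=> xab; have dE : is_derive x 1 (fun x => expR (- (K + K) * x))
      (expR (- (K + K) * x) * - (K + K)).
    apply: (is_derive1_comp (f := expR) (g := fun x => - (K + K) * x)).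
    by apply: is_derive_eq; rewrite /GRing.scale/= mulr1.
  apply: is_derive_eq (is_derive_mul (is_derive_mul (du x xab) (du x xab)) dE) _.
  by move: (expR _) => E; ring.
have cf : {within `[a, b], continuous f}.
  move=> x; apply: cvgM; first by apply: cvgM; exact: cu.
  by apply: continuous_subspaceT => y; apply: continuous_comp;
    [exact: mulrl_continuous|exact: continuous_expR].
have : f t <= f a.
  have [->//|ne] := eqVneq t a.
  have at_ : a < t by rewrite lt_neqAle eq_sym ne.
  have cft : {within `[a, t], continuous f}.
    apply: continuous_subspaceW cf => x /=; rewrite !in_itv/= => /andP[-> xt] /=.
    exact: le_trans tb.
  have dft x : x \in `]a, t[ ->
      is_derive x 1 f ((c x - K) * 2 * (u x * u x) * expR (- (K + K) * x)).
    rewrite in_itv/= => /andP[? ?]; apply: df.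
    by rewrite in_itv/=; apply/andP; split=> //; exact: lt_le_trans tb.
  have [z] := MVT at_ dft cft.
  rewrite in_itv/= => /andP[az zt] E; rewrite -subr_le0 E.
  rewrite pmulr_lle0 ?subr_gt0// pmulr_lle0 ?expR_gt0//.
  rewrite mulr_le0_ge0 -?expr2 ?sqr_ge0// pmulr_lle0// subr_le0.
  by apply: cK; rewrite in_itv/= az (lt_le_trans zt tb).
rewrite /f ua mul0r mul0r pmulr_lle0 ?expR_gt0// -expr2 => H.
by apply/eqP; rewrite -sqrf_eq0 eq_le H sqr_ge0.
Qed.

End Partition.

(** * A unimodular moving frame for the weighted connection *)

Section Gauge.
Context (R : realType).
Local Notation pt := 'rV[R]_2.
Variables (a b phi : pt -> R).
Hypotheses (sa : smooth_on setT a) (sb : smooth_on setT b)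
  (sphi : smooth_on setT phi).

(** The derivative of f in the direction u, written with the partial derivatives
    so that it can be generalized before algebraic simplification. *)
Definition dder (f : pt -> R) (x u : pt) : R := cx u * dx f x + cy u * dy f x.

Lemma is_derive_dder (f : pt -> R) (g : R -> pt) (t : R) (v : pt) :
  is_derive t 1 g v -> differentiable f (g t) ->
  is_derive t 1 (f \o g) (dder f (g t) v).
Proof.
by move=> dg df; rewrite /dder -diff_dxy; exact: is_derive_comp_curve.
Qed.

Definition wcoef : connection_coef (plane R) :=
  weighted (M := plane R) phi (fun _ => christoffel a b).

(** The coordinates w of a tangent vector are taken with respect to the frame
    e^(phi - a) d/dx, e^(2 phi - b) d/dy. The weighted connection has the parallel
    area form e^(a + b - 3 phi) dx dy, for which this frame has area 1: this is
    why the connection form [omega] below has trace zero. Other unimodular frames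
    would do, but in this one the diagonal part of the connection form has no
    dy component, and for functions a = b and phi of y alone it vanishes. *)
Definition gauge (x w : pt) : pt :=
  row2 (expR (phi x - a x) * cx w) (expR (phi x + phi x - b x) * cy w).

Definition ungauge (x v : pt) : pt :=
  row2 (expR (a x - phi x) * cx v) (expR (b x - (phi x + phi x)) * cy v).

Lemma gaugeK x : cancel (gauge x) (ungauge x).
Proof.
move=> w; apply: row2P; rewrite !row2E mulrA -expRD.
  by rewrite (_ : _ + _ = 0) ?expR0 ?mul1r//; ring.
by rewrite (_ : _ + _ = 0) ?expR0 ?mul1r//; ring.
Qed.

Lemma ungaugeK x : cancel (ungauge x) (gauge x).
Proof.
move=> w; apply: row2P; rewrite !row2E mulrA -expRD.
  by rewrite (_ : _ + _ = 0) ?expR0 ?mul1r//; ring.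
by rewrite (_ : _ + _ = 0) ?expR0 ?mul1r//; ring.
Qed.

(** The entries of the connection form, with the sign for which parallel vector
    fields satisfy W' = omega(g') W: d on the diagonal (and its opposite), u in
    the upper right corner, l in the lower left corner. *)
Definition omega_d (x u : pt) : R := dx phi x * cx u.

Definition omega_u (x u : pt) : R :=
  (dy phi x - dy a x) * expR (phi x + a x - b x) * cx u
  + dx b x * expR (phi x + b x - a x) * cy u.

Definition omega_l (x u : pt) : R :=
  dy a x * expR (a x - b x - phi x) * cx u
  + (dx phi x - dx b x) * expR (b x - a x - phi x) * cy u.

Definition omega (x u w : pt) : pt :=
  row2 (omega_d x u * cx w + omega_u x u * cy w)
       (omega_l x u * cx w - omega_d x u * cy w).

Lemma opp_row2 (p q k l : R) (u v : pt) :
  - (row2 p q - k *: v - l *: u) =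
  row2 (- p + k * cx v + l * cx u) (- q + k * cy v + l * cy u).
Proof. by apply: row2P; rewrite !mxE/=; ring. Qed.

Lemma wcoefE x u v : - wcoef tt x u v =
  row2 (- (dx a x * (cx u * cx v) + dy a x * (cx u * cy v + cy u * cx v)
         + - dx b x * expR (b x + b x - (a x + a x)) * (cy u * cy v))
        + dder phi x u * cx v
        + dder phi x v * cx u)
       (- (- dy a x * expR (a x + a x - (b x + b x)) * (cx u * cx v)
         + dx b x * (cx u * cy v + cy u * cx v) + dy b x * (cy u * cy v))
        + dder phi x u * cy v
        + dder phi x v * cy u).
Proof.
rewrite /wcoef /weighted.
have E w : 'd (phi \o chart_inv (m := plane R) tt) x w =
           dder phi x w := diff_dxy phi x w.
by rewrite !E; exact: opp_row2.
Qed.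

(** The computation of the connection form, with P, A, B put for e^phi, e^a, e^b
    and p, a, b followed by x or y for the partial derivatives. *)
Lemma gauge_identity (P A B px py ax ay bx by_ : R) (u w : pt) :
  P != 0 -> A != 0 -> B != 0 ->
  let v := row2 (P * A^-1 * cx w) (P * P * B^-1 * cy w) in
  row2 (- (ax * (cx u * cx v) + ay * (cx u * cy v + cy u * cx v)
         + - bx * (B * B * (A * A)^-1) * (cy u * cy v))
        + (cx u * px + cy u * py) * cx v + (cx v * px + cy v * py) * cx u)
       (- (- ay * (A * A * (B * B)^-1) * (cx u * cx v)
         + bx * (cx u * cy v + cy u * cx v) + by_ * (cy u * cy v))
        + (cx u * px + cy u * py) * cy v + (cx v * px + cy v * py) * cy u) =
  row2 (P * A^-1 * ((cx u * px + cy u * py - (cx u * ax + cy u * ay)) * cx w +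
          (px * cx u * cx w +
           ((py - ay) * (P * A * B^-1) * cx u + bx * (P * B * A^-1) * cy u)
             * cy w)))
       (P * P * B^-1 *
         ((cx u * px + cy u * py + (cx u * px + cy u * py)
            - (cx u * bx + cy u * by_)) * cy w +
          ((ay * (A * B^-1 * P^-1) * cx u
            + (px - bx) * (B * A^-1 * P^-1) * cy u) * cx w
           - px * cx u * cy w))).
Proof.
move=> P0 A0 B0 v; apply: row2P; rewrite !row2E; move: (cx u) (cy u) (cx w) (cy w).
  by move=> *; field; apply/andP.
by move=> *; field; apply/and3P.
Qed.

(** If V = gauge w then V' = gauge w' plus the derivative of the frame along u:
    the terms in dder are that derivative, what remains is omega. *)
Lemma wcoef_gauge x u w : - wcoef tt x u (gauge x w) =
  row2 (expR (phi x - a x) *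
          ((dder phi x u - dder a x u) * cx w + cx (omega x u w)))
       (expR (phi x + phi x - b x) *
          ((dder phi x u + dder phi x u - dder b x u) * cy w + cy (omega x u w))).
Proof.
rewrite wcoefE /dder /gauge /omega /omega_d /omega_u /omega_l.
rewrite !expRD !expRN !expRD [cx (row2 (_ + _) (_ - _))]row2E
  [cy (row2 (_ + _) (_ - _))]row2E.
by apply: gauge_identity; rewrite gt_eqF// expR_gt0.
Qed.

Lemma is_derive_expR_comp (f : R -> R) t d : is_derive t (1 : R) f d ->
  is_derive t (1 : R) (fun s => expR (f s)) (expR (f t) * d).
Proof. by move=> df; exact: (is_derive1_comp (f := expR) (g := f)). Qed.

Lemma gauge_sum (E d w w' : R) : E * d * w + E * w' = E * (d * w + w').
Proof. by rewrite mulrDr mulrA. Qed.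

Lemma is_derive_gauge (g W : R -> pt) (t : R) (v : pt) :
  is_derive t 1 g v -> is_derive t 1 W (omega (g t) v (W t)) ->
  is_derive t 1 (fun s => gauge (g s) (W s))
    (- wcoef tt (g t) v (gauge (g t) (W t))).
Proof.
move=> dg dW; have [d1 d2] := is_derive_coord dW; rewrite wcoef_gauge.
have da := is_derive_dder dg (smooth_differentiable (g t) sa).
have db := is_derive_dder dg (smooth_differentiable (g t) sb).
have dp := is_derive_dder dg (smooth_differentiable (g t) sphi).
apply: is_derive_row2.
  apply: is_derive_eq (is_derive_mul (is_derive_expR_comp (is_deriveB dp da)) d1) _.
  exact: gauge_sum.
apply: is_derive_eq (is_derive_mul
  (is_derive_expR_comp (is_deriveB (is_deriveD dp dp) db)) d2) _.
exact: gauge_sum.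
Qed.

Lemma cancel_identity (E F p q V W : R) : E * F = 1 ->
  E * (p - q) * V + E * (F * ((q - p) * (E * V) + W)) = W.
Proof.
move=> EF; rewrite [E * (F * _)]mulrA EF mul1r; ring.
Qed.

Lemma is_derive_ungauge (g V : R -> pt) (t : R) (v : pt) :
  is_derive t 1 g v -> is_derive t 1 V (- wcoef tt (g t) v (V t)) ->
  is_derive t 1 (fun s => ungauge (g s) (V s))
    (omega (g t) v (ungauge (g t) (V t))).
Proof.
move=> dg; rewrite -{1}[V t](ungaugeK (g t)) wcoef_gauge => /is_derive_coord[].
rewrite !row2E => d1 d2.
have da := is_derive_dder dg (smooth_differentiable (g t) sa).
have db := is_derive_dder dg (smooth_differentiable (g t) sb).
have dp := is_derive_dder dg (smooth_differentiable (g t) sphi).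
move: (dder _ _ _) (dder _ _ _) (dder _ _ _) da db dp d1 d2.
move=> p1 a1 b1 da db dp d1 d2; apply: is_derive_row2.
  apply: is_derive_eq (is_derive_mul (is_derive_expR_comp (is_deriveB da dp)) d1) _.
  rewrite !row2E; apply: cancel_identity.
  by rewrite /= -expRD (_ : _ + _ = 0) ?expR0//; rewrite !fctE/=; ring.
apply: is_derive_eq (is_derive_mul
  (is_derive_expR_comp (is_deriveB db (is_deriveD dp dp))) d2) _.
rewrite !row2E; apply: cancel_identity.
by rewrite /= -expRD (_ : _ + _ = 0) ?expR0//; rewrite !fctE/=; ring.
Qed.

End Gauge.

(** * Two by two matrices *)

Notation mxI := (ord0 : 'I_2).
Notation mxII := (lift ord0 (ord0 : 'I_1) : 'I_2).

Section Mx2.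
Context (R : realType).
Local Notation pt := 'rV[R]_2.
Implicit Types (A B : 'M[R]_2).

Definition mx2 (p q r s : R) : 'M[R]_2 :=
  \matrix_(i, j) if i == ord0 then (if j == ord0 then p else q)
                 else (if j == ord0 then r else s).

Lemma mx2E p q r s : (mx2 p q r s mxI mxI = p) * (mx2 p q r s mxI mxII = q) *
  (mx2 p q r s mxII mxI = r) * (mx2 p q r s mxII mxII = s).
Proof. by rewrite !mxE. Qed.

Lemma I2P (i : 'I_2) : i = mxI \/ i = mxII.
Proof. by case: (unliftP ord0 i) => [j|] ->; [right; rewrite (ord1 j)|left]. Qed.

Lemma mx2P A B : A mxI mxI = B mxI mxI -> A mxI mxII = B mxI mxII ->
  A mxII mxI = B mxII mxI -> A mxII mxII = B mxII mxII -> A = B.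
Proof.
move=> h1 h2 h3 h4; apply/matrixP => i j.
by have [->|->] := I2P i; have [->|->] := I2P j.
Qed.

Lemma mx2_eta A : A = mx2 (A mxI mxI) (A mxI mxII) (A mxII mxI) (A mxII mxII).
Proof. by apply: mx2P; rewrite mx2E. Qed.

Lemma mulmx2 p q r s p' q' r' s' : mx2 p q r s *m mx2 p' q' r' s' =
  mx2 (p * p' + q * r') (p * q' + q * s') (r * p' + s * r') (r * q' + s * s').
Proof. by apply: mx2P; rewrite !mxE !big_ord_recl big_ord0 !mxE/= addr0. Qed.

Lemma mx2_1 : 1%:M = mx2 1 0 0 1.
Proof. by apply: mx2P; rewrite !mxE. Qed.

Lemma det_mx2 p q r s : \det (mx2 p q r s) = p * s - q * r.
Proof.
rewrite (expand_det_row _ ord0) !big_ord_recl big_ord0 /cofactor !det_mx11 !mxE/=.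
by rewrite addr0 !expr0 !expr1; ring.
Qed.

(** Matrices act on the row vectors of components as on columns. *)
Definition act A (w : pt) : pt :=
  row2 (A mxI mxI * cx w + A mxI mxII * cy w)
       (A mxII mxI * cx w + A mxII mxII * cy w).

Lemma act1 w : act 1%:M w = w.
Proof. by apply: row2P; rewrite !row2E mx2_1 !mx2E; ring. Qed.

Lemma actM A B w : act (A *m B) w = act A (act B w).
Proof.
rewrite (mx2_eta A) (mx2_eta B) mulmx2.
by apply: row2P; rewrite !row2E !mx2E; ring.
Qed.

End Mx2.

Section Tangent.
Context (R : realType).
Local Notation pt := 'rV[R]_2.
Variable (p : plane R).

Lemma tangent_plane (u : pt) :
  (fun _ : chart_index (plane R) => u) \in tangent_pred p.
Proof.
apply/mem_set; split=> [i j _ _|i]; last by case.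
exact/esym/plane_transition.
Qed.

Definition tvec (u : pt) : tangent p := Tangent (tangent_plane u).

Lemma tangentP (u v : tangent p) : components u tt = components v tt -> u = v.
Proof. by move=> uv; apply/val_inj/funext => -[]. Qed.

Lemma componentsD (u v : tangent p) i :
  components (u + v) i = components u i + components v i.
Proof. by []. Qed.

Lemma componentsZ (k : R) (u : tangent p) i :
  components (k *: u) i = k *: components u i.
Proof. by []. Qed.

End Tangent.

(** * The holonomy group in the moving frame *)

Section HolonomyFrame.
Context (R : realType).
Local Notation pt := 'rV[R]_2.
Variables (a b phi : pt -> R).
Hypotheses (sa : smooth_on setT a) (sb : smooth_on setT b)
  (sphi : smooth_on setT phi).
Local Notation gauge := (gauge a b phi).
Local Notation ungauge := (ungauge a b phi).
Local Notation omega := (omega a b phi).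
Local Notation wcoef := (wcoef a b phi).

Lemma gauge_linear x : linear (gauge x).
Proof. by move=> k u v; apply: row2P; rewrite !mxE/= ?mxE; ring. Qed.

Lemma act_linear (A : 'M[R]_2) : linear (act A).
Proof. by move=> k u v; apply: row2P; rewrite !mxE/= ?mxE; ring. Qed.

Variable p : plane R.

Definition tcoord (u : tangent p) : pt :=
  components u (tt : chart_index (plane R)).

(** Q is the basis change from the basis in which the group is given to the
    moving frame at p. *)
Definition frame_vec (Q : 'M[R]_2) (w : pt) : tangent p := tvec p (gauge p (act Q w)).

Lemma frame_vec_linear Q : linear (frame_vec Q).
Proof.
move=> k u v; apply: tangentP; rewrite componentsD componentsZ /=.
by rewrite act_linear gauge_linear.
Qed.

Lemma frame_vec0 Q : frame_vec Q 0 = 0.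
Proof.
by have := frame_vec_linear Q (-1) 0 0; rewrite scaler0 addr0 scaleN1r addNr.
Qed.

Lemma frame_vecM Q A w : frame_vec (Q *m A) w = frame_vec Q (act A w).
Proof. by rewrite /frame_vec actM. Qed.

Lemma frame_vec_surj u : u = frame_vec 1%:M (ungauge p (tcoord u)).
Proof. by apply: tangentP; rewrite /= act1 ungaugeK. Qed.

Definition ebasis (j : 'I_2) : pt := if j == ord0 then row2 1 0 else row2 0 1.

Definition frame Q (j : 'I_2) : tangent p := frame_vec Q (ebasis j).

Lemma sum_frame Q (c : 'I_2 -> R) :
  \sum_(i < 2) c i *: frame Q i = frame_vec Q (row2 (c mxI) (c mxII)).
Proof.
rewrite !big_ord_recl big_ord0 addr0 row2DZ frame_vec_linear; congr (_ + _).
have := frame_vec_linear Q (c mxII) (row2 0 1) 0.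
by rewrite addr0 frame_vec0 addr0.
Qed.

Lemma frame_basis Q : Q \in unitmx -> is_basis (frame Q).
Proof.
move=> uQ; pose g (u : tangent p) : 'I_2 -> R :=
  fun i => act (invmx Q) (ungauge p (tcoord u)) ord0 i.
exists g => [c|u].
  rewrite sum_frame /g /= gaugeK -actM mulVmx// act1.
  by apply/funext => i; have [->|->] := I2P i; rewrite row2E.
rewrite sum_frame /g row2_coord -frame_vecM mulmxV//; exact/esym/frame_vec_surj.
Qed.

Definition holonomy_frame (Gamma : connection_coef (plane R)) : set 'M[R]_2 :=
  [set T | exists2 L : {linear tangent p -> tangent p},
     holonomy Gamma p L & forall w, L (frame_vec 1%:M w) = frame_vec 1%:M (act T w)].

(** The freedom in the choice of the basis: a conjugate of the group of matrices
    in the moving frame is obtained in the basis given by the columns of Q. *)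
Lemma matrices_in_frame Q Gamma : Q \in unitmx ->
  matrices_in_basis (frame Q) (holonomy Gamma p) =
  [set A | holonomy_frame Gamma (Q *m A *m invmx Q)].
Proof.
move=> uQ; apply/seteqP; split=> A [L].
  move=> [HL LE]; exists L => // w.
  have -> : frame_vec 1%:M w = frame_vec Q (act (invmx Q) w) by rewrite -frame_vecM mulmxV.
  set w' := act (invmx Q) w.
  have -> : frame_vec Q w' = \sum_(i < 2) (fun i => w' ord0 i) i *: frame Q i.
    by rewrite sum_frame row2_coord.
  rewrite !big_ord_recl big_ord0 addr0 linearD !linearZ/= !LE.
  rewrite !(sum_frame Q (fun i => A i _)) !actM -/w' -frame_vecM mul1mx.
  rewrite -[X in _ + X]addr0.
  rewrite -(frame_vec0 Q) -frame_vec_linear -frame_vec_linear; congr (frame_vec Q _).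
  by apply: row2P; rewrite !mxE/=; ring.
move=> HL LE; exists L; split=> // j.
rewrite (sum_frame Q (fun i => A i j)) /frame.
have -> : frame_vec Q (ebasis j) = frame_vec 1%:M (act Q (ebasis j)) by rewrite -frame_vecM mul1mx.
rewrite LE -frame_vecM mul1mx !frame_vecM -(actM (invmx Q)) mulVmx// act1; congr (frame_vec Q _).
by have [->|->] := I2P j; apply: row2P; rewrite /ebasis /= !row2E; ring.
Qed.

End HolonomyFrame.

(** * Holonomy transformations come from solutions of a linear equation *)

Section HolonomyFlow.
Context (R : realType).
Local Notation pt := 'rV[R]_2.
Variables (a b phi : pt -> R).
Hypotheses (sa : smooth_on setT a) (sb : smooth_on setT b)
  (sphi : smooth_on setT phi).
Local Notation gauge := (gauge a b phi).
Local Notation ungauge := (ungauge a b phi).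
Local Notation omega := (omega a b phi).
Local Notation wcoef := (wcoef a b phi).

Lemma nbhs_itv (x y t : R) : t \in `]x, y[ -> nbhs t `[x, y]%classic.
Proof.
move=> txy; have : nbhs t `]x, y[%classic.
  by apply: open_nbhs_nbhs; split=> //; exact: interval_open.
by apply: filterS => z /=; rewrite !in_itv/= => /andP[/ltW-> /ltW->].
Qed.

(** The derivative of g is quantified in the equation, because it is determined by g. *)
Definition flow (g W : R -> pt) (x y : R) : Prop :=
  {within `[x, y], continuous W} /\
  forall t v, t \in `]x, y[ -> is_derive t 1 g v ->
    is_derive t 1 W (omega (g t) v (W t)).

Definition C1_piece (g : R -> pt) (x y : R) : Prop :=
  {within `[x, y], continuous g} /\
  exists2 v : R -> pt, {within `[x, y], continuous v} &
    forall t, t \in `]x, y[ -> is_derive t 1 g (v t).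

Lemma within_continuous_row2 (J : set R) (f g : R -> R) :
  {within J, continuous f} -> {within J, continuous g} ->
  {within J, continuous (fun t => row2 (f t) (g t))}.
Proof.
move=> cf cg x; apply: continuous_mx => i j; rewrite mxE.
under eq_fun do rewrite mxE.
by case: ifP => _; [exact: cf|exact: cg].
Qed.

Lemma within_continuousM (J : set R) (f g : R -> R) :
  {within J, continuous f} -> {within J, continuous g} ->
  {within J, continuous (fun t => f t * g t)}.
Proof. by move=> cf cg x; apply: cvgM; [exact: cf|exact: cg]. Qed.

Lemma within_continuousD (J : set R) (f g : R -> R) :
  {within J, continuous f} -> {within J, continuous g} ->
  {within J, continuous (fun t => f t + g t)}.
Proof. by move=> cf cg x; apply: cvgD; [exact: cf|exact: cg]. Qed.

Lemma within_continuousN (J : set R) (f : R -> R) :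
  {within J, continuous f} -> {within J, continuous (fun t => - f t)}.
Proof. by move=> cf x; apply: cvgN; exact: cf. Qed.

Lemma within_continuous_coord (J : set R) (f : R -> pt) i :
  {within J, continuous f} -> {within J, continuous (fun t => f t ord0 i)}.
Proof.
move=> cf x; apply: (@continuous_comp (subspace J) pt R f
  (fun M : pt => M ord0 i) x); first exact: cf.
exact: coord_continuous.
Qed.

Lemma within_continuous_smooth (J : set R) (f : pt -> R) (g : R -> pt) :
  smooth_on setT f -> {within J, continuous g} ->
  {within J, continuous (fun t => f (g t))}.
Proof.
move=> sf cg x; apply: (@continuous_comp (subspace J) pt R g f x);
  first exact: cg.
exact/differentiable_continuous/smooth_differentiable.
Qed.

Lemma within_continuous_ungauge (J : set R) (g V : R -> pt) :
  {within J, continuous g} -> {within J, continuous V} ->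
  {within J, continuous (fun t => ungauge (g t) (V t))}.
Proof.
move=> cg cV; apply: (within_continuous_row2
  (f := fun t => expR (a (g t) - phi (g t)) * cx (V t))
  (g := fun t => expR (b (g t) - (phi (g t) + phi (g t))) * cy (V t)));
  apply: within_continuousM.
- apply: (within_continuous_smooth (f := fun x => expR (a x - phi x))) => //.
  by apply/smooth_expR/smoothB.
- exact: within_continuous_coord.
- apply: (within_continuous_smooth
    (f := fun x => expR (b x - (phi x + phi x)))) => //.
  by apply/smooth_expR/smoothB => //; exact: smoothD.
- exact: within_continuous_coord.
Qed.

(** Writing parallel fields in the moving frame turns them into solutions of
    W' = omega(g') W. All curves must be considered here, but their solutions are
    given with the transformation: no existence theorem for differential
    equations is involved. *)
Lemma holonomy_flow p T : holonomy_frame a b phi p wcoef T ->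
  exists (s : seq R) (g : R -> pt),
    [/\ itv_partition 0 1 s,
        forall k, (k < size s)%N ->
          C1_piece g (nth 0 (0 :: s) k) (nth 0 (0 :: s) k.+1) &
        forall w, exists W : R -> pt,
          [/\ forall k, (k < size s)%N ->
                flow g W (nth 0 (0 :: s) k) (nth 0 (0 :: s) k.+1),
              W 0 = w & W 1 = act T w]].
Proof.
move=> [L [s [g [[sP _ gC1 g0 g1] HV]]] LE]; exists s, g.
have C1 k : (k < size s)%N ->
    C1_piece g (nth 0 (0 :: s) k) (nth 0 (0 :: s) k.+1).
  move=> ks; have [cg /(_ (tt : chart_index (plane R)))[v [cv dv]]] := gC1 k ks.
  split=> //; exists v.
    by apply: continuous_subspaceW cv => t pt_t; split.
  move=> t tk; apply: (deriv_within_is_derive (nbhs_itv tk)).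
  apply: dv => //; move: tk; rewrite /piece/= !in_itv/=.
  by move=> /andP[/ltW-> /ltW->].
split=> // w; have [V [[_ Vpar] V0 V1]] := HV (frame_vec a b phi p 1%:M w).
pose V' t := V t (tt : chart_index (plane R)).
exists (fun t => ungauge (g t) (V' t)); split.
- move=> k ks; split.
    apply: within_continuous_ungauge; first exact: (C1 k ks).1.
    apply: deriv_within_continuous => t kt.
    by have [v [_ dV]] := Vpar k (tt : chart_index (plane R)) t ks kt I;
      exists (- wcoef tt (g t) v (V' t)).
  move=> t v tk dg.
  have kt : piece s k t.
    by move: tk; rewrite /piece/= !in_itv/= => /andP[/ltW-> /ltW->].
  have [v' [dv' dV]] := Vpar k (tt : chart_index (plane R)) t ks kt I.
  have dv2 := deriv_within_is_derive (nbhs_itv tk) dv'.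
  have vE : v' = v.
    have [_ <-] := dv2; have [_ <-] := dg; by [].
  rewrite vE in dV.
  exact: (is_derive_ungauge sa sb sphi dg
    (deriv_within_is_derive (nbhs_itv tk) dV)).
- by rewrite /V' V0 g0 /= act1 gaugeK.
- by rewrite /V' V1 LE g1 /= act1 gaugeK.
Qed.

End HolonomyFlow.

(** * Polygonal loops *)

Section Glue.
Context (R : realType) (T : Type).

(** Concatenation of the curves f 0, ..., f (n - 1), each of them run through
    in time 1/n. The minimum puts the end point t = 1 on the last curve. *)
Definition glue (f : nat -> R -> T) (n : nat) (t : R) : T :=
  let k := minn (Num.truncn (n%:R * t)) n.-1 in f k (n%:R * t - k%:R).

Lemma glueE (f : nat -> R -> T) n k t :
  (forall i, (i.+1 < n)%N -> f i 1 = f i.+1 0) -> (k < n)%N ->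
  k%:R <= n%:R * t <= k.+1%:R -> glue f n t = f k (n%:R * t - k%:R).
Proof.
move=> fE kn /andP[kt tk]; rewrite /glue.
have nt0 : 0 <= n%:R * t by exact: le_trans kt.
have [tk'|tk'] := ltP (n%:R * t) k.+1%:R.
  have -> : Num.truncn (n%:R * t) = k by apply: truncn_def; rewrite kt.
  by rewrite (minn_idPl _)// -ltnS prednK//; exact: leq_ltn_trans kn.
have {tk tk'}E : n%:R * t = k.+1%:R by apply/eqP; rewrite eq_le tk tk'.
rewrite E natrK.
have [kn'|kn'] := ltnP k.+1 n.
  rewrite (minn_idPl _); last by rewrite -ltnS prednK//; exact: ltn_trans kn'.
  by rewrite subrr -fE// -natrB// subSnn.
have -> : minn k.+1 n.-1 = k.
  have -> : n = k.+1 by apply/eqP; rewrite eqn_leq kn' kn.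
  exact/minn_idPr.
by rewrite -natrB.
Qed.

End Glue.

Section UniformPartition.
Context (R : realType).

Definition uniform_seq (n : nat) : seq R := [seq i%:R / n%:R | i <- iota 1 n].

Lemma size_uniform_seq n : size (uniform_seq n) = n.
Proof. by rewrite size_map size_iota. Qed.

Lemma nth_uniform_seq n k : (k <= n)%N ->
  nth 0 (0 :: uniform_seq n) k = k%:R / n%:R.
Proof.
case: k => [_|k kn]; first by rewrite mul0r.
by rewrite /= (nth_map 0%N) ?size_iota// nth_iota.
Qed.

Lemma uniform_partition n : (0 < n)%N -> itv_partition 0 1 (uniform_seq n).
Proof.
move=> n0; have n0' : 0 < n%:R :> R by rewrite ltr0n.
split.
  apply/(pathP 0) => k; rewrite size_uniform_seq => kn.
  have /= := nth_uniform_seq kn => ->.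
  by rewrite nth_uniform_seq 1?ltnW// ltr_pM2r ?invr_gt0// ltr_nat.
by rewrite (last_nth 0) size_uniform_seq nth_uniform_seq// divff// gt_eqF.
Qed.

Lemma uniform_piece n k (t : R) : (k < n)%N -> piece (uniform_seq n) k t ->
  k%:R <= n%:R * t <= k.+1%:R.
Proof.
move=> kn; rewrite /piece/= in_itv/=.
have /= := nth_uniform_seq kn => ->; rewrite nth_uniform_seq 1?ltnW//.
have n0 : 0 < n%:R :> R by rewrite ltr0n; exact: leq_ltn_trans kn.
by rewrite ler_pdivrMr// ler_pdivlMr// ![t * _]mulrC.
Qed.

End UniformPartition.

Section Transport.
Context (R : realType).
Local Notation pt := 'rV[R]_2.
Variables (a b phi : pt -> R).
Hypotheses (sa : smooth_on setT a) (sb : smooth_on setT b)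
  (sphi : smooth_on setT phi).
Local Notation gauge := (gauge a b phi).
Local Notation ungauge := (ungauge a b phi).
Local Notation omega := (omega a b phi).
Local Notation wcoef := (wcoef a b phi).

Definition line (P Q : pt) (t : R) : pt := P + t *: (Q - P).

(** The fundamental matrix of the transport equation along a segment. *)
Definition seg_sol (P Q : pt) (F : R -> 'M[R]_2) : Prop :=
  F 0 = 1%:M /\ forall (t : R) (w : pt), 0 <= t <= 1 ->
    is_derive t 1 (fun s => act (F s) w) (omega (line P Q t) (Q - P) (act (F t) w)).

(** The existence of the fundamental matrix is part of the predicate: only
    segments along which the equation is solved in closed form are used. *)
Definition seg (P Q : pt) (A : 'M[R]_2) : Prop :=
  exists2 F, seg_sol P Q F & F 1 = A.

(** Transport along broken lines. The last segment acts last, so its matrix is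
    the leftmost factor. *)
Inductive transp (P : pt) : pt -> 'M[R]_2 -> Prop :=
| Transp0 : transp P P 1%:M
| TranspS Q S A B : transp P Q A -> seg Q S B -> transp P S (B *m A).

Lemma transp_comp P Q S A B : transp P Q A -> transp Q S B ->
  transp P S (B *m A).
Proof.
move=> tA; elim=> [|Q' S' A' B' _ IH sB]; first by rewrite mul1mx.
by rewrite -mulmxA; exact: TranspS IH sB.
Qed.

Lemma transp_seg P Q A : seg P Q A -> transp P Q A.
Proof. by move=> s; rewrite -[A]mulmx1; exact: TranspS (Transp0 P) s. Qed.

Lemma omegaZ (k : R) x u w : omega x (k *: u) w = k *: omega x u w.
Proof.
rewrite /omega /omega_d /omega_u /omega_l.
by apply: row2P; rewrite !mxE/=;
  move: (expR _) (expR _) (dx a x) (dx b x) (dx phi x) (dy a x) (dy phi x) => *;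
  ring.
Qed.

Lemma opp_wcoefZ (k : R) x u v :
  - wcoef tt x (k *: u) v = k *: (- wcoef tt x u v).
Proof.
rewrite !wcoefE /dder; move: (expR _) (expR _) => E F.
move: (dx a x) (dx b x) (dx phi x) (dy a x) (dy b x) (dy phi x) => *.
by apply: row2P; rewrite !mxE/= ?mxE; ring.
Qed.

Lemma seg_const P : seg P P 1%:M.
Proof.
exists (fun=> 1%:M) => //; split=> // t w _.
have -> : omega (line P P t) (P - P) (act 1%:M w) = 0.
  by rewrite subrr; have := omegaZ 0 (line P P t) 0 (act 1%:M w); rewrite !scale0r.
exact: is_derive_cst.
Qed.

Lemma line0 P Q : line P Q 0 = P.
Proof. by rewrite /line scale0r addr0. Qed.

Lemma line1 P Q : line P Q 1 = Q.
Proof. by rewrite /line scale1r addrC subrK. Qed.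

(** The list of vertices q, of fundamental matrices F and of partial products C
    of a broken line; a constant segment ensures that there is at least one. *)
Lemma transp_data P Q A : transp P Q A ->
  exists (n : nat) (q : nat -> pt) (F : nat -> R -> 'M[R]_2) (C : nat -> 'M[R]_2),
    [/\ (0 < n)%N, q 0%N = P, q n = Q, C 0%N = 1%:M & C n = A] /\
    forall k, (k < n)%N ->
      seg_sol (q k) (q k.+1) (F k) /\ C k.+1 = F k 1 *m C k.
Proof.
elim=> [|Q' S A' B _ [n [q [F [C [[n0 q0 qn C0 Cn] HF]]]]] [G sG G1]].
  have [G sG G1] := seg_const P.
  exists 1%N, (fun=> P), (fun=> G), (fun=> 1%:M); split=> // k _.
  by split=> //=; rewrite G1 mulmx1.
exists n.+1, (fun k => if (k <= n)%N then q k else S),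
  (fun k => if (k < n)%N then F k else G),
  (fun k => if (k <= n)%N then C k else B *m A').
split; first by rewrite ltnn.
move=> k; rewrite ltnS => kn /=; have [->|kn'] := eqVneq k n.
  by rewrite leqnn ltnn qn Cn G1.
have {}kn : (k < n)%N by rewrite ltn_neqAle kn'.
by rewrite kn (ltnW kn); exact: HF.
Qed.

Lemma deriv_within_eq (V : normedModType R) (J : set R) (f g : R -> V) (t : R) (l : V) :
  (forall s, J s -> f s = g s) -> J t -> deriv_within J f t l ->
  deriv_within J g t l.
Proof.
move=> fg Jt; apply: cvg_trans; apply: near_eq_cvg; rewrite near_withinE.
by near=> s => Js; rewrite !fg.
Unshelve. all: by end_near. Qed.

Lemma is_derive_affine (V : normedModType R) (f : R -> V) (n k t : R) (l : V) :
  is_derive (n * t - k) 1 f l -> is_derive t 1 (fun s => f (n * s - k)) (n *: l).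
Proof.
move=> [df <-]; have {}df : differentiable f (n * t - k).
  exact/derivable1_diffP.
have dn : is_derive t 1 (fun s => n * s - k) n.
  by apply: is_derive_eq; rewrite /GRing.scale/= mulr1 subr0.
have := is_derive_comp_curve dn df.
have -> : 'd f (n * t - k) n = n *: 'D_1 f (n * t - k); last by [].
by rewrite deriveE// -linearZ/= [n *: 1]mulr1.
Qed.

Lemma is_derive_line P Q (t : R) : is_derive t 1 (line P Q) (Q - P).
Proof. exact: is_derive_ray. Qed.

Lemma glue_piece (V : normedModType R) (f : nat -> R -> V) n k (t : R) (l : V) :
  (forall i, (i.+1 < n)%N -> f i 1 = f i.+1 0) -> (k < n)%N ->
  piece (uniform_seq R n) k t -> is_derive (n%:R * t - k%:R) 1 (f k) l ->
  deriv_within (piece (uniform_seq R n) k) (glue f n) t (n%:R *: l).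
Proof.
move=> fE kn kt df.
apply: (deriv_within_eq (f := fun s => f k (n%:R * s - k%:R))) => //.
  by move=> s ks; rewrite (glueE fE kn)//; exact: uniform_piece ks.
exact/is_derive_within/is_derive_affine.
Qed.

Lemma piecewise_continuous (V : normedModType R) n (f : R -> V) : (0 < n)%N ->
  (forall k, (k < n)%N -> {within piece (uniform_seq R n) k, continuous f}) ->
  {within `[0, 1], continuous f}.
Proof.
move=> n0 cf; have n0' : 0 < n%:R :> R by rewrite ltr0n.
suff H k : (k <= n)%N -> {within `[0, k%:R / n%:R], continuous f}.
  by have := H n (leqnn n); rewrite divff// gt_eqF.
elim: k => [_|k IH kn].
  by rewrite mul0r set_itv1; exact: continuous_subspace1.
have := withinU_continuous _ _ (IH (ltnW kn)) (cf k kn).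
rewrite /piece; have /= -> := nth_uniform_seq R kn.
rewrite nth_uniform_seq 1?ltnW// => H.
apply: continuous_subspaceW (H _ _); [|exact: interval_closed..].
move=> t /=; rewrite !in_itv/= => /andP[t0 ->]; rewrite t0 /= andbT.
by have [|/ltW] := leP t (k%:R / n%:R); [left|right].
Qed.

(** A closed broken line is a piecewise C^1 loop once its sides are run through
    in equal times; the parallel field starting from w is glued from the
    fundamental matrices applied to the partial products. *)
Lemma transp_holonomy (p : plane R) T : transp p p T -> holonomy_frame a b phi p wcoef T.
Proof.
move=> /transp_data[n [q [F [C [[n0 q0 qn C0 Cn] HF]]]]].
have TE : linear (fun u : tangent p =>
    frame_vec a b phi p T (ungauge p (tcoord u))).
  move=> k u v; rewrite -frame_vec_linear; congr (frame_vec _ _ _ _ _ _).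
  have -> : tcoord (k *: u + v) = k *: tcoord u + tcoord v by [].
  by apply: row2P; rewrite !mxE/=; ring.
pose L : {linear tangent p -> tangent p} := HB.pack
  (fun u : tangent p => frame_vec a b phi p T (ungauge p (tcoord u)))
  (GRing.isLinear.Build _ _ _ _ _ TE).
have LE w : L (frame_vec a b phi p 1%:M w) = frame_vec a b phi p 1%:M (act T w).
  by rewrite /= /tcoord/= gaugeK act1 -[in RHS]frame_vecM mul1mx.
exists L => //.
pose f i := line (q i) (q i.+1).
have fE i : (i.+1 < n)%N -> f i 1 = f i.+1 0 by move=> _; rewrite /f line1 line0.
pose g := glue f n.
have ng0 (U : Type) (h : nat -> R -> U) : glue h n 0 = h 0%N 0.
  by rewrite /glue mulr0 truncn0 min0n subr0.
have ng1 (U : normedModType R) (h : nat -> R -> U) :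
    (forall i, (i.+1 < n)%N -> h i 1 = h i.+1 0) -> glue h n 1 = h n.-1 1.
  move=> hE; rewrite (glueE (k := n.-1) hE) ?prednK// ?mulr1.
    by rewrite -{2}(prednK n0) -natr1 addrAC subrr add0r.
  by rewrite lexx ler_nat leq_pred.
have k01 k t : (k < n)%N -> piece (uniform_seq R n) k t ->
    0 <= n%:R * t - k%:R <= 1.
  move=> kn /(uniform_piece kn); rewrite subr_ge0 => /andP[-> H] /=.
  by rewrite lerBlDr nat1r.
have dg k t : (k < n)%N -> piece (uniform_seq R n) k t ->
    deriv_within (piece (uniform_seq R n) k) g t (n%:R *: (q k.+1 - q k)).
  by move=> kn kt; apply: glue_piece => //; exact: is_derive_line.
exists (uniform_seq R n), g; split.
  split.
  - exact: uniform_partition.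
  - apply: (piecewise_continuous n0) => k kn.
    by apply: deriv_within_continuous => t kt; eexists; exact: dg.
  - move=> k; rewrite size_uniform_seq => kn; split.
      by apply: deriv_within_continuous => t kt; eexists; exact: dg.
    move=> i; exists (fun=> n%:R *: (q k.+1 - q k)); split.
      by apply: continuous_subspaceT => x; exact: cvg_cst.
    by move=> t kt _; exact: dg.
  - by rewrite /g ng0 /f line0.
  - by rewrite /g ng1// /f line1 prednK.
move=> u; pose w := ungauge p (tcoord u).
pose h i s := gauge (f i s) (act (F i s) (act (C i) w)).
have hE i : (i.+1 < n)%N -> h i 1 = h i.+1 0.
  move=> ni; rewrite /h fE//.
  have [_ ->] := HF i (ltnW ni); have [[-> _] _] := HF _ ni.
  by rewrite actM act1.
exists (fun t _ => glue h n t); split.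
- split; first by move=> t _; exact: tangent_plane.
  move=> k i t; rewrite size_uniform_seq => kn kt _.
  exists (n%:R *: (q k.+1 - q k)); split; first exact: dg.
  have Ef : g t = f k (n%:R * t - k%:R).
    by rewrite /g (glueE fE kn)//; exact: uniform_piece kt.
  have Eh : glue h n t = h k (n%:R * t - k%:R).
    by rewrite (glueE hE kn)//; exact: uniform_piece kt.
  have -> : - weighted (M := plane R) phi (fun=> christoffel a b) i
       (chart i (g t)) (n%:R *: (q k.+1 - q k)) (glue h n t) =
     n%:R *: (- wcoef tt (f k (n%:R * t - k%:R)) (q k.+1 - q k)
                (h k (n%:R * t - k%:R))).
    rewrite Eh -Ef /h -Ef; case: i.
    exact: opp_wcoefZ.
  apply: glue_piece => //.
  have [[_ dF] _] := HF k kn.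
  by apply: is_derive_gauge => //; [exact: is_derive_line|exact/dF/k01].
- rewrite ng0 /h /f line0 q0; have [[-> _] _] := HF 0%N n0.
  by rewrite C0 !act1 /w ungaugeK; apply/funext => -[].
- rewrite ng1// /h /f line1 prednK// qn -actM.
  have n1n : (n.-1 < n)%N by rewrite prednK.
  have [_ CE] := HF n.-1 n1n; rewrite -CE prednK// Cn.
  by apply/funext => -[].
Qed.

End Transport.

(** * Upper bounds for holonomy groups *)

Section Groups.
Context (R : realType).

(** The identity component of the group of matrices of determinant 1 commuting
    with the companion matrix (0, -d; 1, 0). *)
Definition one_param_group (d : R) : set 'M[R]_2 :=
  [set A | exists c s, [/\ A = mx2 c (- (d * s)) s c, c * c + d * (s * s) = 1 &
                           d <= 0 -> 0 < c]].

Definition borel_group : set 'M[R]_2 :=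
  [set A | exists l m, A = mx2 l m 0 l^-1 /\ 0 < l].

Definition sl2_group : set 'M[R]_2 := [set A | \det A = 1].

Definition trivial_group : set 'M[R]_2 := [set 1%:M].

End Groups.

Section UpperBounds.
Context (R : realType).
Local Notation pt := 'rV[R]_2.
Variables (a b phi : pt -> R).
Hypotheses (sa : smooth_on setT a) (sb : smooth_on setT b)
  (sphi : smooth_on setT phi).
Local Notation omega := (omega a b phi).
Local Notation wcoef := (wcoef a b phi).

(** The bilinear forms that are conserved by a connection form bound the
    holonomy from above. *)
Definition bilin (k l m n : R) (w z : pt) : R :=
  k * (cx w * cx z) + l * (cx w * cy z) + m * (cy w * cx z) + n * (cy w * cy z).

Lemma bilin_conserved_piece (k l m n : R) (g W Z : R -> pt) (x y t : R) :
  (forall p u w z, bilin k l m n (omega p u w) z + bilin k l m n w (omega p u z) = 0) ->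
  C1_piece g x y -> flow a b phi g W x y -> flow a b phi g Z x y ->
  t \in `[x, y] -> bilin k l m n (W t) (Z t) = bilin k l m n (W x) (Z x).
Proof.
move=> B0 [_ [v _ dg]] [cW dW] [cZ dZ].
apply: (constant_itv (f := fun t => bilin k l m n (W t) (Z t))).
  have cx_ := within_continuous_coord (i := mxI) cW.
  have cy_ := within_continuous_coord (i := mxII) cW.
  have cx' := within_continuous_coord (i := mxI) cZ.
  have cy' := within_continuous_coord (i := mxII) cZ.
  have cC (c : R) : {within `[x, y], continuous (fun _ : R => c)}.
    by apply: continuous_subspaceT => z; exact: cvg_cst.
  by rewrite /bilin; do 3?[apply: within_continuousD];
    apply: within_continuousM => //; exact: within_continuousM.
move=> {}t txy; have [dw1 dw2] := is_derive_coord (dW t _ txy (dg t txy)).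
have [dz1 dz2] := is_derive_coord (dZ t _ txy (dg t txy)).
have dc c (f : R -> R) d : is_derive t 1 f d ->
    is_derive t 1 (fun t => c * f t) (c * d).
  move=> df; apply: is_derive_eq (is_derive_mul (is_derive_cst c t 1) df) _.
  by rewrite mul0r add0r.
apply: is_derive_eq (is_deriveD (is_deriveD (is_deriveD
  (dc k _ _ (is_derive_mul dw1 dz1)) (dc l _ _ (is_derive_mul dw1 dz2)))
  (dc m _ _ (is_derive_mul dw2 dz1))) (dc n _ _ (is_derive_mul dw2 dz2))) _.
rewrite -(B0 (g t) (v t) (W t) (Z t)) /bilin.
move: (omega (g t) (v t) (W t)) (omega (g t) (v t) (Z t)) => ow oz.
by move: (cx ow) (cy ow) (cx oz) (cy oz) => *; ring.
Qed.

Section Loop.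
Variables (s : seq R) (g : R -> pt).
Hypotheses (sP : itv_partition 0 1 s)
  (gC1 : forall k, (k < size s)%N ->
     C1_piece g (nth 0 (0 :: s) k) (nth 0 (0 :: s) k.+1)).

Definition loop_flow (W : R -> pt) : Prop := forall k, (k < size s)%N ->
  flow a b phi g W (nth 0 (0 :: s) k) (nth 0 (0 :: s) k.+1).

Lemma bilin_conserved (k l m n : R) (W Z : R -> pt) :
  (forall p u w z, bilin k l m n (omega p u w) z + bilin k l m n w (omega p u z) = 0) ->
  loop_flow W -> loop_flow Z ->
  (forall i, (i <= size s)%N -> bilin k l m n (W (nth 0 (0 :: s) i))
    (Z (nth 0 (0 :: s) i)) = bilin k l m n (W 0) (Z 0)) /\
  bilin k l m n (W 1) (Z 1) = bilin k l m n (W 0) (Z 0).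
Proof.
move=> B0 fW fZ; pose P t := bilin k l m n (W t) (Z t) = bilin k l m n (W 0) (Z 0).
have PS i : (i < size s)%N -> P (nth 0 (0 :: s) i) ->
    forall t, piece s i t -> P t.
  move=> iS Pi t it; rewrite /P -Pi.
  by apply: (bilin_conserved_piece B0 (gC1 iS)); [exact: fW|exact: fZ|].
split; first exact: (partition_ind (P := P) sP).
exact: (partition_ind1 (P := P) sP).
Qed.

Lemma positive_conserved (W : R -> pt) : loop_flow W -> 0 < cx (W 0) ->
  (forall i t, (i < size s)%N -> piece s i t -> cx (W t) != 0) -> 0 < cx (W 1).
Proof.
move=> fW W0 Wn0; apply: (partition_ind1 (P := fun t => 0 < cx (W t)) sP) => //.
move=> k ks kp t kt.
apply: (gt0_itv (f := fun t => cx (W t)) _ _ kp kt).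
  exact: within_continuous_coord (fW k ks).1.
by move=> x kx; exact: Wn0 kx.
Qed.

End Loop.

(** The connection form has trace zero, so it preserves the area form. *)
Lemma det_conserved p u w z :
  bilin 0 1 (-1) 0 (omega p u w) z + bilin 0 1 (-1) 0 w (omega p u z) = 0.
Proof.
rewrite /bilin /omega !row2E.
move: (omega_d _ _ _) (omega_u _ _ _ _ _) (omega_l _ _ _ _ _) => *.
by ring.
Qed.

(** The columns of a holonomy matrix are the end values of two solutions, so an
    identity conserved by pairs of solutions is an identity between the entries
    of the matrix. *)
Lemma holonomy_columns p T : holonomy_frame a b phi p wcoef T ->
  exists (s : seq R) (g W Z : R -> pt),
    [/\ itv_partition 0 1 s,
        forall k, (k < size s)%N ->
          C1_piece g (nth 0 (0 :: s) k) (nth 0 (0 :: s) k.+1),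
        loop_flow s g W, loop_flow s g Z &
        [/\ W 0 = row2 1 0, Z 0 = row2 0 1,
            W 1 = row2 (T mxI mxI) (T mxII mxI) &
            Z 1 = row2 (T mxI mxII) (T mxII mxII)]].
Proof.
move=> /(holonomy_flow sa sb sphi)[s [g [sP gC1 HW]]].
have [W [fW W0 W1]] := HW (row2 1 0); have [Z [fZ Z0 Z1]] := HW (row2 0 1).
exists s, g, W, Z; split=> //; split=> //.
  by rewrite W1; apply: row2P; rewrite !row2E; ring.
by rewrite Z1; apply: row2P; rewrite !row2E; ring.
Qed.

Lemma holonomy_det p T : holonomy_frame a b phi p wcoef T -> \det T = 1.
Proof.
move=> /holonomy_columns[s [g [W [Z [sP gC1 fW fZ [W0 Z0 W1 Z1]]]]]].
have [_] := bilin_conserved sP gC1 det_conserved fW fZ.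
rewrite W0 Z0 W1 Z1 /bilin !row2E (mx2_eta T) det_mx2 !mx2E => H.
by rewrite -[RHS](_ : 0 * (1 * 0) + 1 * (1 * 1) + -1 * (0 * 0) + 0 * (0 * 1) = 1 :> R);
  [rewrite -H|]; ring.
Qed.

(** A connection form with values in the line of the companion matrix preserves
    w1 z1 + d w2 z2 as well as the area; a matrix that preserves both commutes
    with the companion matrix. For d <= 0 the value 1 of the form at the first
    solution keeps its first component away from 0, hence positive. *)
Lemma one_param_upper (d : R) (rho : pt -> pt -> R) p T :
  (forall x u w, omega x u w = row2 (- (d * rho x u * cy w)) (rho x u * cx w)) ->
  holonomy_frame a b phi p wcoef T -> one_param_group d T.
Proof.
move=> omE HT; have dT := holonomy_det HT.
have [s [g [W [Z [sP gC1 fW fZ [W0 Z0 W1 Z1]]]]]] := holonomy_columns HT.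
have B0 q u w z : bilin 1 0 0 d (omega q u w) z + bilin 1 0 0 d w (omega q u z) = 0.
  by rewrite /bilin !omE !row2E; move: (rho q u) => *; ring.
have [BW BWW1] := bilin_conserved sP gC1 B0 fW fW.
have [_ BZ] := bilin_conserved sP gC1 B0 fZ fZ.
have [_ BWZ] := bilin_conserved sP gC1 B0 fW fZ.
move: BWW1 BZ BWZ; rewrite W0 Z0 W1 Z1 /bilin !row2E => E1 E2 E3.
move: dT; rewrite (mx2_eta T) det_mx2.
have c0 : d <= 0 -> 0 < T mxI mxI.
  move=> d0; have := positive_conserved sP fW; rewrite W0 W1 !row2E; apply=> //.
  move=> i t iS it.
  have it' : t \in `[nth 0 (0 :: s) i, nth 0 (0 :: s) i.+1] := it.
  have := bilin_conserved_piece B0 (gC1 i iS) (fW i iS) (fW i iS) it'.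
  rewrite BW 1?ltnW// W0 /bilin !row2E => E.
  apply/eqP => W0'; move: E; rewrite W0'.
  rewrite !(mul0r, mulr0, mul1r, mulr1, add0r, addr0) => E.
  have : d * (cy (W t) * cy (W t)) <= 0.
    by rewrite mulr_le0_ge0// -expr2 sqr_ge0.
  by rewrite E ler10.
move: (T mxI mxI) (T mxI mxII) (T mxII mxI) (T mxII mxII) E1 E2 E3 c0.
move=> p0 q r s0 E1 E2 E3 c0 E4.
(* multiply by the conserved value 1, then use orthogonality of the columns
   and det = 1 *)
have Es : s0 = p0.
  have -> : s0 = s0 * (1 * (p0 * p0) + 0 * (p0 * r) + 0 * (r * p0) + d * (r * r)).
    by rewrite E1; ring.
  have -> : s0 * (1 * (p0 * p0) + 0 * (p0 * r) + 0 * (r * p0) + d * (r * r)) =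
     p0 * (p0 * s0 - q * r) + r * (1 * (p0 * q) + 0 * (p0 * s0) + 0 * (r * q) + d * (r * s0)).
    by ring.
  by rewrite E3 E4; ring.
have Eq : q = - (d * r).
  have -> : q = q * (1 * (p0 * p0) + 0 * (p0 * r) + 0 * (r * p0) + d * (r * r)).
    by rewrite E1; ring.
  have -> : q * (1 * (p0 * p0) + 0 * (p0 * r) + 0 * (r * p0) + d * (r * r)) =
     - (d * r) * (p0 * s0 - q * r) + p0 * (1 * (p0 * q) + 0 * (p0 * s0) + 0 * (r * q) + d * (r * s0)).
    by ring.
  by rewrite E3 E4; ring.
exists p0, r; rewrite Es Eq; split=> //.
by have -> : p0 * p0 + d * (r * r) = 1 * (p0 * p0) + 0 * (p0 * r) + 0 * (r * p0) + d * (r * r)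
  by [ring]; rewrite E1; ring.
Qed.

(** The second component of a solution satisfies a scalar homogeneous linear
    equation, so it stays 0 if it starts there. The first component then cannot
    vanish because the area is conserved. *)
Lemma borel_upper p T : (forall x u, omega_l a b phi x u = 0) ->
  holonomy_frame a b phi p wcoef T -> borel_group T.
Proof.
move=> ol0 HT; have dT := holonomy_det HT.
have [s [g [W [Z [sP gC1 fW fZ [W0 Z0 W1 Z1]]]]]] := holonomy_columns HT.
have Wy0 k : (k < size s)%N -> cy (W (nth 0 (0 :: s) k)) = 0 ->
    forall t, piece s k t -> cy (W t) = 0.
  move=> ks Wk t kt; have [cg [v cv dg]] := gC1 k ks; have [cW dW] := fW k ks.
  set x := nth 0 (0 :: s) k in cg cv dg cW dW Wk.
  set y := nth 0 (0 :: s) k.+1 in cg cv dg cW dW.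
  have xy : x <= y by apply/ltW; exact: itv_partition_lt.
  have cc : {within `[x, y], continuous (fun t => - omega_d phi (g t) (v t))}.
    apply: within_continuousN; apply: within_continuousM.
      by apply: within_continuous_smooth => //; exact: smooth_dx.
    exact: within_continuous_coord.
  have [K HK] := bounded_itv xy cc.
  apply: (linear_ode_zero (u := fun t => cy (W t)) (K := K)
    (c := fun t => - omega_d phi (g t) (v t)) _ _ _ Wk kt).
  - exact: within_continuous_coord.
  - move=> z zxy; have [_] := is_derive_coord (dW z _ zxy (dg z zxy)).
    by rewrite /omega row2E ol0 mul0r add0r mulNr.
  - move=> z; rewrite in_itv/= => /andP[xz zy].
    apply: le_trans (ler_norm _) (HK _ _).
    by rewrite in_itv/= !ltW.
have Wy : cy (W 0) = 0 by rewrite W0 row2E.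
have Wi := partition_ind (P := fun t => cy (W t) = 0) sP Wy Wy0.
have := partition_ind1 (P := fun t => cy (W t) = 0) sP Wy Wy0.
rewrite W1 row2E => T10.
have [Bi _] := bilin_conserved sP gC1 det_conserved fW fZ.
have T00 : 0 < T mxI mxI.
  have := positive_conserved sP fW; rewrite W0 W1 !row2E; apply=> //.
  move=> i t iS it.
  have it' : t \in `[nth 0 (0 :: s) i, nth 0 (0 :: s) i.+1] := it.
  have := bilin_conserved_piece det_conserved (gC1 i iS) (fW i iS) (fZ i iS) it'.
  rewrite Bi 1?ltnW// /bilin (Wy0 i iS (Wi i (ltnW iS)) t it) W0 Z0 !row2E => E.
  apply/eqP => Wx; move: E; rewrite Wx.
  by rewrite !(mul0r, mulr0, mul1r, mulr1, add0r, addr0) => /eqP; rewrite eq_sym oner_eq0.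
exists (T mxI mxI), (T mxI mxII); split=> //.
have : T mxI mxI * T mxII mxII = 1.
  by rewrite -dT [in RHS](mx2_eta T) T10 det_mx2 mulr0 subr0.
move=> E; apply: mx2P; rewrite mx2E//.
by apply: (mulfI (negbT (gt_eqF T00))); rewrite E mulfV// gt_eqF.
Qed.

End UpperBounds.

(** * Explicit transport along segments *)

Section DiffRules.
Context (R : realType).
Local Notation pt := 'rV[R]_2.
Implicit Types (f g : pt -> R).

Lemma diff_mulE f g x u : smooth_on setT f -> smooth_on setT g ->
  'd (fun x => f x * g x : R) x u = f x * 'd g x u + g x * 'd f x u.
Proof.
move=> sf sg.
by have /(congr1 (fun h => h u)) := diffM (smooth_differentiable x sf)
  (smooth_differentiable x sg).
Qed.

Lemma diff_addE f g x u : smooth_on setT f -> smooth_on setT g ->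
  'd (fun x => f x + g x : R) x u = 'd f x u + 'd g x u.
Proof.
move=> sf sg.
by have /(congr1 (fun h => h u)) := diffD (smooth_differentiable x sf)
  (smooth_differentiable x sg).
Qed.

Lemma diff_cstE (c : R) (x u : pt) : 'd (fun _ : pt => c) x u = 0.
Proof. by rewrite (_ : (fun=> c) = cst c)// diff_cst. Qed.

Lemma diff_cmulE (c : R) f x u : smooth_on setT f ->
  'd (fun x => c * f x : R) x u = c * 'd f x u.
Proof.
move=> sf; apply: etrans (diff_mulE x u (@smooth_cst R pt R c) sf) _.
by rewrite (diff_cstE c x u) mulr0 addr0.
Qed.

Lemma diff_caddE (c : R) f x u : smooth_on setT f ->
  'd (fun x => c + f x : R) x u = 'd f x u.
Proof.
move=> sf; apply: etrans (diff_addE x u (@smooth_cst R pt R c) sf) _.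
by rewrite (diff_cstE c x u) add0r.
Qed.

Lemma diff_coordE i (x u : pt) : 'd (fun v : pt => v ord0 i : R) x u = u ord0 i.
Proof.
have l : linear (fun u : pt => u ord0 i : R) by move=> k v w; rewrite !mxE.
pose L : {linear pt -> R} := HB.pack (fun u : pt => u ord0 i : R)
  (GRing.isLinear.Build _ _ _ _ _ l).
have cL : continuous L by exact: coord_continuous.
by have /(congr1 (fun h => h u)) E := diff_lin x cL; exact: E.
Qed.

Lemma diff_ycomp (h : R -> R) (dh : R) (x u : pt) : is_derive (cy x) 1 h dh ->
  'd (fun x : pt => h (cy x) : R) x u = dh * cy u.
Proof.
move=> ih; have [_ E] := diff_comp1 ih (smooth_differentiable x (@smooth_cy R)).
by rewrite -(diff_coordE _ x); exact: E.
Qed.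

Lemma dxy_ycomp (h : R -> R) (dh : R) (x : pt) : is_derive (cy x) 1 h dh ->
  dx (fun x : pt => h (cy x)) x = 0 /\ dy (fun x : pt => h (cy x)) x = dh.
Proof.
move=> ih; split; rewrite /dx /dy (diff_ycomp _ ih) row2E; first exact: mulr0.
exact: mulr1.
Qed.

End DiffRules.

Section SegmentSolutions.
Context (R : realType).
Local Notation pt := 'rV[R]_2.
Variables (a b phi : pt -> R).
Local Notation seg := (seg a b phi).
Local Notation transp := (transp a b phi).

Lemma is_derive_lin2 (p q : R -> R) (t dp dq c d : R) :
  is_derive t 1 p dp -> is_derive t 1 q dq ->
  is_derive t 1 (fun s => p s * c + q s * d) (dp * c + dq * d).
Proof.
move=> ip iq; apply: is_derive_eq (is_deriveD
  (is_derive_mul ip (is_derive_cst c t 1)) (is_derive_mul iq (is_derive_cst d t 1))) _.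
by rewrite !mulr0 !addr0.
Qed.

(** The transport equation for the fundamental matrix (p, q; r, z). *)
Lemma seg_mx P Q (p q r z : R -> R) :
  [/\ p 0 = 1, q 0 = 0, r 0 = 0 & z 0 = 1] ->
  (forall t : R, 0 <= t <= 1 ->
    let od := omega_d phi (line P Q t) (Q - P) in
    let ou := omega_u a b phi (line P Q t) (Q - P) in
    let ol := omega_l a b phi (line P Q t) (Q - P) in
    [/\ is_derive t 1 p (od * p t + ou * r t),
        is_derive t 1 q (od * q t + ou * z t),
        is_derive t 1 r (ol * p t - od * r t) &
        is_derive t 1 z (ol * q t - od * z t)]) ->
  seg P Q (mx2 (p 1) (q 1) (r 1) (z 1)).
Proof.
move=> [p0 q0 r0 z0] H.
exists (fun t => mx2 (p t) (q t) (r t) (z t)) => //; split.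
  by rewrite p0 q0 r0 z0 mx2_1.
move=> t w /H[dp dq dr dz]; rewrite /act.
have E s : row2 (mx2 (p s) (q s) (r s) (z s) mxI mxI * cx w +
                 mx2 (p s) (q s) (r s) (z s) mxI mxII * cy w)
                (mx2 (p s) (q s) (r s) (z s) mxII mxI * cx w +
                 mx2 (p s) (q s) (r s) (z s) mxII mxII * cy w) =
           row2 (p s * cx w + q s * cy w) (r s * cx w + z s * cy w).
  by rewrite !mx2E.
under eq_fun do rewrite E.
rewrite E; have := is_derive_row2 (is_derive_lin2 (cx w) (cy w) dp dq)
  (is_derive_lin2 (cx w) (cy w) dr dz).
move=> /is_derive_eq; apply; rewrite /omega !row2E.
move: (omega_d _ _ _) (omega_u _ _ _ _ _) (omega_l _ _ _ _ _) => *.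
by apply: row2P; rewrite !row2E; ring.
Qed.

Lemma seg_trivial P Q :
  (forall t, [/\ omega_d phi (line P Q t) (Q - P) = 0,
     omega_u a b phi (line P Q t) (Q - P) = 0 &
     omega_l a b phi (line P Q t) (Q - P) = 0]) -> seg P Q 1%:M.
Proof.
move=> H; rewrite mx2_1.
apply: (@seg_mx P Q (fun=> 1) (fun=> 0) (fun=> 0) (fun=> 1)) => // t _ /=.
have [-> -> ->] := H t.
by split; apply: is_derive_eq (is_derive_cst _ t 1) _; ring.
Qed.

Lemma transp1 P Q S : transp P Q 1%:M -> transp Q S 1%:M -> transp P S 1%:M.
Proof. by move=> h1 h2; have := transp_comp h1 h2; rewrite mul1mx. Qed.

(** When vertical segments and the segments of the line y = 0 have trivial
    transport, a loop around a rectangle based on that line has the transport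
    of its upper side. *)
Lemma rectangle_transp (h w : R) (A : 'M[R]_2) (P : pt) :
  (forall P Q : pt, cx P = cx Q -> seg P Q 1%:M) ->
  (forall P Q : pt, cy P = 0 -> cy Q = 0 -> seg P Q 1%:M) ->
  seg (row2 (cx P) h) (row2 (cx P + w) h) A -> transp P P A.
Proof.
move=> vert hor sA.
have v (P0 Q : pt) : cx P0 = cx Q -> transp P0 Q 1%:M by move=> /vert /transp_seg.
have h0 (P0 Q : pt) : cy P0 = 0 -> cy Q = 0 -> transp P0 Q 1%:M.
  by move=> P00 /(hor _ _ P00)/transp_seg.
have t1 : transp P (row2 (cx P) h) 1%:M by apply: v; rewrite row2E.
have t2 := transp_comp t1 (transp_seg sA).
have t3 : transp (row2 (cx P + w) h) (row2 (cx P + w) 0) 1%:M.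
  by apply: v; rewrite !row2E.
have t4 : transp (row2 (cx P + w) 0) (row2 (cx P) 0) 1%:M.
  by apply: h0; rewrite row2E.
have t5 : transp (row2 (cx P) 0) P 1%:M by apply: v; rewrite row2E.
have := transp_comp t2 (transp1 (transp1 t3 t4) t5).
by rewrite mul1mx mulmx1.
Qed.

End SegmentSolutions.

Section FlatLines.
Context (R : realType).
Local Notation pt := 'rV[R]_2.
Variables (ha hp ha' hp' : R -> R).
Hypotheses (dha : forall y : R, is_derive y 1 ha (ha' y))
  (dhp : forall y : R, is_derive y 1 hp (hp' y)).
Let a (x : pt) := ha (cy x).
Let phi (x : pt) := hp (cy x).

(** For a conformal metric and a density that depend on y only, the connection
    form vanishes on vertical vectors, and the derivatives of ha and hp can be
    chosen to give it any off-diagonal value on each horizontal line. *)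
Lemma omega_conformal (x u : pt) :
  [/\ omega_d phi x u = 0,
      omega_u a a phi x u = (hp' (cy x) - ha' (cy x)) * expR (hp (cy x)) * cx u &
      omega_l a a phi x u = ha' (cy x) * expR (- hp (cy x)) * cx u].
Proof.
have [a1 a2] := dxy_ycomp (x := x) (dha (cy x)).
have [p1 p2] := dxy_ycomp (x := x) (dhp (cy x)).
rewrite /omega_d /omega_u /omega_l a1 a2 p1 p2 /a /phi addrK subrr sub0r.
by rewrite !(mul0r, subr0, addr0).
Qed.

Lemma conformal_vertical (P Q : pt) : cx P = cx Q -> seg a a phi P Q 1%:M.
Proof.
move=> PQ; apply: seg_trivial => t.
have [-> -> ->] := omega_conformal (line P Q t) (Q - P).
by rewrite !mxE PQ subrr !mulr0.
Qed.

Lemma conformal_bottom (P Q : pt) : ha' 0 = 0 -> hp' 0 = 0 -> cy P = 0 ->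
  cy Q = 0 -> seg a a phi P Q 1%:M.
Proof.
move=> a0 p0 P0 Q0; apply: seg_trivial => t.
have [-> -> ->] := omega_conformal (line P Q t) (Q - P).
by rewrite !mxE P0 Q0 subrr mulr0 addr0 a0 p0 subrr !mul0r.
Qed.

Lemma line_horizontal (x x' y t : R) :
  (cy (line (row2 x y) (row2 x' y) t) = y) *
  (cx (row2 x' y - row2 x y) = x' - x).
Proof. by rewrite !mxE/= subrr mulr0 addr0. Qed.

End FlatLines.

(** * Realizing the one-parameter groups *)

Section Realizable.
Context (R : realType).
Local Notation pt := 'rV[R]_2.

(** The basis of the tangent space is free in the definition of the holonomy
    group, which therefore is defined up to conjugation. Asking for all conjugates
    allows to replace a subgroup by a conjugate in normal form. *)
Definition realizable (G : set 'M[R]_2) : Prop := forall Q, Q \in unitmx ->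
  exists D : manifold_with_density R 2,
    weighted_holonomy_is D [set A | G (Q *m A *m invmx Q)].

(** The two inclusions: every holonomy matrix lies in G, and every element of G
    is the transport of a broken line based at p. *)
Lemma realize (a b phi : pt -> R) (G : set 'M[R]_2) :
  smooth_on setT a -> smooth_on setT b -> smooth_on setT phi ->
  (forall p T, holonomy_frame a b phi p (wcoef a b phi) T -> G T) ->
  (forall p T, G T -> transp a b phi p p T) -> realizable G.
Proof.
move=> sa sb sphi GU GL Q uQ; exists (diag_plane sa sb sphi), (fun _ => christoffel a b).
split=> [|p]; first exact: diag_levi_civita.
exists (frame a b phi p Q); split; first exact: frame_basis.
rewrite -[weighted _ _]/(wcoef a b phi) matrices_in_frame//.
apply/seteqP; split=> A /=; first exact: GU.
by move=> /(GL p) /(transp_holonomy sa sb sphi).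
Qed.

Lemma circle_param (c s : R) : c * c + s * s = 1 ->
  exists t, cos t = c /\ sin t = s.
Proof.
move=> E; have c01 : -1 <= c <= 1.
  have : c * c <= 1 by rewrite -E lerDl -expr2 sqr_ge0.
  by move=> *; apply/andP; split; nra.
have ss : Num.sqrt (1 - c ^+ 2) = `|s|.
  by rewrite -E expr2 addrAC subrr add0r -expr2 sqrtr_sqr.
have [s0|s0] := leP 0 s.
  by exists (acos c); rewrite acosK// sin_acos// ss ger0_norm.
exists (- acos c); rewrite cosN sinN acosK// sin_acos// ss ltr0_norm//.
by rewrite opprK.
Qed.

(** Cosine and sine for d = 1, their hyperbolic analogues for d = -1, and
    1, t for d = 0. *)
Lemma one_param_functions (d : R) : d = 0 \/ d = 1 \/ d = -1 ->
  exists c s : R -> R, [/\ c 0 = 1, s 0 = 0,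
    forall t : R, is_derive t 1 c (- (d * s t)),
    forall t : R, is_derive t 1 s (c t) &
    forall c0 s0, c0 * c0 + d * (s0 * s0) = 1 -> (d <= 0 -> 0 < c0) ->
      exists t, c t = c0 /\ s t = s0].
Proof.
case=> [->|[->|->]].
- exists (fun=> 1), id; split=> //.
  + by move=> t; rewrite mul0r oppr0; exact: is_derive_cst.
  + by move=> t; exact: is_derive_id.
  + move=> c0 s0; rewrite mul0r addr0 => c1 /(_ (lexx _)) c0p; exists s0.
    split=> //; apply/esym/eqP; rewrite -(@eqrXn2 _ 2%N)// ?ltW//.
    by rewrite expr2 c1 expr1n.
- exists cos, sin; split=> //; [exact: cos0|exact: sin0| | |].
  + by move=> t; rewrite mul1r; exact: is_derive_cos.
  + by move=> t; exact: is_derive_sin.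
  + by move=> c0 s0; rewrite mul1r => E _; exact: circle_param.
- have dE (k : R) (t : R) : is_derive t 1 (fun t => expR (k * t)) (expR (k * t) * k).
    apply: is_derive_expR_comp.
    by apply: is_derive_eq; rewrite /GRing.scale/= mulr1.
  exists (fun t => (expR (1 * t) + expR (-1 * t)) * 2^-1),
         (fun t => (expR (1 * t) - expR (-1 * t)) * 2^-1); split=> //.
  + by rewrite !mulr0 expR0; field.
  + by rewrite !mulr0 expR0; field.
  + move=> t; apply: is_derive_eq (is_derive_mul
      (is_deriveD (dE 1 t) (dE (-1) t)) (is_derive_cst (2^-1 : R) t 1)) _.
    by rewrite /=; move: (expR _) (expR _) => *; ring.
  + move=> t; apply: is_derive_eq (is_derive_mul
      (is_deriveB (dE 1 t) (dE (-1) t)) (is_derive_cst (2^-1 : R) t 1)) _.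
    by rewrite /=; move: (expR _) (expR _) => *; ring.
  + move=> c0 s0 E /(_ (lerN10 _)) c0p.
    have E' : (c0 + s0) * (c0 - s0) = 1 by rewrite -E; ring.
    have cs0 : 0 < c0 + s0 by nra.
    exists (ln (c0 + s0)); rewrite !mul1r mulN1r expRN lnK//.
    have -> : (c0 + s0)^-1 = c0 - s0.
      by apply: (mulfI (negbT (gt_eqF cs0))); rewrite E' mulfV// gt_eqF.
    by split; field.
Qed.

Section OneParam.
Variables (d : R) (ha hp ha' hp' : R -> R).
Hypotheses (dha : forall y : R, is_derive y 1 ha (ha' y))
  (dhp : forall y : R, is_derive y 1 hp (hp' y)).
Let a (x : pt) := ha (cy x).
Let phi (x : pt) := hp (cy x).
Hypotheses (sa : smooth_on setT a) (sphi : smooth_on setT phi).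

(** The differential equation for ha and hp says that the connection form is a
    multiple of the companion matrix of d. The horizontal line y = 0 has trivial
    transport since both derivatives vanish there, while the line y = 1 has the
    nonzero speed k, so that the transport of a rectangle of height 1 runs through
    the one-parameter group. *)
Lemma one_param_realizable : d = 0 \/ d = 1 \/ d = -1 ->
  (forall y, (hp' y - ha' y) * expR (hp y) = - (d * (ha' y * expR (- hp y)))) ->
  ha' 0 = 0 -> hp' 0 = 0 -> ha' 1 != 0 -> realizable (one_param_group d).
Proof.
move=> d3 E a0 p0 a1; have omE := omega_conformal dha dhp.
apply: (realize sa sa sphi) => p T.
  apply: (one_param_upper sa sa sphi
    (rho := fun x u => ha' (cy x) * expR (- hp (cy x)) * cx u)) => x u w.
  have [e1 e2 e3] := omE x u; rewrite /omega [omega_d _ _ _]e1.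
  rewrite [omega_u _ _ _ _ _]e2 [omega_l _ _ _ _ _]e3 E.
  by apply: row2P; rewrite !row2E; ring.
move=> [c0 [s0 [-> cs c0p]]].
have [c [s [c00 s00 dc ds cs_surj]]] := one_param_functions d3.
have [tau [<- <-]] := cs_surj _ _ cs c0p.
pose k := ha' 1 * expR (- hp 1).
have k0 : k != 0 by rewrite mulf_neq0// gt_eqF// expR_gt0.
apply: (@rectangle_transp _ _ _ _ 1 (tau / k)).
- exact: conformal_vertical dha dhp.
- by move=> P Q; exact: conformal_bottom dha dhp _ _ a0 p0.
have -> : mx2 (c tau) (- (d * s tau)) (s tau) (c tau) =
    mx2 (c (tau * 1)) (- (d * s (tau * 1))) (s (tau * 1)) (c (tau * 1)).
  by rewrite mulr1.
have dmul (f : R -> R) (df t : R) : is_derive (tau * t) 1 f df ->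
    is_derive t 1 (fun t => f (tau * t)) (df * tau).
  move=> idf; have := is_derive1_comp (g := fun t => tau * t) idf.
  apply; by apply: is_derive_eq; rewrite /GRing.scale/= mulr1.
have dd (f : R -> R) (df t : R) : is_derive t 1 f df ->
    is_derive t 1 (fun t => - (d * f t)) (- (d * df)).
  move=> idf; have := is_deriveN (is_derive_mul (is_derive_cst d t 1) idf).
  by rewrite mul0r add0r.
apply: (@seg_mx _ a a phi _ _ (fun t => c (tau * t)) (fun t => - (d * s (tau * t)))
  (fun t => s (tau * t)) (fun t => c (tau * t))).
  by rewrite mulr0 c00 s00 mulr0 oppr0.
move=> t _; set P := row2 _ _; set Q := row2 _ _ => od ou ol.
have [e1 e2 e3] := omE (line P Q t) (Q - P).
have yE : cy (line P Q t) = 1 by rewrite /P /Q line_horizontal.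
have xE : cx (Q - P) = tau / k by (rewrite /P /Q !mxE/=); rewrite addrAC subrr add0r.
have -> : od = 0 by rewrite /od [LHS]e1.
have -> : ou = - (d * tau).
  by rewrite /ou [LHS]e2 E yE xE -/k; field.
have -> : ol = tau.
  by rewrite /ol [LHS]e3 yE xE -/k; field.
split.
- by apply: is_derive_eq (dmul _ _ _ (dc (tau * t))) _; ring.
- by apply: is_derive_eq (dd _ _ _ (dmul _ _ _ (ds (tau * t)))) _; ring.
- by apply: is_derive_eq (dmul _ _ _ (ds (tau * t))) _; ring.
- by apply: is_derive_eq (dmul _ _ _ (dc (tau * t))) _; ring.
Qed.

End OneParam.

End Realizable.

(** * Realizing the trivial group and the whole group *)

Section Cases.
Context (R : realType).
Local Notation pt := 'rV[R]_2.

(** A matrix with nonzero lower left entry is a product of three elementary ones,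
    and adding a row to another reduces to this case. *)
Lemma sl2_generated (H : 'M[R]_2 -> Prop) :
  (forall A B, H A -> H B -> H (A *m B)) ->
  (forall u, H (mx2 1 u 0 1)) -> (forall u, H (mx2 1 0 u 1)) ->
  forall A, \det A = 1 -> H A.
Proof.
move=> HM HU HL A; rewrite (mx2_eta A).
move: (A mxI mxI) (A mxI mxII) (A mxII mxI) (A mxII mxII) => p q r s.
rewrite det_mx2 => dA.
have key p' q' r' s' : r' != 0 -> p' * s' - q' * r' = 1 -> H (mx2 p' q' r' s').
  move=> r0 d1.
  have -> : mx2 p' q' r' s' = mx2 1 ((p' - 1) / r') 0 1 *m mx2 1 0 r' 1
                              *m mx2 1 ((s' - 1) / r') 0 1.
    have q'E : q' = (p' * s' - 1) / r' by rewrite -d1; field.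
    by rewrite !mulmx2; apply: mx2P; rewrite !mx2E ?q'E; field.
  by apply: (HM); [apply: (HM)|].
have [r0|r0] := eqVneq r 0; last exact: key.
have p0 : p != 0.
  by apply/eqP => p0; move: dA; rewrite p0 r0; move/eqP;
     rewrite mul0r mulr0 subr0 eq_sym oner_eq0.
have -> : mx2 p q r s = mx2 1 0 (-1) 1 *m mx2 p q (r + p) (s + q).
  by rewrite !mulmx2; apply: mx2P; rewrite !mx2E; ring.
apply: (HM) => //; apply: key; first by rewrite r0 add0r.
by rewrite -dA; ring.
Qed.

Section SL2.
Variables (ha hp ha' hp' : R -> R).
Hypotheses (dha : forall y : R, is_derive y 1 ha (ha' y))
  (dhp : forall y : R, is_derive y 1 hp (hp' y)).
Let a (x : pt) := ha (cy x).
Let phi (x : pt) := hp (cy x).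
Hypotheses (sa : smooth_on setT a) (sphi : smooth_on setT phi).
Hypotheses (a0 : ha' 0 = 0) (p0 : hp' 0 = 0).

Lemma conformal_side (h w : R) (P : pt) :
  let ou := (hp' h - ha' h) * expR (hp h) * w in
  let ol := ha' h * expR (- hp h) * w in
  (ol = 0 -> seg a a phi (row2 (cx P) h) (row2 (cx P + w) h) (mx2 1 ou 0 1)) /\
  (ou = 0 -> seg a a phi (row2 (cx P) h) (row2 (cx P + w) h) (mx2 1 0 ol 1)).
Proof.
move=> ou ol; set Q := row2 _ h; set Q' := row2 _ h.
have E t : [/\ omega_d phi (line Q Q' t) (Q' - Q) = 0,
    omega_u a a phi (line Q Q' t) (Q' - Q) = ou &
    omega_l a a phi (line Q Q' t) (Q' - Q) = ol].
  have [e1 e2 e3] := omega_conformal dha dhp (line Q Q' t) (Q' - Q).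
  have yE : cy (line Q Q' t) = h by rewrite /Q /Q' line_horizontal.
  have xE : cx (Q' - Q) = w by (rewrite /Q /Q' !mxE/=); rewrite addrAC subrr add0r.
  by split; [exact: e1|apply: etrans e2 _; rewrite yE xE|
                       apply: etrans e3 _; rewrite yE xE].
have dl (c : R) t : is_derive t (1 : R) (fun t : R => c * t) c.
  by apply: is_derive_eq; rewrite /GRing.scale/= mulr1.
split=> o0.
  have -> : mx2 1 ou 0 1 = mx2 1 (ou * 1) 0 1 by rewrite mulr1.
  apply: (@seg_mx _ a a phi _ _ (fun=> 1) (fun t => ou * t) (fun=> 0) (fun=> 1)).
    by rewrite mulr0.
  move=> t _; have [-> -> ->] := E t; rewrite o0; split.
  - by apply: is_derive_eq (is_derive_cst _ t 1) _; ring.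
  - by apply: is_derive_eq (dl _ _) _; ring.
  - by apply: is_derive_eq (is_derive_cst _ t 1) _; ring.
  - by apply: is_derive_eq (is_derive_cst _ t 1) _; ring.
have -> : mx2 1 0 ol 1 = mx2 1 0 (ol * 1) 1 by rewrite mulr1.
apply: (@seg_mx _ a a phi _ _ (fun=> 1) (fun=> 0) (fun t => ol * t) (fun=> 1)).
  by rewrite mulr0.
move=> t _; have [-> -> ->] := E t; rewrite o0; split.
- by apply: is_derive_eq (is_derive_cst _ t 1) _; ring.
- by apply: is_derive_eq (is_derive_cst _ t 1) _; ring.
- by apply: is_derive_eq (dl _ _) _; ring.
- by apply: is_derive_eq (is_derive_cst _ t 1) _; ring.
Qed.

Lemma conformal_loop (h w : R) (P : pt) A :
  seg a a phi (row2 (cx P) h) (row2 (cx P + w) h) A -> transp a a phi P P A.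
Proof.
apply: rectangle_transp; first exact: conformal_vertical dha dhp.
by move=> Q Q'; exact: conformal_bottom dha dhp _ _ a0 p0.
Qed.

(** Transport along the line of height y is an upper unipotent, along the line of
    height z a lower one: where ha' = 0, respectively hp' = ha', one of the two
    off-diagonal entries of the connection form vanishes. *)
Lemma sl2_realizable (y z : R) : ha' y = 0 -> hp' y != 0 ->
  hp' z = ha' z -> ha' z != 0 -> realizable (@sl2_group R).
Proof.
move=> ay py pz az; apply: (realize sa sa sphi) => p T; first exact: holonomy_det.
apply: sl2_generated => [A B|u|u]; first by move=> tA tB; exact: transp_comp tB tA.
  pose k := hp' y * expR (hp y).
  have k0 : k != 0 by rewrite mulf_neq0// gt_eqF// expR_gt0.
  have [H _] := conformal_side y (u / k) p; apply: (@conformal_loop y (u / k)).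
  have E : (hp' y - ha' y) * expR (hp y) * (u / k) = u.
    by rewrite ay subr0 -/k; field.
  by rewrite E in H; apply: H; rewrite ay !mul0r.
pose k := ha' z * expR (- hp z).
have k0 : k != 0 by rewrite mulf_neq0// gt_eqF// expR_gt0.
have [_ H] := conformal_side z (u / k) p; apply: (@conformal_loop z (u / k)).
have E : ha' z * expR (- hp z) * (u / k) = u by rewrite -/k; field.
by rewrite E in H; apply: H; rewrite pz subrr !mul0r.
Qed.

End SL2.

Lemma is_derive_sqr_half (y : R) : is_derive y 1 (fun y : R => 2^-1 * (y * y)) y.
Proof.
apply: is_derive_eq (is_derive_mul (is_derive_cst (2^-1 : R) y 1)
  (is_derive_mul (is_derive_id y 1) (is_derive_id y 1))) _.
by rewrite /=; field.
Qed.

Lemma smooth_sqr_half : smooth_on setT (fun x : pt => 2^-1 * (cy x * cy x) : R).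
Proof.
apply: smoothM; first exact: smooth_cst.
by apply: smoothM; exact: smooth_cy.
Qed.

(** For the flat metric with constant density the connection form is 0, so it
    takes its values in both lines for d = 0 and d = 1. The two groups meet in
    the identity. *)
Lemma trivial_realizable : realizable (@trivial_group R).
Proof.
have s0 := @smooth_cst R pt R 0.
apply: (realize s0 s0 s0) => p T; last by move=> ->; exact: Transp0.
move=> HT; have omE x u w : omega (fun=> 0) (fun=> 0) (fun=> 0) x u w = 0 :> pt.
  rewrite /omega /omega_d /omega_u /omega_l /dx /dy !(diff_cstE 0).
  by apply: row2P; rewrite row2E mxE; ring.
have H d : one_param_group d T.
  apply: (one_param_upper s0 s0 s0 (rho := fun _ _ => 0) _ HT) => x u w.
  by rewrite omE; apply: row2P; rewrite row2E mxE; ring.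
have [c [s [TE + /(_ (lexx _)) c0]]] := H 0; rewrite mul0r addr0 => c1.
have [c' [s' [E + _]]] := H 1; rewrite TE in E.
have := congr1 (fun A : 'M[R]_2 => A mxI mxI) E.
have := congr1 (fun A : 'M[R]_2 => A mxII mxI) E; rewrite !mx2E => <- <-.
rewrite mul1r c1 => /eqP; rewrite -subr_eq0 addrAC subrr add0r mulf_eq0 orbb.
move=> /eqP s_0; rewrite /trivial_group/= TE mx2_1 s_0 mulr0 oppr0.
have -> : c = 1 by apply/eqP; rewrite -(@eqrXn2 _ 2%N)// ?ltW// expr2 c1 expr1n.
by [].
Qed.

Lemma parabolic_realizable : realizable (@one_param_group R 0).
Proof.
have d1 := is_derive_sqr_half; have s1 := smooth_sqr_half.
apply: (one_param_realizable d1 d1 s1 s1) => //; first by left.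
by move=> y; rewrite subrr !mul0r oppr0.
Qed.

Lemma elliptic_realizable : realizable (@one_param_group R 1).
Proof.
have d1 := is_derive_sqr_half; have s1 := smooth_sqr_half.
have d0 (y : R) : is_derive y 1 (fun _ : R => 0 : R) ((fun=> 0) y).
  exact: is_derive_cst.
have s0 := @smooth_cst R pt R 0.
apply: (one_param_realizable d1 d0 s1 s0) => //; first by right; left.
by move=> y; rewrite sub0r oppr0 expR0 !mulr1 mul1r.
Qed.

(** With hp = y^2 / 2, the choice ha = ln (1 + e^(2 hp)) / 2 solves the required
    equation (hp' - ha') e^hp = ha' e^(- hp). *)
Lemma hyperbolic_realizable : realizable (@one_param_group R (-1)).
Proof.
have d1 := is_derive_sqr_half; have s1 := smooth_sqr_half.
pose q (y : R) := 2^-1 * (y * y).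
pose E y := 1 + expR (q y + q y).
have E0 y : 0 < E y by rewrite ltr_pwDl// ?ltr01// expR_ge0.
have dE (y : R) : is_derive y 1 E (expR (q y + q y) * (y + y)).
  have := is_deriveD (is_derive_cst (1 : R) y 1)
    (is_derive_expR_comp (is_deriveD (d1 y) (d1 y))).
  by rewrite add0r.
pose ha y := 2^-1 * ln (E y); pose ha' y := y * (expR (q y) * expR (q y)) / E y.
have dha (y : R) : is_derive y 1 ha (ha' y).
  have := is_derive_mul (is_derive_cst (2^-1 : R) y 1)
    (is_derive1_comp (is_derive1_ln (E0 y)) (dE y)).
  move=> /is_derive_eq; apply; rewrite mul0r add0r /ha' expRD /cst.
  by have := E0 y; move: (E y) (expR _) => e X e0; field; rewrite gt_eqF.
have sq : smooth_on setT (fun x : pt => q (cy x)) := s1.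
have sha : smooth_on setT (fun x : pt => ha (cy x)).
  apply: smoothM; first exact: smooth_cst.
  apply: smooth_ln => [x|]; first exact: E0.
  by apply: smoothD; [exact: smooth_cst|apply: smooth_expR; exact: smoothD].
apply: (one_param_realizable dha d1 sha sq) => //.
- by right; right.
- move=> y; rewrite /ha' -/(q y) expRN mulN1r opprK.
  have := E0 y; rewrite /E expRD; have := expR_gt0 (q y).
  move: (expR _) => X X0 e0; field.
  by rewrite !gt_eqF.
- by rewrite /ha' !mul0r.
- by rewrite /ha' mul1r !mulf_neq0 ?invr_neq0// gt_eqF ?expR_gt0.
Qed.

(** Here ha' = y^2 - y and hp' = - 2 y, so ha' vanishes at 1 and equals hp' at -1. *)
Lemma SL2_realizable : realizable (@sl2_group R).
Proof.
pose ha (y : R) := 3^-1 * (y * (y * y)) + - (2^-1 * (y * y)).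
pose hp (y : R) := -1 * (y * y).
have dX (y : R) : is_derive y 1 (fun y : R => y * y) (y + y).
  apply: is_derive_eq (is_derive_mul (is_derive_id y 1) (is_derive_id y 1)) _.
  by rewrite mul1r mulr1.
have dha (y : R) : is_derive y 1 ha (y * y - y).
  apply: is_derive_eq (is_deriveD (is_derive_mul (is_derive_cst (3^-1 : R) y 1)
    (is_derive_mul (is_derive_id y 1) (dX y)))
    (is_deriveN (is_derive_sqr_half y))) _.
  by rewrite /=; field.
have dhp (y : R) : is_derive y 1 hp (- (y + y)).
  apply: is_derive_eq (is_derive_mul (is_derive_cst (-1 : R) y 1) (dX y)) _.
  by rewrite /=; ring.
have cC (c : R) := @smooth_cst R pt R c.
have sy := @smooth_cy R.
have syy := smoothM sy sy.
have sha : smooth_on setT (fun x : pt => ha (cy x)).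
  apply: smoothD; first exact: smoothM (cC _) (smoothM sy syy).
  exact/smoothN/smooth_sqr_half.
have shp : smooth_on setT (fun x : pt => hp (cy x)) by exact: smoothM (cC _) syy.
apply: (sl2_realizable dha dhp sha shp _ _ (y := 1) (z := -1)); last first.
- by apply/eqP => h; lra.
- by lra.
- by apply/eqP => h; lra.
- by lra.
- by lra.
- by lra.
Qed.

End Cases.

(** * Realizing the triangular group *)

Section Borel.
Context (R : realType).
Local Notation pt := 'rV[R]_2.

(** The metric dx^2 + P dy^2 with phi = ln P / 2, where P = 1 + x^2 kap(y). As a = 0
    and b = phi, the lower left entry of the connection form vanishes. The function
    kap vanishes to second order at 0 and 1, where horizontal segments have trivial
    transport; its derivative vanishes at 1/2, where horizontal segments have
    diagonal transport; and vertical segments have unipotent transport, with entry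
    x times the increment of the primitive Kap of kap. *)
Let kap (y : R) : R := (y * (1 - y)) * (y * (1 - y)).
Let dkap (y : R) : R := 2 * (y * (1 - y)) * (1 - 2 * y).
Let Kap (y : R) : R := 3^-1 * y ^+ 3 - 2^-1 * y ^+ 4 + 5^-1 * y ^+ 5.
Let P (x : pt) : R := 1 + cx x * cx x * kap (cy x).
Let phi (x : pt) : R := 2^-1 * ln (P x).
Let zero (_ : pt) : R := 0.

Let dX (n : nat) (y : R) : is_derive y 1 (fun y : R => y ^+ n.+1) (n.+1%:R * y ^+ n).
Proof.
apply: DeriveDef; first exact: exprn_derivable.
by rewrite exp_derive /GRing.scale/= mulr1.
Qed.

Let dkapE (y : R) : is_derive y 1 kap (dkap y).
Proof.
have d1 : is_derive y 1 (fun y : R => 1 - y) (-1).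
  have := is_deriveB (is_derive_cst (1 : R) y 1) (is_derive_id y 1).
  by rewrite sub0r.
have d2 := is_derive_mul (is_derive_id y (1 : R)) d1.
apply: is_derive_eq (is_derive_mul d2 d2) _.
by rewrite /dkap; ring.
Qed.

Let dKapE (y : R) : is_derive y 1 Kap (kap y).
Proof.
have dc (c : R) n := is_derive_mul (is_derive_cst c y 1) (dX n y).
apply: is_derive_eq (is_deriveD (is_deriveB (dc 3^-1 2%N) (dc 2^-1 3%N)) (dc 5^-1 4%N)) _.
by rewrite /kap /cst; field.
Qed.

Let kap_ge0 y : 0 <= kap y. Proof. by rewrite /kap -expr2 sqr_ge0. Qed.

Let P_gt0 x : 0 < P x.
Proof. by rewrite ltr_pwDl// mulr_ge0// -expr2 sqr_ge0. Qed.

Let smooth_kap : smooth_on setT (fun x : pt => kap (cy x)).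
Proof.
have s1 : smooth_on setT (fun x : pt => cy x * (1 - cy x)).
  apply: smoothM; first exact: smooth_cy.
  by apply: smoothB; [exact: smooth_cst|exact: smooth_cy].
exact: smoothM.
Qed.

Let smooth_xx : smooth_on setT (fun x : pt => cx x * cx x : R).
Proof. by apply: smoothM; exact: smooth_cx. Qed.

Let smooth_P : smooth_on setT P.
Proof. by apply: smoothD; [exact: smooth_cst|exact: smoothM]. Qed.

Let smooth_phi : smooth_on setT phi.
Proof. by apply: smoothM; [exact: smooth_cst|exact: smooth_ln]. Qed.

Let smooth_zero : smooth_on setT zero := @smooth_cst R pt R 0.

Let diff_phi x u : 'd phi x u =
  (P x)^-1 * (cx x * kap (cy x) * cx u + 2^-1 * (cx x * cx x * dkap (cy x)) * cy u).
Proof.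
have -> : 'd phi x u = 2^-1 * 'd (fun x => ln (P x)) x u.
  exact: diff_cmulE (smooth_ln P_gt0 smooth_P).
have [_ E] := diff_comp1 (is_derive1_ln (P_gt0 x)) (smooth_differentiable x smooth_P).
have -> : 'd (fun x => ln (P x)) x u = (P x)^-1 * 'd P x u := E u.
have -> : 'd P x u = 'd (fun x => cx x * cx x * kap (cy x)) x u.
  exact: diff_caddE (smoothM smooth_xx smooth_kap).
have -> : 'd (fun x => cx x * cx x * kap (cy x)) x u =
          cx x * cx x * 'd (fun x : pt => kap (cy x)) x u
          + kap (cy x) * 'd (fun x : pt => cx x * cx x : R) x u.
  exact: diff_mulE.
have -> : 'd (fun x : pt => cx x * cx x : R) x u = cx x * cx u + cx x * cx u.
  by rewrite -(diff_coordE mxI x u); exact: diff_mulE (@smooth_cx R) (@smooth_cx R).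
rewrite (diff_ycomp u (dkapE (cy x))).
by have := P_gt0 x; move: (P x) => p p0; field; rewrite gt_eqF.
Qed.

Let dx_phi x : dx phi x = cx x * kap (cy x) / P x.
Proof. by rewrite /dx diff_phi !row2E mulr0 addr0 mulr1 mulrC. Qed.

Let dy_phi x : dy phi x = 2^-1 * (cx x * cx x * dkap (cy x)) / P x.
Proof. by rewrite /dy diff_phi !row2E mulr0 add0r mulr1 mulrC. Qed.

Let exp_phi x : expR (phi x + phi x) = P x.
Proof.
have -> : phi x + phi x = ln (P x) by rewrite /phi; field.
by rewrite lnK// posrE.
Qed.

Let omegaE x u : [/\ omega_d phi x u = cx x * kap (cy x) / P x * cx u,
  omega_u zero phi phi x u = 2^-1 * (cx x * cx x * dkap (cy x)) / P x * cx u
                             + cx x * kap (cy x) * cy u &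
  omega_l zero phi phi x u = 0].
Proof.
have z1 : dy zero x = 0 by exact: diff_cstE.
rewrite /omega_d /omega_u /omega_l z1 dx_phi dy_phi /zero; split=> //.
  rewrite !subr0 !addr0 subrr expR0 mulr1 exp_phi.
  by have := P_gt0 x; move: (P x) => p p0; field; rewrite gt_eqF.
by rewrite subrr !mul0r addr0.
Qed.

Local Notation seg := (seg zero phi phi).
Local Notation transp := (transp zero phi phi).

Let seg_vertical (x y0 y1 : R) :
  seg (row2 x y0) (row2 x y1) (mx2 1 (x * (Kap y1 - Kap y0)) 0 1).
Proof.
set Q := row2 x y0; set Q' := row2 x y1.
pose l (t : R) := y0 + t * (y1 - y0).
have -> : mx2 1 (x * (Kap y1 - Kap y0)) 0 1 =
          mx2 1 (x * (Kap (l 1) - Kap y0)) 0 1.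
  by have -> : l 1 = y1 by rewrite /l; ring.
apply: (@seg_mx _ zero phi phi _ _ (fun=> 1) (fun t => x * (Kap (l t) - Kap y0))
  (fun=> 0) (fun=> 1)).
  by rewrite /l mul0r addr0 subrr mulr0.
move=> t _; have [-> -> ->] := omegaE (line Q Q' t) (Q' - Q).
have -> : cx (Q' - Q) = 0 by rewrite /Q /Q' !mxE subrr.
have -> : cy (Q' - Q) = y1 - y0 by rewrite /Q /Q' !mxE.
have -> : cy (line Q Q' t) = l t by rewrite /Q /Q' !mxE.
have -> : cx (line Q Q' t) = x by rewrite /Q /Q' !mxE subrr mulr0 addr0.
have dl : is_derive t 1 l (y1 - y0).
  have := is_deriveD (is_derive_cst y0 t 1)
    (is_derive_mul (is_derive_id t (1 : R)) (is_derive_cst (y1 - y0) t 1)).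
  by rewrite mul1r mulr0 addr0 add0r.
split.
- by apply: is_derive_eq (is_derive_cst _ t 1) _; ring.
- apply: is_derive_eq (is_derive_mul (is_derive_cst x t 1)
    (is_deriveB (is_derive1_comp (dKapE (l t)) dl) (is_derive_cst (Kap y0) t 1))) _.
  by rewrite /cst; ring.
- by apply: is_derive_eq (is_derive_cst _ t 1) _; ring.
- by apply: is_derive_eq (is_derive_cst _ t 1) _; ring.
Qed.

Let seg_edge (x0 x1 h : R) : kap h = 0 -> dkap h = 0 ->
  seg (row2 x0 h) (row2 x1 h) 1%:M.
Proof.
move=> k0 dk0; apply: seg_trivial => t.
have [-> -> ->] := omegaE (line (row2 x0 h) (row2 x1 h) t) (row2 x1 h - row2 x0 h).
have -> : cy (row2 x1 h - row2 x0 h) = 0 by rewrite !mxE subrr.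
rewrite line_horizontal k0 dk0.
by rewrite !(mulr0, mul0r, addr0).
Qed.

Let seg_middle (x0 x1 : R) :
  let l := phi (row2 x1 2^-1) - phi (row2 x0 2^-1) in
  seg (row2 x0 2^-1) (row2 x1 2^-1) (mx2 (expR l) 0 0 (expR (- l))).
Proof.
move=> l; set Q := row2 x0 2^-1; set Q' := row2 x1 2^-1.
have -> : mx2 (expR l) 0 0 (expR (- l)) =
   mx2 (expR (phi (line Q Q' 1) - phi Q)) 0 0 (expR (- (phi (line Q Q' 1) - phi Q))).
  by rewrite line1.
apply: (@seg_mx _ zero phi phi _ _ (fun t => expR (phi (line Q Q' t) - phi Q))
  (fun=> 0) (fun=> 0) (fun t => expR (- (phi (line Q Q' t) - phi Q)))).
  by rewrite line0 subrr oppr0 expR0.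
move=> t _; have [e1 e2 ->] := omegaE (line Q Q' t) (Q' - Q).
have yE : cy (Q' - Q) = 0 by rewrite /Q /Q' !mxE subrr.
have lE : cy (line Q Q' t) = 2^-1 by rewrite /Q /Q' line_horizontal.
have dk : dkap 2^-1 = 0 by rewrite /dkap; field.
rewrite e2 yE lE dk.
have dl : is_derive t 1 (fun t => phi (line Q Q' t) - phi Q)
    (omega_d phi (line Q Q' t) (Q' - Q)).
  apply: is_derive_eq (is_deriveB (is_derive_dder (is_derive_line Q Q' t)
    (smooth_differentiable (line Q Q' t) smooth_phi)) (is_derive_cst (phi Q) t 1)) _.
  by rewrite subr0 /dder /omega_d yE mul0r addr0 mulrC.
split.
- apply: is_derive_eq (is_derive_expR_comp dl) _; rewrite /=.
  by move: (expR _) (omega_d _ _ _) => *; ring.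
- by apply: is_derive_eq (is_derive_cst _ t 1) _; move: (omega_d _ _ _) => *; ring.
- by apply: is_derive_eq (is_derive_cst _ t 1) _; move: (omega_d _ _ _) => *; ring.
- apply: is_derive_eq (is_derive_expR_comp (is_deriveN dl)) _; rewrite /=.
  by move: (expR _) (omega_d _ _ _) => *; ring.
Qed.

Let O : pt := row2 0 0.

Let edge0 (x0 x1 : R) : transp (row2 x0 0) (row2 x1 0) 1%:M.
Proof. by apply/transp_seg/seg_edge; rewrite ?/kap ?/dkap; ring. Qed.

Let edge1 (x0 x1 : R) : transp (row2 x0 1) (row2 x1 1) 1%:M.
Proof. by apply/transp_seg/seg_edge; rewrite ?/kap ?/dkap; ring. Qed.

Let axis (y0 y1 : R) : transp (row2 0 y0) (row2 0 y1) 1%:M.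
Proof.
have := transp_seg (seg_vertical 0 y0 y1).
by rewrite mul0r mx2_1.
Qed.

Let vertical (x y0 y1 : R) := transp_seg (seg_vertical x y0 y1).

(** The rectangle with sides x = 0, x = 30 u, y = 0, y = 1; the integral of kap
    over [0, 1] is 1/30. *)
Let unipotents u : transp O O (mx2 1 u 0 1).
Proof.
have h1 := transp_comp (edge0 0 (30 * u)) (vertical (30 * u) 0 1).
have h2 := transp_comp h1 (transp_comp (edge1 (30 * u) 0) (axis 1 0)).
move: h2; rewrite !mul1mx !mulmx1.
by have -> : 30 * u * (Kap 1 - Kap 0) = u by rewrite /Kap; field.
Qed.

Let cancel_right T v : transp O O (T *m mx2 1 v 0 1) -> transp O O T.
Proof.
move=> h; have := transp_comp (unipotents (- v)) h.
rewrite -mulmxA mulmx2 (_ : mx2 _ _ _ _ = 1%:M) ?mulmx1//.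
by rewrite mx2_1; apply: mx2P; rewrite !mx2E; ring.
Qed.

Let cancel_left T v : transp O O (mx2 1 v 0 1 *m T) -> transp O O T.
Proof.
move=> h; have := transp_comp h (unipotents (- v)).
rewrite mulmxA mulmx2 (_ : mx2 _ _ _ _ = 1%:M) ?mul1mx//.
by rewrite mx2_1; apply: mx2P; rewrite !mx2E; ring.
Qed.

(** The rectangle between y = 0 and y = 1/2, up to a unipotent coming from its
    vertical side. As kap(1/2) = 1/16, the diagonal entry is the square root of
    1 + (x / 4)^2, which takes all values from 1 on. *)
Let diagonal l : 0 < l -> transp O O (mx2 l 0 0 l^-1).
Proof.
have key x : let m := expR (phi (row2 x 2^-1)) in
    transp O O (mx2 m 0 0 m^-1) /\ transp O O (mx2 m^-1 0 0 m).
  move=> m; have p0 : phi (row2 0 2^-1) = 0.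
    by rewrite /phi /P row2E !mul0r addr0 ln1 mulr0.
  split.
    have h1 := transp_comp (axis 0 2^-1) (transp_seg (seg_middle 0 x)).
    have := transp_comp h1 (transp_comp (vertical x 2^-1 0) (edge0 x 0)).
    by rewrite p0 subr0 expRN mul1mx mulmx1 => /cancel_left.
  have h1 := transp_comp (edge0 0 x) (vertical x 0 2^-1).
  have := transp_comp h1 (transp_comp (transp_seg (seg_middle x 0)) (axis 2^-1 0)).
  by rewrite p0 sub0r opprK expRN mul1mx mulmx1 => /cancel_right.
have mE x : expR (phi (row2 x 2^-1)) = Num.sqrt (1 + (x / 4) ^+ 2).
  have e0 := expR_ge0 (phi (row2 x 2^-1)).
  rewrite -[LHS]ger0_norm// -sqrtr_sqr; congr Num.sqrt.
  rewrite expr2 -expRD exp_phi /P !row2E /kap.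
  by field.
have key1 m : 1 <= m -> transp O O (mx2 m 0 0 m^-1) /\ transp O O (mx2 m^-1 0 0 m).
  move=> m1; have := key (4 * Num.sqrt (m ^+ 2 - 1)).
  rewrite mE (mulrC 4) mulfK// sqr_sqrtr.
    by rewrite addrC subrK sqrtr_sqr ger0_norm// (le_trans ler01).
  by rewrite subr_ge0 exprn_ege1.
move=> l0; have [l1|/ltW l1] := leP 1 l; first exact: (key1 _ l1).1.
have := (key1 l^-1 _).2; rewrite invrK; apply.
by rewrite invf_ge1.
Qed.

(** The base point p is joined to the origin by a broken line with unipotent
    transport, which is a conjugation inside the group. *)
Lemma borel_realizable : realizable (@borel_group R).
Proof.
apply: (realize smooth_zero smooth_phi smooth_phi) => p T.
  by apply: (borel_upper smooth_zero smooth_phi smooth_phi) => x u; have [] := omegaE x u.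
have base l m : 0 < l -> transp O O (mx2 l m 0 l^-1).
  move=> l0; have := transp_comp (diagonal l0) (unipotents (m * l)).
  have -> // : mx2 1 (m * l) 0 1 *m mx2 l 0 0 l^-1 = mx2 l m 0 l^-1.
  by rewrite mulmx2; apply: mx2P; rewrite !mx2E; field; rewrite ?gt_eqF.
move=> [l [m [-> l0]]]; pose c := cx p * (Kap 0 - Kap (cy p)).
have h1 : transp p O (mx2 1 c 0 1).
  rewrite -[p]row2_coord -[mx2 _ _ _ _]mul1mx.
  exact: transp_comp (vertical _ _ 0) (edge0 _ 0).
have h2 : transp O p (mx2 1 (- c) 0 1).
  rewrite -[p]row2_coord -[mx2 _ _ _ _]mulmx1.
  apply: transp_comp (edge0 0 _) _.
  by have -> : - c = cx p * (Kap (cy p) - Kap 0); [rewrite /c; ring|exact: vertical].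
have := transp_comp h1 (transp_comp (base l (m + c * l^-1 - l * c) l0) h2).
have -> // : mx2 1 (- c) 0 1 *m mx2 l (m + c * l^-1 - l * c) 0 l^-1
   *m mx2 1 c 0 1 = mx2 l m 0 l^-1.
by rewrite !mulmx2; apply: mx2P; rewrite !mx2E; ring.
Qed.

End Borel.

(** * Connected Lie subgroups *)

Section LieSubgroup.
Context (R : realType) (d : nat) (H : manifold R d) (S : lie_group H).
Variable (iota : H -> 'M[R]_2).

(** The part of being a connected Lie subgroup of SL_2 that is stable under
    conjugation in GL_2 and easy to use: one derivative is enough. *)
Definition lie_subgroup_data : Prop :=
  [/\ connected [set: H],
      forall x y, iota (lmul S x y) = iota x *m iota y,
      injective iota,
      forall (i : chart_index H) x, chart_image i x ->
        differentiable (iota \o chart_inv i) x /\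
        injective ('d (iota \o chart_inv i) x) &
      forall x, \det (iota x) = 1].

Hypothesis data : lie_subgroup_data.
Let e : H := lone S.

Lemma ld_connected : connected [set: H]. Proof. by case: data. Qed.
Lemma ld_mul x y : iota (lmul S x y) = iota x *m iota y.
Proof. by case: data. Qed.
Lemma ld_inj : injective iota. Proof. by case: data. Qed.
Lemma ld_diff (i : chart_index H) x : chart_image i x ->
  differentiable (iota \o chart_inv i) x.
Proof. by case: data => _ _ _ h _ /h[]. Qed.
Lemma ld_dinj (i : chart_index H) x : chart_image i x ->
  injective ('d (iota \o chart_inv i) x).
Proof. by case: data => _ _ _ h _ /h[]. Qed.
Lemma ld_det x : \det (iota x) = 1. Proof. by case: data. Qed.

Lemma ld_unit x : iota x \in unitmx.
Proof. by rewrite unitmxE ld_det unitr1. Qed.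

Lemma ld_one : iota e = 1%:M.
Proof.
have : iota e *m iota e = iota e by rewrite -ld_mul lmul1.
by move=> /(congr1 (mulmx (invmx (iota e)))); rewrite mulKmx ?mulVmx ?ld_unit.
Qed.

Lemma ld_invl x : iota (linv S x) *m iota x = 1%:M.
Proof. by rewrite -ld_mul lmulV ld_one. Qed.

Lemma ld_inv x : iota (linv S x) = invmx (iota x).
Proof.
have /(congr1 (mulmx^~ (invmx (iota x)))) := ld_invl x.
by rewrite /= mulmxK ?ld_unit// mul1mx.
Qed.

Lemma chart_invK (i : chart_index H) x : chart_image i x ->
  chart i (chart_inv i x) = x.
Proof. by move=> [p ip <-]; rewrite chartK. Qed.

Lemma chart_inv_dom (i : chart_index H) x : chart_image i x ->
  chart_dom i (chart_inv i x).
Proof. by move=> [p ip <-]; rewrite chartK. Qed.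

Lemma chart_image_dom (i : chart_index H) (p : H) : chart_dom i p ->
  chart_image i (chart i p).
Proof. by move=> ip; exists p. Qed.

Lemma chart_dom_nbhs (i : chart_index H) (p : H) : chart_dom i p ->
  nbhs p (chart_dom i).
Proof. by move=> ip; apply: open_nbhs_nbhs; split=> //; exact: chart_dom_open. Qed.

Lemma chart_image_nbhs (i : chart_index H) x : chart_image i x ->
  nbhs x (chart_image i).
Proof.
by move=> ix; apply: open_nbhs_nbhs; split=> //; exact: chart_image_open.
Qed.

Lemma chart_cts (i : chart_index H) (p : H) : chart_dom i p ->
  {for p, continuous (chart i)}.
Proof.
move=> ip; have := chart_continuous (i := i).
rewrite continuous_open_subspace; last exact: chart_dom_open.
by apply; exact/mem_set.
Qed.

Lemma chart_inv_cts (i : chart_index H) x : chart_image i x ->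
  {for x, continuous (chart_inv i)}.
Proof.
move=> ix; have := chart_inv_continuous (i := i).
rewrite continuous_open_subspace; last exact: chart_image_open.
by apply; exact/mem_set.
Qed.

Lemma ld_continuous : continuous iota.
Proof.
move=> p; have [i ip] := chart_dom_cover p.
have h : (iota \o chart_inv i) \o chart i @ p --> iota p.
  have c : {for p, continuous ((iota \o chart_inv i) \o chart i)}.
    apply: continuous_comp; first exact: chart_cts.
    by apply/differentiable_continuous/ld_diff/chart_image_dom.
  by move: c; rewrite /prop_for /continuous_at /= chartK.
apply: cvg_trans h; apply: near_eq_cvg.
by near=> q; rewrite /= chartK//; near: q; exact: chart_dom_nbhs.
Unshelve. all: by end_near. Qed.

Lemma entry_continuous i j : continuous (fun x : H => iota x i j : R).
Proof.
move=> x; apply: (@continuous_comp _ _ _ iota (fun M : 'M[R]_2 => M i j)).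
  exact: ld_continuous.
exact: coord_continuous.
Qed.

(** Differentiate iota \o F = L \o iota in charts. *)
Lemma tangent_push (F : H -> H) (L : {linear 'M[R]_2 -> 'M[R]_2}) p i j v :
  continuous L -> (forall x, iota (F x) = L (iota x)) ->
  {for p, continuous F} -> chart_dom i p -> chart_dom j (F p) ->
  differentiable (fun x => chart j (F (chart_inv i x))) (chart i p) ->
  exists w, L ('d (iota \o chart_inv i) (chart i p) v) =
            'd (iota \o chart_inv j) (chart j (F p)) w.
Proof.
move=> cL FL cF ip jF dT; set T := fun x => _ in dT; set x0 := chart i p in dT *.
have ix := chart_image_dom ip.
have df := ld_diff ix; have Lf : differentiable (L \o (iota \o chart_inv i)) x0.
  by apply: differentiable_comp => //; exact: linear_differentiable.
have T0 : T x0 = chart j (F p) by rewrite /T /x0 chartK.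
have dg : differentiable (iota \o chart_inv j) (T x0).
  by rewrite T0; exact/ld_diff/chart_image_dom.
have dgT := differentiable_comp dT dg.
exists ('d T x0 v).
have E1 : 'd (L \o (iota \o chart_inv i)) x0 v =
          L ('d (iota \o chart_inv i) x0 v).
  have /(congr1 (fun h => h v)) E := diff_comp df
    (linear_differentiable (iota (chart_inv i x0)) cL).
  have /(congr1 (fun h => h ('d (iota \o chart_inv i) x0 v))) E' :=
    diff_lin (iota (chart_inv i x0)) cL.
  exact: etrans E E'.
have E2 : 'd ((iota \o chart_inv j) \o T) x0 v =
          'd (iota \o chart_inv j) (chart j (F p)) ('d T x0 v).
  have /(congr1 (fun h => h v)) E := diff_comp dT dg.
  by apply: etrans E _; rewrite /= T0.
apply: etrans (esym E1) (etrans _ E2).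
apply: etrans (esym (deriveE v Lf)) (etrans _ (deriveE v dgT)).
apply: near_eq_derive.
have : \forall y \near x0, chart_image i y /\ chart_dom j (F (chart_inv i y)).
  apply: filterI; first exact: chart_image_nbhs.
  have c1 : F \o chart_inv i @ x0 --> F p.
    have c : {for x0, continuous (F \o chart_inv i)}.
      apply: continuous_comp; first exact: chart_inv_cts.
      by rewrite /x0 chartK.
    by move: c; rewrite /prop_for /continuous_at /= /x0 chartK.
  by apply: (c1 _); exact: chart_dom_nbhs.
by apply: filterS => y [iy jy]; rewrite /= /T -FL chartK.
Qed.

Lemma lmul_cts (x y : H) : {for (x, y), continuous (fun z : H * H => lmul S z.1 z.2)}.
Proof. by have [c _] := lmul_smooth S; exact: c. Qed.

Lemma mulmxl_continuous (A : 'M[R]_2) : continuous (mulmx A : 'M[R]_2 -> 'M[R]_2).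
Proof.
move=> M; apply: (continuous_mx (F := nbhs M)) => i j; rewrite mxE.
under eq_fun do rewrite mxE.
rewrite !big_ord_recl big_ord0; under eq_fun do rewrite !big_ord_recl big_ord0.
by apply: cvgD; [|apply: cvgD; [|exact: cvg_cst]];
   (apply: cvgM; [exact: cvg_cst|exact: coord_continuous]).
Qed.

Lemma mulmxr_continuous (A : 'M[R]_2) : continuous (mulmxr A : 'M[R]_2 -> 'M[R]_2).
Proof.
move=> M; apply: (continuous_mx (F := nbhs M)) => i j; rewrite /= mxE.
under eq_fun do rewrite /= mxE.
rewrite !big_ord_recl big_ord0; under eq_fun do rewrite !big_ord_recl big_ord0.
by apply: cvgD; [|apply: cvgD; [|exact: cvg_cst]];
   (apply: cvgM; [exact: coord_continuous|exact: cvg_cst]).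
Qed.

(** Translations of the group are restrictions of linear maps of matrices. The
    product is a variable q so that the base points can be simplified in advance. *)
Lemma left_push (g p q : H) i j v : lmul S g p = q ->
  chart_dom i p -> chart_dom j q ->
  exists w, iota g *m 'd (iota \o chart_inv i) (chart i p) v =
            'd (iota \o chart_inv j) (chart j q) w.
Proof.
move=> <- ip jgp; apply: (tangent_push (F := lmul S g) (L := mulmx (iota g))) => //.
- exact: mulmxl_continuous.
- by move=> x; rewrite ld_mul.
- apply: (@continuous_comp _ _ _ (fun y => (g, y)) (fun z : H * H => lmul S z.1 z.2)).
    by apply: cvg_pair; [exact: cvg_cst|exact: cvg_id].
  exact: lmul_cts.
have [k kg] := chart_dom_cover g.
have [_ /(_ k i j) /(_ 1%N) [D _]] := lmul_smooth S.
have Dz := D (chart k g, chart i p); rewrite /= !chartK// in Dz.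
have {}Dz := Dz (And3 (chart_image_dom kg) (chart_image_dom ip) jgp).
have dp : differentiable (fun x : 'rV[R]_d => (chart k g, x)) (chart i p).
  by apply: differentiable_pair; [exact: differentiable_cst|].
have := differentiable_comp dp Dz.
by rewrite /comp/= chartK.
Qed.

Lemma right_push (g p q : H) i j v : lmul S p g = q ->
  chart_dom i p -> chart_dom j q ->
  exists w, 'd (iota \o chart_inv i) (chart i p) v *m iota g =
            'd (iota \o chart_inv j) (chart j q) w.
Proof.
move=> <- ip jpg.
apply: (tangent_push (F := fun x => lmul S x g) (L := mulmxr (iota g))) => //.
- exact: mulmxr_continuous.
- by move=> x; rewrite ld_mul.
- apply: (@continuous_comp _ _ _ (fun y => (y, g)) (fun z : H * H => lmul S z.1 z.2)).
    by apply: cvg_pair; [exact: cvg_id|exact: cvg_cst].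
  exact: lmul_cts.
have [k kg] := chart_dom_cover g.
have [_ /(_ i k j) /(_ 1%N) [D _]] := lmul_smooth S.
have Dz := D (chart i p, chart k g); rewrite /= !chartK// in Dz.
have {}Dz := Dz (And3 (chart_image_dom ip) (chart_image_dom kg) jpg).
have dp : differentiable (fun x : 'rV[R]_d => (x, chart k g)) (chart i p).
  by apply: differentiable_pair; [|exact: differentiable_cst].
have := differentiable_comp dp Dz.
by rewrite /comp/= chartK.
Qed.

Lemma lmulr1 (x : H) : lmul S x e = x.
Proof. by apply: ld_inj; rewrite ld_mul ld_one mulmx1. Qed.

Lemma lmulrV (x : H) : lmul S x (linv S x) = e.
Proof. by apply: ld_inj; rewrite ld_mul ld_inv ld_one mulmxV// ld_unit. Qed.

(** The translates of an open subgroup are open, so it is also closed. *)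
Lemma open_subgroup (P : H -> Prop) : (forall x y, P x -> P y -> P (lmul S x y)) ->
  (forall x, P x -> P (linv S x)) -> (\forall x \near e, P x) -> forall x, P x.
Proof.
move=> PM PV Pe.
have tr (x : H) : \forall y \near x, P (lmul S (linv S x) y).
  have c : lmul S (linv S x) y @[y --> x] --> e.
    rewrite -[X in _ --> X](lmulV S x).
    apply: (@continuous_comp _ _ _ (fun y => (linv S x, y))
      (fun z : H * H => lmul S z.1 z.2)).
      by apply: cvg_pair; [exact: cvg_cst|exact: cvg_id].
    exact: lmul_cts.
  exact: c Pe.
have Pe0 : P e by exact: nbhs_singleton Pe.
have shift x y : P x -> P (lmul S (linv S x) y) -> P y.
  by move=> Px Pxy; have := PM _ _ Px Pxy; rewrite lmulA lmulrV lmul1.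
have oP : open [set x | P x].
  by rewrite openE => x Px; apply: filterS (tr x) => y; exact: shift.
have cP : closed [set x | P x].
  rewrite -openC openE => x nPx; apply: filterS (tr x) => y Pxy Py; apply: nPx.
  have := PM _ _ Py (PV _ Pxy).
  suff -> : lmul S y (linv S (lmul S (linv S x) y)) = x by [].
  set z := lmul S (linv S x) y.
  have yE : iota y = iota x *m iota z.
    by rewrite /z ld_mul ld_inv mulmxA mulmxV ?ld_unit// mul1mx.
  by apply: ld_inj; rewrite ld_mul ld_inv yE mulmxK// ld_unit.
suff PT : P = [set: H] by move=> x; rewrite PT.
apply: ld_connected; first by exists e.
- by exists P; rewrite ?setTI.
- by exists P; rewrite ?setTI.
Qed.

End LieSubgroup.

(** * The Lie algebra *)

Section LieAlgebra.
Context (R : realType) (d : nat) (H : manifold R d) (S : lie_group H).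
Variable (iota : H -> 'M[R]_2).
Hypothesis data : lie_subgroup_data S iota.
Let e : H := lone S.

Lemma connected_ivt (u : H -> R) x y c : continuous u -> u x <= c <= u y ->
  exists z, u z = c.
Proof.
move=> cu xcy; have : connected (u @` [set: H]).
  apply: connected_continuous_connected; first exact: ld_connected data.
  exact: continuous_subspaceT.
move=> /connected_intervalP /(_ (u x) (u y)) h.
have [||z _ <-] := h _ _ c xcy; [by exists x|by exists y|by exists z].
Qed.

Lemma connected_gt0 (u : H -> R) x0 : continuous u -> (forall x, u x != 0) ->
  0 < u x0 -> forall x, 0 < u x.
Proof.
move=> cu u0 ux0 x; rewrite ltNge; apply/negP => ux.
have [|z /eqP] := @connected_ivt u x x0 0 cu; first by rewrite ux ltW.
exact/negP/u0.
Qed.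

Lemma chart_curve (i : chart_index H) (x v : 'rV[R]_d) (t : R) :
  chart_image i (x + t *: v) ->
  is_derive t 1 (fun s => (iota \o chart_inv i) (x + s *: v))
    ('d (iota \o chart_inv i) (x + t *: v) v).
Proof.
move=> ix; apply: (is_derive_comp_curve (g := fun s => x + s *: v)).
  exact: is_derive_ray.
exact: ld_diff data _ _ ix.
Qed.

(** The derivative of the constant determinant, by the product rule. *)
Lemma det_deriv (i : chart_index H) (x v : 'rV[R]_d) : chart_image i x ->
  let M := (iota \o chart_inv i) x in let N := 'd (iota \o chart_inv i) x v in
  M mxI mxI * N mxII mxII + M mxII mxII * N mxI mxI =
  M mxI mxII * N mxII mxI + M mxII mxI * N mxI mxII.
Proof.
move=> ix M N; pose g s := (iota \o chart_inv i) (x + s *: v).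
have ix0 : chart_image i (x + 0 *: v) by rewrite scale0r addr0.
have := chart_curve ix0; rewrite scale0r addr0 -/N => /is_derive_mx dg.
have g0 : g 0 = M by rewrite /g scale0r addr0.
pose h s := g s mxI mxI * g s mxII mxII - g s mxI mxII * g s mxII mxI.
have [_ D] : is_derive (0 : R) 1 h _ := is_deriveB
  (is_derive_mul (dg mxI mxI) (dg mxII mxII))
  (is_derive_mul (dg mxI mxII) (dg mxII mxI)).
have [_ E] : is_derive (0 : R) 1 h 0.
  rewrite (_ : h = cst 1); first exact: is_derive_cst.
  apply/funext => s; have := ld_det data (chart_inv i (x + s *: v)).
  by rewrite (mx2_eta (iota _)) det_mx2.
have := etrans (esym D) E; rewrite -/(g 0) g0 => K.
by apply/eqP; rewrite -subr_eq0 -[X in _ == X]K; apply/eqP; ring.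
Qed.

Variable i0 : chart_index H.
Hypothesis ie : chart_dom i0 e.

Definition lie_alg (v : 'rV[R]_d) : 'M[R]_2 :=
  'd (iota \o chart_inv i0) (chart i0 e) v.

Lemma lie_alg_inj : injective lie_alg.
Proof. exact: ld_dinj data _ _ (chart_image_dom ie). Qed.

Lemma lie_alg_linear : linear lie_alg.
Proof. by move=> k u v; rewrite /lie_alg linearP. Qed.

Lemma lie_alg_trace v : lie_alg v mxII mxII = - lie_alg v mxI mxI.
Proof.
have := det_deriv v (chart_image_dom ie); rewrite /= chartK// (ld_one data).
rewrite mx2_1 !mx2E !mul1r !mul0r addr0 -/(lie_alg v) => /eqP.
by rewrite addr_eq0 => /eqP.
Qed.

(** Left-invariant vector fields trivialize the tangent spaces. *)
Lemma tangent_left p i v : chart_dom i p -> exists w,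
  'd (iota \o chart_inv i) (chart i p) v = iota p *m lie_alg w.
Proof.
move=> ip; have [w E] := left_push data v (lmulV S p) ip ie; exists w.
have /(congr1 (mulmx (iota p))) := E; rewrite (ld_inv data) => <-.
by rewrite mulKVmx// (ld_unit data).
Qed.

(** The adjoint action is left translation by g followed by right translation by
    its inverse. *)
Lemma ad_stable g v : exists w,
  iota g *m lie_alg v *m invmx (iota g) = lie_alg w.
Proof.
have [j jg] := chart_dom_cover g.
have [w1 E1] := left_push data v (lmulr1 data g) ie jg.
have [w2 E2] := right_push data w1 (lmulrV data g) jg ie.
exists w2; rewrite -(ld_inv data).
have /(congr1 (mulmx^~ (iota (linv S g)))) E1' := E1.
exact: etrans E1' E2.
Qed.

(** The derivative at the identity of the constant function L \o iota. *)
Lemma lie_alg_relation (W : normedModType R) (L : {linear 'M[R]_2 -> W}) c :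
  continuous L -> (forall x, L (iota x) = c) -> forall v, L (lie_alg v) = 0.
Proof.
move=> cL Lc v; have [_ E] := diff_linear_comp cL (ld_diff data (chart_image_dom ie)).
have E0 : 'd (L \o (iota \o chart_inv i0)) (chart i0 e) v = 0.
  by rewrite (_ : L \o _ = cst c) ?diff_cst//; apply/funext => x; exact: Lc.
exact: etrans (esym (E v)) E0.
Qed.

Lemma lie_alg_commute Z : (forall x, iota x *m Z = Z *m iota x) ->
  forall v, lie_alg v *m Z = Z *m lie_alg v.
Proof.
move=> Zc v.
have l : linear (fun M : 'M[R]_2 => M *m Z - Z *m M).
  by move=> k M N; rewrite mulmxDl mulmxDr -scalemxAl -scalemxAr scalerBr opprD addrACA.
pose L : {linear 'M[R]_2 -> 'M[R]_2} := HB.pack (fun M : 'M[R]_2 => M *m Z - Z *m M)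
  (GRing.isLinear.Build _ _ _ _ _ l).
have cL : continuous L.
  move=> M; apply: (@cvgB _ _ _ (nbhs M) _ (mulmxr Z) (mulmx Z)).
    exact: (@mulmxr_continuous R Z M).
  exact: (@mulmxl_continuous R Z M).
apply/eqP; rewrite -subr_eq0; apply/eqP.
apply: (lie_alg_relation (L := L) (c := 0) cL) => x.
by rewrite /= Zc subrr.
Qed.

End LieAlgebra.

(** * Normal forms and conjugation *)

Section NormalForm.
Context (R : realType).
Implicit Types (A X Y : 'M[R]_2).

(** The normal forms of traceless matrices up to scaling: nilpotent, elliptic and
    hyperbolic for d = 0, 1, -1. *)
Definition companion (d : R) : 'M[R]_2 := mx2 0 (- d) 1 0.

(** Not a multiple of the identity, in the terms of [commute2P]. *)
Definition nonscalar A : Prop :=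
  A mxI mxII != 0 \/ A mxII mxI != 0 \/ A mxI mxI - A mxII mxII != 0.

(** Two matrices commute if and only if the vectors made of their off-diagonal
    entries and of the difference of their diagonal entries are proportional. *)
Lemma commute2P A X : A *m X = X *m A <->
  [/\ A mxI mxII * X mxII mxI = A mxII mxI * X mxI mxII,
      A mxI mxII * (X mxI mxI - X mxII mxII) =
        (A mxI mxI - A mxII mxII) * X mxI mxII &
      A mxII mxI * (X mxI mxI - X mxII mxII) =
        (A mxI mxI - A mxII mxII) * X mxII mxI].
Proof.
have E1 := mx2_eta A; have E2 := mx2_eta X.
move: (A mxI mxI) (A mxI mxII) (A mxII mxI) (A mxII mxII) E1 => a b c d ->.
move: (X mxI mxI) (X mxI mxII) (X mxII mxI) (X mxII mxII) E2 => x y z w ->.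
rewrite !mulmx2; split.
  move=> E; have := congr1 (fun M : 'M[R]_2 => M mxII mxII) E.
  have := congr1 (fun M : 'M[R]_2 => M mxII mxI) E.
  have := congr1 (fun M : 'M[R]_2 => M mxI mxII) E.
  rewrite !mx2E => h1 h2 h3; split.
  - by apply: (addrI (d * w)); rewrite addrC [in RHS]addrC mulrC in h3 *; lra.
  - by lra.
  - by lra.
by move=> [h1 h2 h3]; apply: mx2P; rewrite !mx2E; lra.
Qed.

(** Vectors proportional to the same nonzero vector are proportional. *)
Lemma commutant_commutative A X Y : nonscalar A -> A *m X = X *m A ->
  A *m Y = Y *m A -> X *m Y = Y *m X.
Proof.
rewrite /nonscalar => + /commute2P + /commute2P + ; rewrite commute2P.
move: (A mxI mxII) (A mxII mxI) (A mxI mxI - A mxII mxII) => u1 u2 u3.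
move: (X mxI mxII) (X mxII mxI) (X mxI mxI - X mxII mxII) => x1 x2 x3.
move: (Y mxI mxII) (Y mxII mxI) (Y mxI mxI - Y mxII mxII) => y1 y2 y3.
have key v1 v2 v3 p1 p2 p3 q1 q2 q3 : v1 != 0 :> R -> v1 * p2 = v2 * p1 ->
    v1 * p3 = v3 * p1 -> v1 * q2 = v2 * q1 -> v1 * q3 = v3 * q1 ->
    [/\ p1 * q2 = p2 * q1, p1 * q3 = p3 * q1 & p2 * q3 = p3 * q2].
  move=> v0 h2 h3 k2 k3.
  have -> : p2 = v2 * p1 / v1 by rewrite -h2 mulrC mulKf.
  have -> : p3 = v3 * p1 / v1 by rewrite -h3 mulrC mulKf.
  have -> : q2 = v2 * q1 / v1 by rewrite -k2 mulrC mulKf.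
  have -> : q3 = v3 * q1 / v1 by rewrite -k3 mulrC mulKf.
  by split; field.
move=> [u0|[u0|u0]] [h1 h2 h3] [k1 k2 k3].
- by have [] := key _ _ _ _ _ _ _ _ _ u0 h1 h2 k1 k2.
- by have [e1 e2 e3] := key _ _ _ _ _ _ _ _ _ u0 (esym h1) h3 (esym k1) k3.
- by have [e1 e2 e3] := key _ _ _ _ _ _ _ _ _ u0 (esym h2) (esym h3) (esym k2) (esym k3).
Qed.

(** By Cayley-Hamilton X^2 is the scalar - det X. A vector v that is not an
    eigenvector of X gives the basis (v, X v / k), in which X is k times the
    companion matrix of d, where k^2 d = det X. *)
Lemma traceless_normal_form X : X mxII mxII = - X mxI mxI -> X != 0 ->
  exists Q k d, [/\ Q \in unitmx, k != 0, d = 0 \/ d = 1 \/ d = -1 &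
    Q *m X *m invmx Q = k *: companion d].
Proof.
rewrite {3 4}(mx2_eta X) => tX; rewrite tX.
move: (X mxI mxI) (X mxI mxII) (X mxII mxI) => x y z {tX} X0.
pose D := - (x * x + y * z).
have [k [d [k0 d3 kd]]] : exists k d : R, [/\ k != 0, d = 0 \/ d = 1 \/ d = -1 & k * k * d = D].
  have [D0|D0|D0] := ltrgtP D 0.
  - exists (Num.sqrt (- D)), (-1); split; [|by right; right|].
      by rewrite gt_eqF// sqrtr_gt0 oppr_gt0.
    by rewrite -expr2 sqr_sqrtr ?oppr_ge0 ?ltW// mulrN1 opprK.
  - exists (Num.sqrt D), 1; split; [|by right; left|].
      by rewrite gt_eqF// sqrtr_gt0.
    by rewrite -expr2 sqr_sqrtr ?mulr1// ltW.
  - by exists 1, 0; split; [exact: oner_neq0|left|rewrite mulr0 D0].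
have [v1 [v2 v0]] : exists v1 v2 : R,
    v1 * (z * v1 - x * v2) - v2 * (x * v1 + y * v2) != 0.
  have [z0|z0] := eqVneq z 0; last first.
    by exists 1, 0; rewrite !(mulr0, mul0r, mulr1, mul1r, subr0).
  have [y0|y0] := eqVneq y 0; last first.
    by exists 0, 1; rewrite !(mulr0, mul0r, mulr1, mul1r, sub0r, add0r) oppr_eq0.
  exists 1, 1; rewrite z0 y0; apply: contra_neq X0 => x0.
  have -> : x = 0 by move: x0; rewrite !(mul0r, mul1r, mulr1, addr0, sub0r); lra.
  by rewrite z0 y0; apply: mx2P; rewrite !mx2E ?mxE ?oppr0.
pose P := mx2 v1 ((x * v1 + y * v2) / k) v2 ((z * v1 - x * v2) / k).
have uP : P \in unitmx.
  rewrite unitmxE det_mx2 unitfE (_ : _ - _ = (v1 * (z * v1 - x * v2) -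
    v2 * (x * v1 + y * v2)) / k); last by field.
  by rewrite mulf_neq0// invr_eq0.
exists (invmx P), k, d; split=> //; first by rewrite unitmx_inv.
have XP : mx2 x y z (- x) *m P = P *m (k *: companion d).
  have -> : k *: companion d = mx2 0 (- (k * d)) k 0.
    by apply: mx2P; rewrite !mxE/= ?mulr0 ?mulr1 ?mulrN.
  have dE : d = D / (k * k) by rewrite -kd; field.
  by rewrite !mulmx2 dE /D; apply: mx2P; rewrite !mx2E; field.
by rewrite invmxK -mulmxA XP mulKmx.
Qed.

End NormalForm.

Section Conjugation.
Context (R : realType) (d : nat) (H : manifold R d) (S : lie_group H).
Variable (iota : H -> 'M[R]_2).
Hypothesis data : lie_subgroup_data S iota.
Variable Q : 'M[R]_2.
Hypothesis uQ : Q \in unitmx.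

Definition conj_mx (M : 'M[R]_2) : 'M[R]_2 := Q *m M *m invmx Q.

Lemma conj_mx_linear : linear conj_mx.
Proof.
by move=> k M N; rewrite /conj_mx mulmxDr mulmxDl -scalemxAr -scalemxAl.
Qed.

Lemma conj_mx_continuous : continuous conj_mx.
Proof.
move=> M; apply: (@continuous_comp _ _ _ (mulmx Q) (mulmxr (invmx Q))).
  exact: mulmxl_continuous.
exact: mulmxr_continuous.
Qed.

Lemma conj_mxM M N : conj_mx (M *m N) = conj_mx M *m conj_mx N.
Proof. by rewrite /conj_mx -!mulmxA mulKmx. Qed.

Lemma conj_mx_inj : injective conj_mx.
Proof.
move=> M N /(congr1 (mulmx (invmx Q))) /(congr1 (mulmx^~ Q)).
by rewrite /conj_mx /= -!mulmxA !mulKmx// mulVmx// !mulmx1.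
Qed.

Let L : {linear 'M[R]_2 -> 'M[R]_2} :=
  HB.pack conj_mx (GRing.isLinear.Build _ _ _ _ _ conj_mx_linear).

Lemma diff_conj (V : normedModType R) (f : V -> 'M[R]_2) x :
  differentiable f x -> differentiable (conj_mx \o f) x /\
  forall v, 'd (conj_mx \o f) x v = conj_mx ('d f x v).
Proof.
by move=> df; exact: (diff_linear_comp (conj_mx_continuous : continuous L) df).
Qed.

Lemma conj_data : lie_subgroup_data S (conj_mx \o iota).
Proof.
split.
- exact: ld_connected data.
- by move=> x y; rewrite [LHS]/= (ld_mul data x y) [LHS]conj_mxM.
- by move=> x y /conj_mx_inj /(ld_inj data).
- move=> i x ix; have [df E] := diff_conj (ld_diff data ix).
  split; first exact: df.
  move=> u v uv; apply: (ld_dinj data ix); apply: conj_mx_inj.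
  exact: etrans (esym (E u)) (etrans uv (E v)).
- move=> x; rewrite [LHS]/= /conj_mx !det_mulmx (ld_det data) mulr1 det_inv.
  by rewrite divrr// -unitmxE.
Qed.

Lemma lie_alg_conj i0 : chart_dom i0 (lone S) ->
  forall v, lie_alg S (conj_mx \o iota) i0 v = conj_mx (lie_alg S iota i0 v).
Proof.
move=> ie v; have [_ E] := diff_conj (ld_diff data (chart_image_dom ie)).
exact: E.
Qed.

End Conjugation.

(** * Subgroups of dimension at most one *)

Section DimensionZero.
Context (R : realType) (H : manifold R 0) (S : lie_group H).
Variable (iota : H -> 'M[R]_2).
Hypothesis data : lie_subgroup_data S iota.

(** A manifold of dimension 0 is discrete, so the identity alone is a
    neighbourhood of the identity. *)
Lemma dim0_range A : trivial_group A <-> exists x, iota x = A.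
Proof.
have T : forall x, iota x = 1%:M.
  apply: (open_subgroup data) => [x y|x|].
  - by move=> hx hy; rewrite (ld_mul data) hx hy mulmx1.
  - by move=> hx; rewrite (ld_inv data) hx invmx1.
  have [i ie] := chart_dom_cover (lone S).
  have : nbhs (lone S) (chart_dom i) by exact: chart_dom_nbhs.
  apply: filterS => q iq; have -> : q = lone S; last exact: ld_one data.
  by rewrite -(chartK iq) -(chartK ie); congr chart_inv; apply/rowP => -[].
split=> [->|[x <-]]; first by exists (lone S).
exact: T.
Qed.

End DimensionZero.

Section DimensionOne.
Context (R : realType) (H : manifold R 1) (S : lie_group H).
Variable (iota : H -> 'M[R]_2).
Hypothesis data : lie_subgroup_data S iota.
Variables (i0 : chart_index H) (k d : R).
Hypotheses (ie : chart_dom i0 (lone S)) (k0 : k != 0)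
  (hX : lie_alg S iota i0 (const_mx 1) = k *: companion d).

Lemma lie_alg_dim1 v : exists c, lie_alg S iota i0 v = c *: companion d.
Proof.
exists (v ord0 ord0 * k); rewrite -scalerA -hX.
have E : v = v ord0 ord0 *: const_mx 1.
  by apply/rowP => j; rewrite !mxE mulr1 (ord1 j).
by rewrite {1}E /lie_alg linearZ.
Qed.

Lemma mul_companionE (c : R) (M : 'M[R]_2) i :
  ((c *: (M *m companion d)) i mxI = c * M i mxII) *
  ((c *: (M *m companion d)) i mxII = - (c * d * M i mxI)).
Proof. by rewrite !mxE !big_ord_recl !big_ord0 !mxE/=; split; ring. Qed.

(** Here the companion matrix acts on the right, on the rows of g, so the dual
    of the form of [one_param_upper] is conserved. *)
Lemma dim1_conserved (g : R -> 'M[R]_2) :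
  (forall t : R, t \in `[0, 1] -> exists c, is_derive t 1 g (c *: (g t *m companion d))) ->
  forall i j, d * (g 1 i mxI * g 1 j mxI) + g 1 i mxII * g 1 j mxII =
              d * (g 0 i mxI * g 0 j mxI) + g 0 i mxII * g 0 j mxII.
Proof.
move=> dg i j.
apply: (constant_itv (f := fun t => d * (g t i mxI * g t j mxI)
                                    + g t i mxII * g t j mxII) (b := 1)).
- apply: derivable_within_continuous => t /dg[c /is_derive_mx D].
  have [] : is_derive t 1 (fun t => d * (g t i mxI * g t j mxI)
      + g t i mxII * g t j mxII) _ := is_deriveD
    (is_derive_mul (is_derive_cst d t 1) (is_derive_mul (D i mxI) (D j mxI)))
    (is_derive_mul (D i mxII) (D j mxII)).
  by [].
- move=> t; rewrite in_itv/= => /andP[t0 t1].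
  have [|c /is_derive_mx D] := dg t; first by rewrite in_itv/= !ltW.
  apply: is_derive_eq (is_deriveD
    (is_derive_mul (is_derive_cst d t 1) (is_derive_mul (D i mxI) (D j mxI)))
    (is_derive_mul (D i mxII) (D j mxII))) _.
  by rewrite !mul_companionE /cst; ring.
- by rewrite in_itv/= ler01 lexx.
Qed.

(** The condition says that iota x commutes with the companion matrix, hence it
    defines a subgroup. It holds near the identity: along a ray of a chart, the
    derivative of iota is a multiple of iota times the companion matrix, and the
    conserved form keeps its value. *)
Lemma dim1_shape x : iota x mxII mxII = iota x mxI mxI /\
  iota x mxI mxII = - (d * iota x mxII mxI).
Proof.
move: x; apply: (open_subgroup data) => [x y|x|].
- rewrite (ld_mul data) (mx2_eta (iota x)) (mx2_eta (iota y)) mulmx2 !mx2E.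
  by move=> [-> ->] [-> ->]; split; ring.
- move=> [h1 h2]; have := ld_invl data x; have := ld_det data x.
  have E : iota x = mx2 (iota x mxI mxI) (- (d * iota x mxII mxI))
                        (iota x mxII mxI) (iota x mxI mxI).
    by rewrite {1}(mx2_eta (iota x)) h1 h2.
  move: (iota x mxI mxI) (iota x mxII mxI) E => p r -> {h1 h2}.
  rewrite det_mx2 => dE iE.
  have -> : iota (linv S x) = mx2 p (d * r) (- r) p.
    rewrite -[LHS]mulmx1 (_ : 1%:M = mx2 p (- (d * r)) r p *m mx2 p (d * r) (- r) p).
      by rewrite mulmxA iE mul1mx.
    by rewrite mulmx2 mx2_1 -dE; apply: mx2P; rewrite !mx2E; ring.
  by rewrite !mx2E; split; ring.
have ix := chart_image_dom ie; set x0 := chart i0 (lone S) in ix.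
have /nbhs_ballP[r /= r0 rP] := chart_image_nbhs ix.
(* join x0 to the chart image of q by a ray inside the chart *)
have near_x0 : \forall q \near lone S, chart_dom i0 q /\ ball x0 r (chart i0 q).
  apply: filterI; first exact: chart_dom_nbhs.
  by apply: (chart_cts ie); exact: nbhsx_ballx.
apply: filterS near_x0 => q [iq bq]; set v := chart i0 q - x0.
pose g t := (iota \o chart_inv i0) (x0 + t *: v).
have vr : `|v| < r by move: bq; rewrite -ball_normE /= distrC.
have g0 : g 0 = 1%:M by rewrite /g scale0r addr0 /= chartK// (ld_one data).
have g1 : g 1 = iota q by rewrite /g scale1r /v addrC subrK /= chartK.
have C := @dim1_conserved g _.
have {}C i j : d * (g 1 i mxI * g 1 j mxI) + g 1 i mxII * g 1 j mxII =
              d * (g 0 i mxI * g 0 j mxI) + g 0 i mxII * g 0 j mxII.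
  apply: C => t; rewrite in_itv/= => /andP[t0 t1].
  have it : chart_image i0 (x0 + t *: v).
    apply: rP; rewrite -ball_normE /= opprD addrA subrr add0r normrN normrZ.
    by rewrite ger0_norm// (le_lt_trans _ vr)// ler_piMl.
  have D := chart_curve data it.
  have [w E] := tangent_left data ie v (chart_inv_dom it).
  have [c Ec] := lie_alg_dim1 w; exists c; apply: is_derive_eq D _.
  move: E; rewrite chart_invK// => ->; rewrite Ec -scalemxAr.
  by rewrite -/(g t).
have := C mxI mxI; have := C mxI mxII; have := C mxII mxII.
have := ld_det data q; rewrite g0 g1 mx2_1 !mx2E {1}(mx2_eta (iota q)) det_mx2.
move: (iota q mxI mxI) (iota q mxI mxII) (iota q mxII mxI) (iota q mxII mxII).
rewrite !(mul0r, mulr0, mul1r, mulr1, addr0, add0r).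
move=> a b c s E4 E3 E2 E1; split.
  have -> : a = a * (d * (c * c) + s * s) by rewrite E3 mulr1.
  transitivity (s * (a * s - b * c) + c * (d * (a * c) + b * s)); last by ring.
  by rewrite E2 E4; ring.
have -> : b = b * (d * (c * c) + s * s) by rewrite E3 mulr1.
transitivity (- (d * c) * (a * s - b * c) + s * (d * (a * c) + b * s)); first by ring.
by rewrite E2 E4; ring.
Qed.

Lemma dim1_mx x : iota x = mx2 (iota x mxI mxI) (- (d * iota x mxII mxI))
                               (iota x mxII mxI) (iota x mxI mxI).
Proof. by have [h1 h2] := dim1_shape x; rewrite {1}(mx2_eta (iota x)) h1 h2. Qed.

Lemma dim1_norm x :
  iota x mxI mxI * iota x mxI mxI + d * (iota x mxII mxI * iota x mxII mxI) = 1.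
Proof. by rewrite -[RHS](ld_det data x) [in RHS]dim1_mx det_mx2; ring. Qed.

Lemma dim1_gt0 : d <= 0 -> forall x, 0 < iota x mxI mxI.
Proof.
move=> d0; apply: (connected_gt0 data (x0 := lone S)).
- exact: (entry_continuous (i := mxI) (j := mxI) data).
- move=> x; apply/eqP => x0; have := dim1_norm x; rewrite x0 mul0r add0r => E.
  have : d * (iota x mxII mxI * iota x mxII mxI) <= 0.
    by rewrite mulr_le0_ge0// -expr2 sqr_ge0.
  by rewrite E ler10.
- by rewrite (ld_one data) mx2_1 mx2E.
Qed.

Lemma dim1_sub x : one_param_group d (iota x).
Proof.
exists (iota x mxI mxI), (iota x mxII mxI); split; first exact: dim1_mx.
  exact: dim1_norm.
by move=> d0; exact: dim1_gt0.
Qed.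

Lemma dim1_inv x : iota (linv S x) = mx2 (iota x mxI mxI) (d * iota x mxII mxI)
                               (- iota x mxII mxI) (iota x mxI mxI).
Proof.
have iE := ld_invl data x; have N := dim1_norm x; move: iE; rewrite (dim1_mx x).
rewrite !mx2E; move: (iota x mxI mxI) (iota x mxII mxI) N => p r N iE.
rewrite -[LHS]mulmx1 (_ : 1%:M = mx2 p (- (d * r)) r p *m mx2 p (d * r) (- r) p).
  by rewrite mulmxA iE mul1mx.
by rewrite mulmx2 mx2_1 -N; apply: mx2P; rewrite !mx2E; ring.
Qed.

Lemma dim1_mul x y :
  (iota (lmul S x y) mxI mxI =
     iota x mxI mxI * iota y mxI mxI - d * (iota x mxII mxI * iota y mxII mxI)) *
  (iota (lmul S x y) mxII mxI =
     iota x mxII mxI * iota y mxI mxI + iota x mxI mxI * iota y mxII mxI).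
Proof.
rewrite (ld_mul data) (dim1_mx x) (dim1_mx y) mulmx2 !mx2E.
by split; ring.
Qed.

(** Otherwise the lower left entry would vanish on the Lie algebra too. *)
Lemma dim1_nontrivial : exists x, iota x mxII mxI != 0.
Proof.
apply: contrapT => nx; have rx x : iota x mxII mxI = 0.
  by apply/eqP/negPn/negP => h; apply: nx; exists x.
have l : linear (fun M : 'M[R]_2 => M mxII mxI : R) by move=> c M N; rewrite !mxE.
pose L : {linear 'M[R]_2 -> R} := HB.pack (fun M : 'M[R]_2 => M mxII mxI : R)
  (GRing.isLinear.Build _ _ _ _ _ l).
have cL : continuous L by exact: coord_continuous.
have := lie_alg_relation data ie cL rx (const_mx 1).
by rewrite /= hX mxE mx2E mulr1; apply/eqP.
Qed.

(** When d <= 0 squaring at least doubles the lower left entry; being a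
    connected set of reals, its values are all reals. *)
Lemma dim1_surjective_le0 : d <= 0 -> forall c, exists x, iota x mxII mxI = c.
Proof.
move=> d0 c; have [x1 x10] := dim1_nontrivial.
have grow n : exists x, 2 ^+ n * `|iota x1 mxII mxI| <= `|iota x mxII mxI|.
  elim: n => [|n [x IH]]; first by exists x1; rewrite mul1r.
  exists (lmul S x x); rewrite dim1_mul.
  rewrite (_ : _ + _ = 2 * (iota x mxI mxI * iota x mxII mxI)); last by ring.
  rewrite exprS -mulrA normrM (ger0_norm (ler0n R 2)) ler_pM2l//.
  apply: le_trans IH _; rewrite normrM ler_peMl//.
  have p0 := dim1_gt0 d0 x; rewrite gtr0_norm//.
  have := dim1_norm x; have : d * (iota x mxII mxI * iota x mxII mxI) <= 0.
    by rewrite mulr_le0_ge0// -expr2 sqr_ge0.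
  by move: (iota x mxI mxI) p0 => p p0 ? ?; nra.
have [x cx_] : exists x, `|c| <= `|iota x mxII mxI|.
  have [x xn] := grow (Num.bound (`|c| / `|iota x1 mxII mxI|)).
  exists x; apply: le_trans xn; rewrite -ler_pdivrMr ?normr_gt0//.
  exact/ltW/upper_nthrootP.
have ivt y z : iota y mxII mxI <= c <= iota z mxII mxI ->
    exists x, iota x mxII mxI = c.
  apply: (connected_ivt data (u := fun x => iota x mxII mxI)).
  exact: (entry_continuous (i := mxII) (j := mxI) data).
have rinv : iota (linv S x) mxII mxI = - iota x mxII mxI.
  by rewrite dim1_inv mx2E.
have [r0|r0] := leP 0 (iota x mxII mxI).
  rewrite ler_norml (ger0_norm r0) in cx_; have h := ivt (linv S x) x.
  by rewrite rinv in h; exact: h.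
rewrite ler_norml (ltr0_norm r0) opprK in cx_; have h := ivt x (linv S x).
by rewrite rinv in h; exact: h.
Qed.

Lemma dim1_range_le0 A : d <= 0 -> one_param_group d A <-> exists x, iota x = A.
Proof.
move=> d0; split=> [[c [s [-> cs /(_ d0) c0]]]|[x <-]]; last exact: dim1_sub.
have [x xs] := dim1_surjective_le0 d0 s; exists x.
have := dim1_norm x; have := dim1_gt0 d0 x; have := dim1_mx x; rewrite xs => -> p0.
rewrite mx2E in p0; rewrite mx2E -cs => /addIr pc.
have -> : iota x mxI mxI = c by move: (iota x mxI mxI) p0 pc => p p0 pc; nra.
by [].
Qed.

(** When d = 1 small rotations are reached because the cosine takes an interval
    of values; the others are their powers. *)
Lemma dim1_range_rot A : d = 1 -> one_param_group d A <-> exists x, iota x = A.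
Proof.
move=> d1; split=> [|[x <-]]; last exact: dim1_sub.
(* the angles up to acos p1 are reached by connectedness of the group *)
pose rot t : 'M[R]_2 := mx2 (cos t) (- sin t) (sin t) (cos t).
have rotD t u : rot (t + u) = rot t *m rot u.
  by rewrite /rot mulmx2 cosD sinD; apply: mx2P; rewrite !mx2E; ring.
have [x1 x10] := dim1_nontrivial; pose p1 := iota x1 mxI mxI.
have p11 : -1 <= p1 < 1.
  have := dim1_norm x1; rewrite d1 mul1r -/p1 -!expr2 => N.
  have : 0 < iota x1 mxII mxI ^+ 2 by rewrite exprn_even_gt0.
  by move=> *; apply/andP; split; nra.
have t0 := acos_gt0 p11.
have p11' : -1 <= p1 <= 1 by case/andP: p11 => -> /ltW.
have [/andP[_ tpi] ct] := acos_def p11'.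
have small t : 0 <= t <= acos p1 -> exists x, iota x = rot t.
  move=> /andP[t_0 t1]; have cp : p1 <= cos t <= 1.
    rewrite cos_le1 andbT -[X in X <= _]ct leNgt ltr_cos ?in_itv/=.
    - by rewrite -leNgt.
    - by rewrite (ltW t0).
    - by rewrite t_0 (le_trans t1).
  have cp' : iota x1 mxI mxI <= cos t <= iota (lone S) mxI mxI.
    by rewrite (ld_one data) mx2_1 mx2E.
  have cu := entry_continuous (i := mxI) (j := mxI) data.
  have [z zc] := connected_ivt data (u := fun x => iota x mxI mxI) cu cp'.
  have := dim1_norm z; rewrite zc d1 mul1r -[1](cos2Dsin2 t) -!expr2 => /addrI.
  move=> /eqP; rewrite eqf_sqr => /orP[]/eqP zs.
    by exists z; rewrite dim1_mx zs zc d1 mul1r.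
  by exists (linv S z); rewrite dim1_inv zs zc d1 mul1r opprK.
have pow n t : (exists x, iota x = rot t) -> exists x, iota x = rot (t *+ n).
  move=> [x xt]; elim: n => [|n [y yt]].
    exists (lone S); rewrite (ld_one data) mulr0n /rot cos0 sin0 oppr0.
    exact: mx2_1.
  by exists (lmul S x y); rewrite (ld_mul data) xt yt mulrS rotD.
have nonneg t : 0 <= t -> exists x, iota x = rot t.
  move=> t_0; pose n := (Num.bound (t / acos p1)).+1.
  have n0 : 0 < n%:R :> R by rewrite ltr0n.
  have -> : t = (t / n%:R) *+ n by rewrite -mulr_natr divfK// gt_eqF.
  apply/pow/small; rewrite divr_ge0 ?ler0n//= ler_pdivrMr// -ler_pdivrMl//.
  rewrite mulrC (le_trans (ltW (archi_boundP _)))// ?divr_ge0 ?(ltW t0)//.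
  by rewrite ler_nat.
move=> [c [s [-> cs _]]]; rewrite d1 mul1r; rewrite d1 mul1r in cs.
have [t [<- <-]] := circle_param cs; have [t_0|t_0] := leP 0 t.
  exact: nonneg.
have [|x xt] := nonneg (- t); first by rewrite oppr_ge0 ltW.
exists (linv S x); rewrite dim1_inv xt /rot !mx2E d1 mul1r cosN sinN.
by rewrite opprK.
Qed.

End DimensionOne.

(** * Subgroups of dimension two: the derived algebra *)

Section TracelessMatrices.
Context (R : realType).
Implicit Types X Y : 'M[R]_2.

Lemma traceless_nonscalar X : X mxII mxII = - X mxI mxI -> X != 0 -> nonscalar X.
Proof.
move=> tX X0; have [b0|b0] := eqVneq (X mxI mxII) 0; last by left.
have [c0|c0] := eqVneq (X mxII mxI) 0; last by right; left.
right; right; apply: contra_neq X0; rewrite tX opprK => a0.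
have a00 : X mxI mxI = 0 by lra.
by apply: mx2P; rewrite ?tX ?a00 ?b0 ?c0 mxE ?oppr0.
Qed.

(** Proportionality in [commute2P] gives proportional matrices, as the trace is zero. *)
Lemma traceless_commute X Y : X mxII mxII = - X mxI mxI ->
  Y mxII mxII = - Y mxI mxI -> X != 0 -> X *m Y = Y *m X ->
  exists c, Y = c *: X.
Proof.
move=> tX tY X0 /commute2P; rewrite tX tY !opprK => -[h1 h2 h3].
have key c : Y mxI mxII = c * X mxI mxII -> Y mxII mxI = c * X mxII mxI ->
    Y mxI mxI + Y mxI mxI = c * (X mxI mxI + X mxI mxI) -> exists c, Y = c *: X.
  move=> e1 e2 e3; have e0 : Y mxI mxI = c * X mxI mxI.
    rewrite mulrDr in e3.
    by move: (Y mxI mxI) (c * X mxI mxI) e3 => y c' e3; lra.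
  by exists c; apply: mx2P; rewrite !mxE ?tX ?tY ?e0 ?e1 ?e2 ?mulrN.
have div (v p q r : R) : v != 0 -> v * q = r * p -> q = p / v * r.
  by move=> v0 E; apply: (mulfI v0); rewrite E; field.
have := traceless_nonscalar tX X0; rewrite /nonscalar tX opprK => -[u0|[u0|u0]].
- by apply: (key (Y mxI mxII / X mxI mxII)); [field|exact: div|exact: div].
- by apply: (key (Y mxII mxI / X mxII mxI)); [exact/div/esym|field|exact: div].
- apply: (key ((Y mxI mxI + Y mxI mxI) / (X mxI mxI + X mxI mxI))); last by field.
    exact/div/esym.
  exact/div/esym.
Qed.

End TracelessMatrices.

Section DimensionTwo.
Context (R : realType) (H : manifold R 2) (S : lie_group H).
Variable (iota : H -> 'M[R]_2).
Hypothesis data : lie_subgroup_data S iota.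
Variable i0 : chart_index H.
Hypothesis ie : chart_dom i0 (lone S).
Local Notation alg := (lie_alg S iota i0).
Let X := alg (row2 1 0).
Let Y := alg (row2 0 1).

Lemma lie_alg_dim2 v : alg v = cx v *: X + cy v *: Y.
Proof. exact: diff_coord. Qed.

(** A commuting pair of traceless matrices is linearly dependent. *)
Lemma dim2_noncommutative : X *m Y <> Y *m X.
Proof.
have alg0 : alg 0 = 0 by rewrite /lie_alg linear0.
have X0 : X != 0.
  apply/eqP => X0; have := lie_alg_inj data ie (etrans X0 (esym alg0)).
  move=> /(congr1 (fun v : 'rV[R]_2 => cx v)); rewrite !mxE /=.
  by apply/eqP; exact: oner_neq0.
move=> XY; have [c Yc] := traceless_commute (lie_alg_trace data ie _)
  (lie_alg_trace data ie _) X0 XY.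
have : alg (row2 (- c) 1) = alg 0.
  apply: etrans (lie_alg_dim2 _) (etrans _ (esym alg0)).
  rewrite !row2E (_ : Y = c *: X); last exact: Yc.
  by rewrite scale1r scaleNr addNr.
move=> /(lie_alg_inj data ie) /(congr1 (fun v : 'rV[R]_2 => cy v)).
by rewrite !mxE /=; apply/eqP; exact: oner_neq0.
Qed.

(** A generator of the derived algebra. *)
Let Z := X *m Y - Y *m X.

Lemma dim2_bracket u v :
  alg u *m alg v - alg v *m alg u = (cx u * cy v - cy u * cx v) *: Z.
Proof.
rewrite (lie_alg_dim2 u) (lie_alg_dim2 v) /Z.
move: (cx u) (cy u) (cx v) (cy v) => a b a' b'.
rewrite !mulmxDl !mulmxDr -!scalemxAl -!scalemxAr.
rewrite (mx2_eta X) (mx2_eta Y) !mulmx2.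
by apply: mx2P; rewrite !mxE/=; ring.
Qed.

(** The group acts on the Lie algebra by conjugation, and thus on its derived line. *)
Lemma dim2_normalize g : exists c, iota g *m Z = c *: (Z *m iota g).
Proof.
have [u Eu] := ad_stable data ie g (row2 1 0).
have [v Ev] := ad_stable data ie g (row2 0 1).
exists (cx u * cy v - cy u * cx v).
have ug := ld_unit data g.
have : conj_mx (iota g) Z = (cx u * cy v - cy u * cx v) *: Z.
  rewrite -dim2_bracket -Eu -Ev -/X -/Y -/(conj_mx _ _) -/(conj_mx _ _).
  by rewrite -!conj_mxM// /conj_mx -mulmxBl -mulmxBr.
by move=> /(congr1 (mulmx^~ (iota g))); rewrite /conj_mx /= mulmxKV// scalemxAl.
Qed.

Lemma dim2_traceless : Z mxII mxII = - Z mxI mxI.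
Proof.
by rewrite /Z (mx2_eta X) (mx2_eta Y) !mulmx2 !mxE/=; ring.
Qed.

Lemma dim2_Z_neq0 : Z != 0.
Proof. by rewrite subr_eq0; apply/eqP; exact: dim2_noncommutative. Qed.

(** If Z were invertible, comparing determinants in [dim2_normalize] would give
    c = 1 or c = -1. Near the identity c = -1 is excluded by continuity, so the
    whole connected group commutes with Z, and so does its Lie algebra. But the
    commutant of a nonscalar matrix is commutative. *)
Lemma dim2_det0 : \det Z = 0.
Proof.
apply/eqP; apply: contrapT => /negP D0; apply: dim2_noncommutative.
have sgn g : iota g *m Z = Z *m iota g \/ iota g *m Z = - (Z *m iota g).
  have [c E] := dim2_normalize g.
  have : c ^+ 2 = 1.
    have := congr1 determinant E; rewrite detZ !det_mulmx (ld_det data).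
    rewrite mul1r mulr1 => /esym/eqP; rewrite -subr_eq0 -{2}[\det Z]mul1r -mulrBl.
    by rewrite mulf_eq0 (negbTE D0) orbF subr_eq0 => /eqP.
  move=> /eqP; rewrite sqrf_eq1 => /orP[]/eqP c1; move: E; rewrite c1.
    by rewrite scale1r; left.
  by rewrite scaleN1r; right.
have Zc : forall g, iota g *m Z = Z *m iota g.
  apply: (open_subgroup data) => [x y hx hy|x hx|].
  - by rewrite (ld_mul data) -mulmxA hy mulmxA hx mulmxA.
  - rewrite (ld_inv data); have ux := ld_unit data x.
    have : invmx (iota x) *m (iota x *m Z) *m invmx (iota x) =
           invmx (iota x) *m (Z *m iota x) *m invmx (iota x) by rewrite hx.
    by rewrite mulKmx// -!mulmxA mulmxV// mulmx1 => ->.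
  have [i [j Zij]] : exists i j, Z i j != 0.
    apply: contrapT => nZ; move: dim2_Z_neq0 => /eqP; apply.
    apply/matrixP => i j; rewrite [RHS]mxE; apply/eqP/negPn/negP => h.
    by apply: nZ; exists i, j.
  pose u g := (iota g *m Z + Z *m iota g) i j.
  have cu : {for lone S, continuous u}.
    apply: (@continuous_comp _ _ _ iota (fun M => (M *m Z + Z *m M) i j)).
      exact: (@ld_continuous _ _ _ _ _ data).
    have cM : continuous (fun M : 'M[R]_2 => M *m Z + Z *m M).
      move=> M; apply: (@cvgD _ _ _ (nbhs M) _ (mulmxr Z) (mulmx Z)).
        exact: (@mulmxr_continuous R Z).
      exact: (@mulmxl_continuous R Z).
    have cE : continuous (fun M : 'M[R]_2 => M i j : R) by exact: coord_continuous.
    exact: (continuous_comp (cM _) (cE _)).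
  have ue : u (lone S) != 0.
    rewrite /u (ld_one data) mul1mx mulmx1; move: (Z) Zij => M Mij; rewrite mxE.
    by apply: contra_neq Mij => M2; lra.
  have : \forall g \near lone S, u g != 0 by exact: (cvgr_neq0 _ cu ue).
  apply: filterS => g ug; have [//|Eg] := sgn g.
  by move: ug; rewrite /u Eg addNr mxE eqxx.
have nZ := traceless_nonscalar dim2_traceless dim2_Z_neq0.
by apply: (commutant_commutative nZ); apply/esym; exact: (lie_alg_commute data ie Zc).
Qed.

End DimensionTwo.

(** * Subgroups of dimension two are triangular groups *)

Section BorelRange.
Context (R : realType) (H : manifold R 2) (S : lie_group H).
Variable (iota : H -> 'M[R]_2).
Hypothesis data : lie_subgroup_data S iota.
Variables (i0 : chart_index H) (k : R).
Hypothesis ie : chart_dom i0 (lone S).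
Local Notation alg := (lie_alg S iota i0).
Let X := alg (row2 1 0).
Let Y := alg (row2 0 1).
Hypotheses (k0 : k != 0) (hZ : X *m Y - Y *m X = k *: mx2 0 1 0 0).
Local Notation diag x := (iota x mxI mxI).

(** The line of the derived algebra is normalized, so its kernel is invariant. *)
Lemma borel_lower x : iota x mxII mxI = 0.
Proof.
have [c] := dim2_normalize data ie x; rewrite -/X -/Y hZ.
rewrite -scalemxAl -scalemxAr {1 2}(mx2_eta (iota x)) !mulmx2.
move=> /(congr1 (fun M : 'M[R]_2 => M mxII mxII)); rewrite !mxE/=.
rewrite !(mulr0, mul0r, mulr1, addr0, add0r) => /eqP.
by rewrite mulf_eq0 (negbTE k0) => /eqP.
Qed.

Lemma borel_det x : diag x * iota x mxII mxII = 1.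
Proof.
by rewrite -[RHS](ld_det data x) [in RHS](mx2_eta (iota x)) det_mx2 borel_lower
  mulr0 subr0.
Qed.

Lemma borel_gt0 x : 0 < diag x.
Proof.
apply: (connected_gt0 data (x0 := lone S) (u := fun x => diag x)).
- exact: (entry_continuous (i := mxI) (j := mxI) data).
- move=> y; apply/eqP => y0; have := borel_det y; rewrite y0 mul0r => /esym/eqP.
  exact/negP/oner_neq0.
- by rewrite (ld_one data) mx2_1 mx2E.
Qed.

Lemma borel_mx x : iota x = mx2 (diag x) (iota x mxI mxII) 0 (diag x)^-1.
Proof.
have p0 := gt_eqF (borel_gt0 x).
rewrite {1}(mx2_eta (iota x)) borel_lower; congr (mx2 _ _ _ _).
by apply: (mulfI (negbT p0)); rewrite borel_det divff ?p0.
Qed.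

Lemma borel_diagM x y : diag (lmul S x y) = diag x * diag y.
Proof. by rewrite (ld_mul data) (borel_mx x) (borel_mx y) mulmx2 !mx2E mulr0 addr0. Qed.

Lemma borel_diagV x : diag (linv S x) = (diag x)^-1.
Proof.
have p0 := negbT (gt_eqF (borel_gt0 x)).
by apply: (mulIf p0); rewrite -borel_diagM lmulV (ld_one data) mx2_1 mx2E mulVf.
Qed.

(** Otherwise the diagonal would be constant, and the Lie algebra strictly upper
    triangular, hence commutative. *)
Lemma borel_diag_gt1 : exists g, 1 < diag g.
Proof.
apply: contrapT => no1.
have le1 x : diag x <= 1 by rewrite leNgt; apply/negP => h; apply: no1; exists x.
have diag1 x : diag x = 1.
  apply/le_anti/andP; split=> //.
  by have := le1 (linv S x); rewrite borel_diagV invf_le1 ?borel_gt0.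
have rel i c : (forall x, iota x i mxI = c) -> forall v, alg v i mxI = 0.
  move=> ci v.
  have l : linear (fun M : 'M[R]_2 => M i mxI : R) by move=> a M N; rewrite !mxE.
  pose L : {linear 'M[R]_2 -> R} := HB.pack (fun M : 'M[R]_2 => M i mxI : R)
    (GRing.isLinear.Build _ _ _ _ _ l).
  have cL : continuous L by exact: coord_continuous.
  exact: (lie_alg_relation data ie cL ci v).
have a00 v : alg v mxI mxI = 0 by exact: rel diag1 v.
have a10 v : alg v mxII mxI = 0 by exact: rel borel_lower v.
have aE v : alg v = mx2 0 (alg v mxI mxII) 0 0.
  by rewrite {1}(mx2_eta (alg v)) (lie_alg_trace data ie v) a00 a10 oppr0.
apply: (dim2_noncommutative data ie).
by rewrite (aE (row2 1 0)) (aE (row2 0 1)) !mulmx2; apply: mx2P; rewrite !mx2E; ring.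
Qed.

(** The diagonal entry is unbounded on the powers of an element where it
    exceeds 1; by connectedness it takes all positive values. *)
Lemma borel_diag_surjective c : 0 < c -> exists g, diag g = c.
Proof.
move=> c0; have [g g1] := borel_diag_gt1.
have grow n : exists x, 1 + n%:R * (diag g - 1) <= diag x.
  elim: n => [|n [x IH]].
    by exists (lone S); rewrite (ld_one data) mx2_1 mx2E mul0r addr0.
  exists (lmul S g x); rewrite borel_diagM -natr1.
  have n0 : 0 <= n%:R :> R by [].
  have := ler_wpM2l (ltW (borel_gt0 g)) IH; apply: le_trans.
  have := mulr_ge0 n0 (sqr_ge0 (diag g - 1)).
  by move: n%:R (diag g) => m p; lra.
have big b : exists x, b <= diag x.
  have [x xn] := grow (Num.bound (b / (diag g - 1))); exists x.
  apply: le_trans xn; rewrite -[X in X <= _]add0r lerD// -ler_pdivrMr ?subr_gt0//.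
  have [b0|b0] := leP 0 b; first by rewrite ltW// archi_boundP// divr_ge0// subr_ge0 ltW.
  by rewrite (@le_trans _ _ 0)// pmulr_lle0 ?invr_gt0 ?subr_gt0// ltW.
have [x cx_] := big c; have [y cy_] := big c^-1.
apply: (connected_ivt data (u := fun x => diag x) (x := linv S y) (y := x)).
  exact: (entry_continuous (i := mxI) (j := mxI) data).
by rewrite cx_ andbT borel_diagV -[c in _ <= c]invrK lef_pV2 ?posrE ?invr_gt0 ?borel_gt0.
Qed.

(** Otherwise the group, and with it the Lie algebra, would be contained in the
    commutative commutant of an element with distinct eigenvalues. *)
Lemma borel_noncommutative : exists g h, iota g *m iota h <> iota h *m iota g.
Proof.
have [g g1] := borel_diag_gt1; exists g; apply: contrapT => nh.
have gh h : iota h *m iota g = iota g *m iota h.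
  by apply: contrapT => E; apply: nh; exists h => /esym.
have ns : nonscalar (iota g).
  right; right; rewrite (borel_mx g) !mx2E subr_eq0 gt_eqF//.
  by apply: lt_trans (g1); rewrite invf_lt1// (lt_trans ltr01 g1).
apply: (dim2_noncommutative data ie); apply: (commutant_commutative ns); apply/esym.
  exact: (lie_alg_commute data ie gh).
exact: (lie_alg_commute data ie gh).
Qed.

(** A commutator is unipotent. *)
Lemma borel_unipotent : exists2 m, m != 0 & exists g, iota g = mx2 1 m 0 1.
Proof.
have [g [h gh]] := borel_noncommutative.
pose u := lmul S (lmul S g h) (linv S (lmul S h g)).
have du : diag u = 1.
  rewrite /u borel_diagM borel_diagV !borel_diagM [diag h * _]mulrC divff//.
  by rewrite mulf_neq0// gt_eqF// borel_gt0.
have uE := borel_mx u; rewrite du invr1 in uE.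
exists (iota u mxI mxII); last by exists u.
apply/eqP => m0; apply: gh; rewrite m0 -mx2_1 in uE.
have : iota (lmul S u (lmul S h g)) = iota (lmul S h g).
  by rewrite (ld_mul data) uE mul1mx.
rewrite /u -lmulA lmulV (lmulr1 data) !(ld_mul data); exact.
Qed.

(** Conjugation by an element with diagonal entry l multiplies the parameter of
    a unipotent by l^2; inversion changes its sign. *)
Lemma borel_unipotents w : exists g, iota g = mx2 1 w 0 1.
Proof.
have [m m0 [u uE]] := borel_unipotent.
have pos v : v != 0 -> (exists g, iota g = mx2 1 v 0 1) -> 0 < w / v ->
    exists g, iota g = mx2 1 w 0 1.
  move=> v0 [h hE] wv; have [g gl] : exists g, diag g = Num.sqrt (w / v).
    by apply: borel_diag_surjective; rewrite sqrtr_gt0.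
  exists (lmul S (lmul S g h) (linv S g)).
  rewrite !(ld_mul data) (ld_inv data) hE.
  have ug := ld_unit data g; apply: (can_inj (mulmxK ug)); rewrite mulmxKV//.
  rewrite (borel_mx g) !mulmx2.
  have l0 : diag g != 0 by rewrite gt_eqF// borel_gt0.
  have l2 : diag g * diag g = w / v by rewrite gl -expr2 sqr_sqrtr// ltW.
  have -> : w = v * (diag g * diag g) by rewrite l2; field.
  by apply: mx2P; rewrite !mx2E; field.
have [w0|w0] := eqVneq w 0.
  by exists (lone S); rewrite (ld_one data) w0 mx2_1.
have [wm|wm] := leP (w / m) 0; last by apply: (pos m m0) => //; exists u.
apply: (pos (- m)); rewrite ?oppr_eq0//.
  exists (linv S u); rewrite (ld_inv data).
  have uu := ld_unit data u; apply: (can_inj (mulmxK uu)); rewrite mulVmx//.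
  by rewrite uE mulmx2 mx2_1; apply: mx2P; rewrite !mx2E; ring.
rewrite invrN mulrN oppr_gt0 lt_neqAle wm andbT mulf_neq0// invr_eq0//.
Qed.

Lemma borel_range A : borel_group A <-> exists x, iota x = A.
Proof.
split=> [[l [m [-> l0]]]|[x <-]]; last first.
  by exists (diag x), (iota x mxI mxII); split; [exact: borel_mx|exact: borel_gt0].
have [g gl] := borel_diag_surjective l0.
have [u uE] := borel_unipotents ((m - iota g mxI mxII) * l).
exists (lmul S u g); rewrite (ld_mul data) uE (borel_mx g) gl mulmx2.
have ln := negbT (gt_eqF l0).
by apply: mx2P; rewrite !mx2E; field.
Qed.

End BorelRange.

Section DimensionTwoRange.
Context (R : realType) (H : manifold R 2) (S : lie_group H).
Variable (iota : H -> 'M[R]_2).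
Hypothesis data : lie_subgroup_data S iota.

(** In the normal form of the derived algebra the generator is k times the
    companion matrix of 0, as its determinant vanishes; J exchanges the two basis
    vectors to make it upper triangular. *)
Lemma dim2_range : exists2 Q : 'M[R]_2, Q \in unitmx &
  forall A, borel_group A <-> exists x, conj_mx Q (iota x) = A.
Proof.
have [i0 ie] := chart_dom_cover (lone S).
pose Z := lie_alg S iota i0 (row2 1 0) *m lie_alg S iota i0 (row2 0 1)
  - lie_alg S iota i0 (row2 0 1) *m lie_alg S iota i0 (row2 1 0).
have tZ : Z mxII mxII = - Z mxI mxI by exact: dim2_traceless.
have Z0 : Z != 0 by exact: (dim2_Z_neq0 data ie).
have D0 : \det Z = 0 by exact: (dim2_det0 data ie).
have [P [k [d [uP k0 _ PZ]]]] := traceless_normal_form tZ Z0.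
have d0 : d = 0.
  have := congr1 determinant PZ; rewrite !det_mulmx D0 mulr0 mul0r detZ.
  rewrite det_mx2 mul0r sub0r mulr1 opprK => /esym/eqP.
  by rewrite mulf_eq0 expf_eq0 (negbTE k0) => /eqP.
pose J : 'M[R]_2 := mx2 0 1 1 0.
have JJ : J *m J = 1%:M.
  by rewrite mulmx2 mx2_1; apply: mx2P; rewrite !mx2E; ring.
have uJ : J \in unitmx by apply: (proj1 (mulmx1_unit JJ)).
have iJ : invmx J = J by rewrite -[LHS]mulmx1 -JJ mulKmx.
have uQ : J *m P \in unitmx by rewrite unitmx_mul uJ.
exists (J *m P) => //.
apply: (borel_range (conj_data data uQ) ie k0).
rewrite !(lie_alg_conj data (J *m P) ie) -!conj_mxM//.
have QM M : conj_mx (J *m P) M = J *m conj_mx P M *m J.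
  apply: (can_inj (mulmxK uQ)); rewrite /conj_mx mulmxKV//.
  by rewrite !mulmxA -(mulmxA _ J J) JJ mulmx1 mulmxKV.
have -> M N : conj_mx (J *m P) M - conj_mx (J *m P) N = conj_mx (J *m P) (M - N).
  by rewrite /conj_mx mulmxBr mulmxBl.
rewrite QM /conj_mx -/Z PZ d0 -scalemxAr -scalemxAl !mulmx2; congr (_ *: _).
by apply: mx2P; rewrite !mx2E; ring.
Qed.

End DimensionTwoRange.

(** * Local surjectivity by minimization *)

Section LinearRank.
Context (R : realType).

Lemma inj_linear_free m n (f : {linear 'rV[R]_m -> 'rV[R]_n}) : injective f ->
  row_free (lin1_mx f).
Proof.
move=> fi; apply: inj_row_free => v; rewrite mul_rV_lin1 => fv.
by apply: fi; rewrite fv linear0.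
Qed.

Lemma inj_linear_le m n (f : {linear 'rV[R]_m -> 'rV[R]_n}) : injective f ->
  (m <= n)%N.
Proof. by move=> /inj_linear_free /eqP <-; exact: rank_leq_col. Qed.

Lemma inj_linear_surj n (f : {linear 'rV[R]_n -> 'rV[R]_n}) : injective f ->
  forall w, exists v, f v = w.
Proof.
move=> /inj_linear_free; rewrite row_free_unit => u w.
by exists (w *m invmx (lin1_mx f)); rewrite -mul_rV_lin1 mulmxKV.
Qed.

End LinearRank.

Section LocalSurjection.
Context (R : realType) (n : nat).
Implicit Types (v : 'rV[R]_n.+1).

Definition sqnorm v : R := \sum_(j < n.+1) v 0 j * v 0 j.

Lemma sqnorm_ge0 v : 0 <= sqnorm v.
Proof. by apply: sumr_ge0 => j _; rewrite -expr2 sqr_ge0. Qed.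

Lemma sqnorm_eq0 v : sqnorm v = 0 -> v = 0.
Proof.
move=> /eqP; rewrite psumr_eq0; last by move=> j _; rewrite -expr2 sqr_ge0.
move=> /allP h; apply/rowP => j; rewrite mxE; apply/eqP.
by have := h j; rewrite mem_index_enum -expr2 sqrf_eq0; apply.
Qed.

(** The triangle inequality for the Euclidean norm, up to constants. *)
Lemma sqnorm_quasi u v : sqnorm u <= 2 * sqnorm (u - v) + 2 * sqnorm v.
Proof.
rewrite /sqnorm !mulr_sumr -big_split; apply: ler_sum => j _ /=; rewrite !mxE.
rewrite -subr_ge0 (_ : _ - _ = (u 0 j - 2 * v 0 j) ^+ 2) ?sqr_ge0//.
by move: (u _ _) (v _ _) => a b; ring.
Qed.

Lemma sqnorm_continuous : continuous sqnorm.
Proof.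
apply: continuous_big => [|j _ v]; first exact: add_continuous.
have c : continuous (fun v : 'rV[R]_n.+1 => v 0 j : R) by exact: coord_continuous.
exact: (cvgM (c v) (c v)).
Qed.

(** At a minimum of the squared distance to y all directional derivatives vanish,
    in particular the one in the direction sent to F x - y by the differential. *)
Lemma sqnorm_min_critical (U : set 'rV[R]_n.+1) (F : 'rV[R]_n.+1 -> 'rV[R]_n.+1) x y :
  nbhs x U -> (forall z, U z -> differentiable F z) -> injective ('d F x) ->
  (forall z, U z -> sqnorm (F x - y) <= sqnorm (F z - y)) -> F x = y.
Proof.
move=> xU dF iF mF; have [v Ev] := inj_linear_surj iF (F x - y).
have [r /= r0 rP] : exists2 r : R, 0 < r & forall t : R, `|t| < r -> U (x + t *: v).
  have [D _] := is_derive_ray x v 0.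
  have c : {for (0 : R), continuous (fun t : R => x + t *: v)}.
    exact/differentiable_continuous/derivable1_diffP.
  have xU0 : nbhs (x + 0 *: v) U by rewrite scale0r addr0.
  have /nbhs_ballP[r /= r0 rP] := c _ xU0.
  by exists r => // t tr; apply: rP; rewrite /ball/= sub0r normrN.
pose h t := sqnorm (F (x + t *: v) - y).
pose dh t := \sum_(j < n.+1) (('d F (x + t *: v) v - 0) 0 j * (F (x + t *: v) - y) 0 j
   + (F (x + t *: v) - y) 0 j * ('d F (x + t *: v) v - 0) 0 j).
have Dh t : U (x + t *: v) -> is_derive t 1 h (dh t).
  move=> Ut.
  have D1 : is_derive t 1 (fun s => F (x + s *: v)) ('d F (x + t *: v) v).
    apply: (is_derive_comp_curve (g := fun s => x + s *: v)); last exact: dF.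
    exact: is_derive_ray.
  have D2 : is_derive t 1 (fun s => F (x + s *: v) - y) ('d F (x + t *: v) v - 0).
    exact: is_deriveB.
  move: D2 => /is_derive_mx D2.
  have -> : h = \sum_(j < n.+1) (fun s => (F (x + s *: v) - y) 0 j * (F (x + s *: v) - y) 0 j).
    by apply/funext => s; rewrite /h /sqnorm fct_sumE.
  apply: is_derive_sum => j; apply: is_derive_eq (is_derive_mul (D2 0 j) (D2 0 j)) _.
  by [].
have itvU (t : R) : t \in `]-r, r[ -> U (x + t *: v).
  by rewrite in_itv/= => tr; apply: rP; rewrite ltr_norml.
have Ux : U (x + 0 *: v) by rewrite scale0r addr0; exact: nbhs_singleton xU.
have [_ h0] : is_derive (0 : R) 1 h 0.
  apply: (@derive1_at_min _ h (- r) r).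
  - by rewrite ge0_cp // ltW.
  - by move=> t /itvU /Dh[].
  - by rewrite in_itv/= oppr_lt0 r0.
  - move=> t /itvU Ut; rewrite /h scale0r addr0; exact: mF.
have [_ h0'] := Dh 0 Ux; rewrite h0 in h0'.
apply/eqP; rewrite -subr_eq0; apply/eqP/sqnorm_eq0.
move: h0'; rewrite /dh scale0r addr0 subr0 Ev => /esym E.
suff : sqnorm (F x - y) *+ 2 = 0 by move/eqP; rewrite mulrn_eq0 => /eqP.
by rewrite -E /sqnorm -sumrMnl; apply: eq_bigr => j _; rewrite mulr2n.
Qed.

(** An elementary substitute for the inverse function theorem: a point close to
    F x0 has a nearest value of F on a small ball around x0, it is not taken on
    the boundary of the ball, and at an interior critical point of the squared
    distance the invertible differential forces the distance to vanish. *)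
Lemma local_surjection (U : set 'rV[R]_n.+1) (F : 'rV[R]_n.+1 -> 'rV[R]_n.+1) x0 :
  nbhs x0 U -> (forall x, U x -> differentiable F x) ->
  (forall x, U x -> injective ('d F x)) ->
  (forall x, U x -> F x = F x0 -> x = x0) ->
  \forall y \near F x0, exists2 x, U x & F x = y.
Proof.
move=> /nbhs_ballP[r /= r0 rU] dF iF jF; pose p := r / 2.
have p0 : 0 < p by rewrite divr_gt0.
have pr : p < r by rewrite /p; lra.
pose B : set 'rV[R]_n.+1 := [set x : 'rV[R]_n.+1 | `|x0 - x| <= p].
pose C : set 'rV[R]_n.+1 := [set x : 'rV[R]_n.+1 | `|x0 - x| = p].
have BU x : B x -> U x.
  by move=> Bx; apply: rU; rewrite -ball_normE /= (le_lt_trans Bx).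
have nc : continuous (fun x : 'rV[R]_n.+1 => `|x0 - x|).
  move=> x; have c : x0 - z @[z --> x] --> x0 - x.
    by apply: (@cvgB _ _ _ (nbhs x) _ (cst x0) id); [exact: cvg_cst|exact: cvg_id].
  exact: (cvg_norm c).
have cB : compact B.
  apply: bounded_closed_compact; last first.
    by move/continuous_closedP: nc => /(_ _ (@closed_le _ p)).
  exists (`|x0| + p); split; first exact: num_real.
  move=> M xM x /= Bx; apply: le_trans (ltW xM).
  have -> : `|x| = `|x0 - (x0 - x)| by rewrite subKr.
  by apply: le_trans (ler_normB _ _) _; rewrite lerD2l.
have cC : compact C.
  apply: (subclosed_compact _ cB); last by move=> x; rewrite /B /C /= => ->.
  by move/continuous_closedP: nc => /(_ _ (@closed_eq _ p)).
have C0 : C !=set0.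
  (* any nonzero vector gives a point of the sphere *)
  have v0 : (const_mx 1 : 'rV[R]_n.+1) != 0.
    by apply/eqP => /rowP/(_ 0)/eqP; rewrite !mxE oner_eq0.
  move: (const_mx 1 : 'rV[R]_n.+1) v0 => v; rewrite -normr_gt0 => v0.
  exists (x0 + (p / `|v|) *: v); rewrite /C /= opprD addrA subrr add0r normrN normrZ.
  by rewrite normrM normfV normr_id (gtr0_norm p0) divfK// gt_eqF.
have cN y : {within B, continuous (fun x : 'rV[R]_n.+1 => sqnorm (F x - y))}.
  apply: continuous_in_subspaceT => x /set_mem Bx.
  apply: (@continuous_comp _ _ _ (fun x : 'rV[R]_n.+1 => F x - y) sqnorm); last exact: sqnorm_continuous.
  apply: (@cvgB _ _ _ (nbhs x) _ F (cst y)); last exact: cvg_cst.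
  exact/differentiable_continuous/dF/BU.
have CB : C `<=` B by move=> x; rewrite /B /C /= => ->.
have cNC : {within C, continuous (fun x : 'rV[R]_n.+1 => sqnorm (F x - F x0))}.
  exact: continuous_subspaceW CB (cN _).
have [c /set_mem cC_ cm] := EVT_min_rV C0 cC cNC.
set m := sqnorm _ in cm.
(* F takes the value F x0 only at x0, which is not on the sphere *)
have m0 : 0 < m.
  rewrite lt_neqAle sqnorm_ge0 andbT eq_sym; apply/eqP => /sqnorm_eq0/eqP.
  rewrite subr_eq0 => /eqP /(jF _ (BU _ (CB _ cC_))) E.
  by move: cC_; rewrite /C /= E subrr normr0 => /eqP; rewrite lt_eqF.
have : \forall y \near F x0, sqnorm (F x0 - y) < m / 4.
  have c1 : {for F x0, continuous (fun y : 'rV[R]_n.+1 => sqnorm (F x0 - y))}.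
    apply: (@continuous_comp _ _ _ (fun y : 'rV[R]_n.+1 => F x0 - y) sqnorm); last exact: sqnorm_continuous.
    by apply: (@cvgB _ _ _ (nbhs (F x0)) _ (cst (F x0)) id); [exact: cvg_cst|exact: cvg_id].
  apply: (cvgr_lt _ c1); rewrite subrr (_ : sqnorm 0 = 0) ?divr_gt0//.
  by rewrite /sqnorm big1// => j _; rewrite mxE mulr0.
apply: filterS => y ym.
have Bx0 : B x0 by rewrite /B /= subrr normr0 ltW.
have [x /set_mem Bx xm] := EVT_min_rV (ex_intro _ x0 Bx0) cB (cN y).
have xp : `|x0 - x| < p.
  rewrite lt_neqAle (Bx : is_true (_ <= _)) andbT; apply/eqP => Cx.
  have h1 := cm x (mem_set Cx); have h2 := sqnorm_quasi (F x - F x0) (y - F x0).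
  have h3 := xm x0 (mem_set Bx0).
  rewrite opprB addrA subrK in h2.
  have h4 : sqnorm (y - F x0) = sqnorm (F x0 - y).
    by rewrite /sqnorm; apply: eq_bigr => j _; rewrite !mxE; ring.
  rewrite h4 in h2.
  move: (sqnorm _) (sqnorm _) (sqnorm _) h1 h2 h3 ym => a b d; lra.
exists x; first exact: BU.
apply: (@sqnorm_min_critical B).
- apply/nbhs_ballP; exists (p - `|x0 - x|) => /=; first by rewrite subr_gt0.
  move=> z; rewrite -ball_normE /= => xz; rewrite /B /=.
  have -> : x0 - z = (x0 - x) + (x - z) by rewrite addrA subrK.
  by apply: le_trans (ler_normD _ _) _; rewrite -lerBrDl ltW.
- by move=> z /BU /dF.
- exact/iF/BU.
- by move=> z Bz; apply: xm; exact/mem_set.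
Qed.

End LocalSurjection.

(** * Subgroups of dimension three, and the theorem *)

Section ThreeEntries.
Context (R : realType).
Implicit Types A B M N : 'M[R]_2.

(** Coordinates on the part of SL_2 where the upper left entry is nonzero, and
    on its Lie algebra. *)
Definition entries3 M : 'rV[R]_3 :=
  \row_j nth 0 [:: M mxI mxI; M mxI mxII; M mxII mxI] j.

Lemma entries3_linear : linear entries3.
Proof.
by move=> k M N; apply/rowP => -[[|[|[|//]]] lt]; rewrite !mxE/=.
Qed.

Lemma entries3_continuous : continuous entries3.
Proof.
move=> M; apply: (continuous_mx (F := nbhs M)) => i j; rewrite mxE.
under eq_fun do rewrite mxE.
by case: j => [[|[|[|//]]] lt] /=; exact: coord_continuous.
Qed.

HB.instance Definition _ :=
  GRing.isLinear.Build R 'M[R]_2 'rV[R]_3 _ entries3 entries3_linear.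

Lemma entries3_eq M N : entries3 M = entries3 N ->
  [/\ M mxI mxI = N mxI mxI, M mxI mxII = N mxI mxII & M mxII mxI = N mxII mxI].
Proof.
move=> /rowP E; have h k (lt : (k < 3)%N) := E (Ordinal lt); move: h => h.
by split; [have := h 0 isT|have := h 1 isT|have := h 2 isT]; rewrite !mxE.
Qed.

Lemma entries3_traceless M N : M mxII mxII = - M mxI mxI ->
  N mxII mxII = - N mxI mxI -> entries3 M = entries3 N -> M = N.
Proof.
by move=> tM tN /entries3_eq[h1 h2 h3]; apply: mx2P; rewrite // tM tN h1.
Qed.

Lemma entries3_det A B : \det A = 1 -> \det B = 1 -> A mxI mxI != 0 ->
  entries3 A = entries3 B -> A = B.
Proof.
rewrite (mx2_eta A) (mx2_eta B) !det_mx2 => dA dB a0 /entries3_eq[].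
move: dA dB a0; rewrite !mx2E.
move: (A mxI mxI) (A mxI mxII) (A mxII mxI) (A mxII mxII) => a b c d.
move: (B mxI mxI) (B mxI mxII) (B mxII mxI) (B mxII mxII) => a' b' c' d'.
move=> dA dB a0 h1 h2 h3; move: dB; rewrite -h1 -h2 -h3 -dA => /addIr /(mulfI a0) ->.
by [].
Qed.

End ThreeEntries.

Section Dimension.
Context (R : realType) (d : nat) (H : manifold R d) (S : lie_group H).
Variable (iota : H -> 'M[R]_2).
Hypothesis data : lie_subgroup_data S iota.

(** The traceless matrices form a space of dimension 3. *)
Lemma lie_dim_le3 : (d <= 3)%N.
Proof.
have [i0 ie] := chart_dom_cover (lone S).
have l : linear (fun v => entries3 (lie_alg S iota i0 v)).
  by move=> k u v; rewrite (lie_alg_linear S iota i0 k u v) linearP.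
pose f : {linear 'rV[R]_d -> 'rV[R]_3} := HB.pack
  (fun v => entries3 (lie_alg S iota i0 v)) (GRing.isLinear.Build _ _ _ _ _ l).
apply: (inj_linear_le (f := f)) => u v uv; apply: (lie_alg_inj data ie).
exact: (entries3_traceless (lie_alg_trace data ie u) (lie_alg_trace data ie v) uv).
Qed.

End Dimension.

Section DimensionThree.
Context (R : realType) (H : manifold R 3) (S : lie_group H).
Variable (iota : H -> 'M[R]_2).
Hypothesis data : lie_subgroup_data S iota.

(** The entries of [entries3] are local coordinates of SL_2 at the identity, and
    those of a three-dimensional subgroup have an injective differential, so they
    take all values near those of the identity. *)
Lemma dim3_near1 : \forall y \near entries3 (1%:M : 'M[R]_2),
  forall A, \det A = 1 -> entries3 A = y -> exists x, iota x = A.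
Proof.
have [i0 ie] := chart_dom_cover (lone S); set x0 := chart i0 (lone S).
have ix : chart_image i0 x0 by exact: chart_image_dom.
pose f := iota \o chart_inv i0.
have fx0 : f x0 = 1%:M by rewrite /f /= chartK// (ld_one data).
pose U := [set x | chart_image i0 x /\ 0 < f x mxI mxI].
have cE : continuous (@entries3 R : {linear _ -> _}) by exact: entries3_continuous.
have dF x : chart_image i0 x -> differentiable (@entries3 R \o f) x /\
    forall v, 'd (@entries3 R \o f) x v = entries3 ('d f x v).
  by move=> iix; exact: (diff_linear_comp cE (ld_diff data iix)).
have : \forall y \near (@entries3 R \o f) x0,
    exists2 x, U x & (@entries3 R \o f) x = y.
  apply: local_surjection.
  - apply: filterI; first exact: chart_image_nbhs.
    have c1 : {for x0, continuous f}.
      exact/differentiable_continuous/(ld_diff data).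
    have c2 : continuous (fun M : 'M[R]_2 => M mxI mxI : R) by exact: coord_continuous.
    apply: (cvgr_gt _ (continuous_comp c1 (c2 _))).
    by rewrite /= -/(f x0) fx0 mx2_1 mx2E.
  - by move=> x [/dF[]].
  - move=> x [iix a0] u v uv; have [_ E] := dF x iix.
    apply: (ld_dinj data iix).
    have {}uv : entries3 ('d f x u) = entries3 ('d f x v).
      exact: etrans (esym (E u)) (etrans uv (E v)).
    have := det_deriv data u iix; have := det_deriv data v iix.
    have [e1 e2 e3] := entries3_eq uv.
    have fxE : iota (chart_inv i0 x) = f x by [].
    rewrite /= fxE; move: a0 e1 e2 e3.
    move: (f x) ('d f x u) ('d f x v) => M N P a0 e1 e2 e3.
    rewrite e1 e2 e3 => <- /addIr /(mulfI (negbT (gt_eqF a0))) e4.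
    exact: mx2P.
  - move=> x [iix a0] E.
    have := entries3_det (ld_det data _) (ld_det data _) (negbT (gt_eqF a0)) E.
    by move=> /(ld_inj data) /(congr1 (chart i0)); rewrite !chart_invK.
rewrite /= -/(f x0) fx0; apply: filterS => y [x [iix a0] <-] A dA EA.
exists (chart_inv i0 x); apply/esym.
have [a1 _ _] := entries3_eq EA.
apply: (entries3_det dA (ld_det data _) _ EA).
by rewrite a1; exact: negbT (gt_eqF a0).
Qed.

(** A one-parameter group of unipotent matrices is generated by its small
    elements. *)
Lemma dim3_unipotent (N : 'M[R]_2) : N *m N = 0 ->
  (forall u, \det (1%:M + u *: N) = 1) -> forall u, exists x, iota x = 1%:M + u *: N.
Proof.
move=> NN dN u; pose y (t : R) := entries3 (1%:M : 'M[R]_2) + t *: entries3 N.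
have yE t : y t = entries3 (1%:M + t *: N) by rewrite /y linearD linearZ.
have [D _] := is_derive_ray (entries3 (1%:M : 'M[R]_2)) (entries3 N) 0.
have c : {for (0 : R), continuous y}.
  exact/differentiable_continuous/derivable1_diffP.
have y0 : y 0 = entries3 (1%:M : 'M[R]_2) by rewrite /y scale0r addr0.
have near0 := dim3_near1; rewrite -y0 in near0.
have /nbhs_ballP[r /= r0 rP] := c _ near0.
(* t is small enough to be reached, and u = n t *)
pose n := (Num.bound (`|u| / r)).+1; pose t := u / n%:R.
have n0 : 0 < n%:R :> R by rewrite ltr0n.
have [x xt] : exists x, iota x = 1%:M + t *: N.
  apply: (rP t _ _ (dN t) (esym (yE t))).
  rewrite /ball/= sub0r normrN normrM normfV (gtr0_norm n0) ltr_pdivrMr//.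
  rewrite mulrC -ltr_pdivrMr// (lt_trans (archi_boundP _)) ?divr_ge0 ?(ltW r0)//.
  by rewrite ltr_nat.
have -> : u = n%:R * t by rewrite /t; field; rewrite gt_eqF.
elim: n {t n0} (t) xt => [|n IH] t xt.
  by exists (lone S); rewrite (ld_one data) mul0r scale0r addr0.
have [z zE] := IH _ xt; exists (lmul S x z); rewrite (ld_mul data) xt zE.
rewrite mulmxDl mul1mx mulmxDr mulmx1 -scalemxAl -scalemxAr NN !scaler0 addr0.
by rewrite -addrA -scalerDl -natr1 mulrDl mul1r.
Qed.

(** The small upper and lower unipotents are reached by [dim3_near1], hence all of
    them, and they generate SL_2. *)
Lemma dim3_range A : sl2_group A <-> exists x, iota x = A.
Proof.
split=> [|[x <-]]; last exact: ld_det data x.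
have uni (b c : R) : b * c = 0 -> forall u, exists x, iota x = mx2 1 (u * b) (u * c) 1.
  move=> bc u; have [||x xE] := @dim3_unipotent (mx2 0 b c 0) _ _ u.
  - by rewrite mulmx2; apply: mx2P; rewrite !mx2E ?mxE ?bc 1?mulrC ?bc; ring.
  - move=> t; rewrite mx2_1 (mx2_eta (_ + _)) det_mx2 !mxE/=.
    rewrite (_ : _ - _ = 1 - t * t * (b * c)); last by ring.
    by rewrite bc mulr0 subr0.
  by exists x; rewrite xE mx2_1; apply: mx2P; rewrite !mxE/=; ring.
apply: (sl2_generated (H := fun A => exists x, iota x = A)).
- by move=> M N [x <-] [y <-]; exists (lmul S x y); rewrite (ld_mul data).
- move=> u; have [|x xE] := uni 1 0 _ u; first by rewrite mulr0.
  by exists x; rewrite xE mulr1 mulr0.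
- move=> u; have [|x xE] := uni 0 1 _ u; first by rewrite mul0r.
  by exists x; rewrite xE mulr1 mulr0.
Qed.

End DimensionThree.

Lemma conj_mx1 (R : realType) (M : 'M[R]_2) : conj_mx 1%:M M = M.
Proof. by rewrite /conj_mx invmx1 mul1mx mulmx1. Qed.

(** It is enough to recognize the subgroup after a change of basis. *)
Lemma realizable_conj (R : realType) (T : Type) (iota : T -> 'M[R]_2)
    (G0 : set 'M[R]_2) (Q : 'M[R]_2) : realizable G0 -> Q \in unitmx ->
  (forall A, G0 A <-> exists x, conj_mx Q (iota x) = A) ->
  exists D : manifold_with_density R 2, weighted_holonomy_is D (range iota).
Proof.
move=> rG uQ GE; have [D hD] := rG Q uQ; exists D.
rewrite (_ : range iota = [set A | G0 (Q *m A *m invmx Q)])//.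
apply/seteqP; split=> [_ [x _ <-]|A /GE[x]] /=; first by apply/GE; exists x.
by move=> /(conj_mx_inj uQ) <-; exists x.
Qed.

Theorem theorem1p1 (R : realType) (G : set 'M[R]_2)
    (hG : connected_lie_subgroup_SL G) :
  exists D : manifold_with_density R 2, weighted_holonomy_is D G.
Proof.
have [dG [d [H [S [iota [cH hom inj imm rG]]]]]] := hG.
have data : lie_subgroup_data S iota.
  split=> // [i x ix|x]; last by apply: dG; rewrite -rG; exists x.
  have [sm dinj] := imm i; split; last exact: dinj.
  by have [dif _] := sm 1%N; exact: dif.
rewrite -rG; have d3 := lie_dim_le3 data.
have u1 : (1%:M : 'M[R]_2) \in unitmx by exact: unitmx1.
case: d H S iota cH hom inj imm rG data d3 => [|[|[|[|//]]]]
  H S iota _ _ _ _ _ data _.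
- apply: (realizable_conj (@trivial_realizable R) u1) => A.
  rewrite (dim0_range data).
  by split=> -[x <-]; exists x; rewrite conj_mx1.
- have [i0 ie] := chart_dom_cover (lone S).
  have X0 : lie_alg S iota i0 (const_mx 1) != 0.
    apply/eqP => X0; have : const_mx 1 = 0 :> 'rV[R]_1.
      by apply: (lie_alg_inj data ie); rewrite X0 /lie_alg linear0.
    by move=> /rowP/(_ ord0)/eqP; rewrite !mxE oner_eq0.
  have [Q [k [d [uQ k0 d_ QX]]]] :=
    traceless_normal_form (lie_alg_trace data ie _) X0.
  have hX : lie_alg S (conj_mx Q \o iota) i0 (const_mx 1) = k *: companion d.
    by rewrite (lie_alg_conj data Q ie).
  have cdata := conj_data data uQ.
  case: d_ => [|[]] dE; rewrite dE in hX.
  + apply: (realizable_conj (@parabolic_realizable R) uQ) => A.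
    exact: (dim1_range_le0 cdata ie k0 hX A (lexx 0)).
  + apply: (realizable_conj (@elliptic_realizable R) uQ) => A.
    exact: (dim1_range_rot cdata ie k0 hX A).
  + apply: (realizable_conj (@hyperbolic_realizable R) uQ) => A.
    by apply: (dim1_range_le0 cdata ie k0 hX A); rewrite lerN10.
- have [Q uQ QE] := dim2_range data.
  exact: (realizable_conj (@borel_realizable R) uQ QE).
- apply: (realizable_conj (@SL2_realizable R) u1) => A.
  rewrite (dim3_range data).
  by split=> -[x <-]; exists x; rewrite conj_mx1.
Qed.
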